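(* Let $N\ge2$, $0<s<1$ and $1<p<p_c=2N/(N+s)$. For every initial function $u_0\ge0$ such that $$u_0(x)\le A|x|^{-sp/(2-p)}$$ for some $A>0$, the solution of $\partial_tu+\mathcal L_{s,p}u=0$ with initial data $u_0$ becomes extinct in finite time. More precisely, its extinction time $T$ satisfies $T\le(A/C_\infty)^{2-p}$.
   Context: Let $\Phi_p(z)=|z|^{p-2}z$ and $\mathcal L_{s,p}(u)(x)=P.V.\int_{\mathbb R^N}\frac{\Phi_p(u(x)-u(y))}{|x-y|^{N+sp}}\,dy$. In $L^2(\mathbb R^N)$ it is the subdifferential of the convex functional $J(u)=\frac1{2p}\iint\frac{|u(x)-u(y)|^p}{|x-y|^{N+sp}}\,dxdy$; it generates a contraction semigroup $S_t$ which extends to an order-preserving contraction semigroup on every $L^q(\mathbb R^N)$, $1\le q<\infty$; semigroup solutions are $S_tu_0$ with $u_0\in L^q(\mathbb R^N)$. For more general nonnegative $u_0$, the solution is the minimal solution $u=\lim_nu_n$, where $u_n$ are the semigroup solutions with data any nondecreasing sequence $0\le u_{0,n}\in L^1(\mathbb R^N)\cap L^\infty(\mathbb R^N)$ converging monotonically to $u_0$. The extinction time of $u$ is the first time $T$ such that $u(\cdot,t)\equiv0$ for $t\ge T$. The constant $C_\infty=C_\infty(s,p,N)>0$ is the constant, existing for $1<p<p_c$, such that for every $T>0$ the function $U(x,t)=C_\infty(T-t)^{1/(2-p)}|x|^{-sp/(2-p)}$ is a solution of the equation for $0<t<T$, $x\ne0$. *)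

(* Defs.v *)
From HB Require Import structures.
From mathcomp Require Import all_boot all_order all_algebra.
From mathcomp Require Import all_classical all_reals all_analysis.

Set Implicit Arguments.
Unset Strict Implicit.
Unset Printing Implicit Defensive.

Import Order.TTheory GRing.Theory Num.Theory.
Import numFieldNormedType.Exports.

Local Open Scope classical_set_scope.
Local Open Scope ring_scope.

(** R^N is [N.-tuple R] with its product sigma-algebra.  Its Lebesgue measure is
    built by recursion on N: R^(n+1) is identified with R * R^n by [cons_pt]. *)
Section lebesgue_measure_tuple.
Variable R : realType.

Definition cons_pt n (z : measurableTypeR R * n.-tuple R) : n.+1.-tuple R :=
  [tuple of z.1 :: z.2].

Lemma measurable_cons_pt n : measurable_fun setT (@cons_pt n).
Proof. by apply: measurable_cons. Qed.

Definition uncons_pt n (x : n.+1.-tuple R) : measurableTypeR R * n.-tuple R :=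
  (thead x, [tuple of behead x]).

Lemma measurable_uncons_pt n : measurable_fun setT (@uncons_pt n).
Proof.
apply/measurable_fun_pairP; split; last exact: measurable_behead.
exact: measurable_tnth.
Qed.

Lemma cons_ptK n : cancel (@cons_pt n) (@uncons_pt n).
Proof. by case=> a x; congr pair; exact: val_inj. Qed.

Section step.
Variables (n : nat) (mu : {sigma_finite_measure set (n.-tuple R) -> \bar R}).

Definition leb_step : set (n.+1.-tuple R) -> \bar R :=
  pushforward (@lebesgue_measure R \x mu)%E (@cons_pt n).

Let leb_step0 : leb_step set0 = 0%E.
Proof. by rewrite /leb_step /pushforward preimage_set0 measure0. Qed.

Let leb_step_ge0 A : (0 <= leb_step A)%E.
Proof. by rewrite /leb_step /pushforward; exact: measure_ge0. Qed.

Let leb_step_sigma_additive : semi_sigma_additive leb_step.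
Proof.
move=> F mF tF mUF; rewrite /leb_step /pushforward preimage_bigcup.
have mcons B : measurable B -> measurable (@cons_pt n @^-1` B).
  by move=> mB; rewrite -[X in measurable X]setTI; exact: measurable_cons_pt.
apply: measure_semi_sigma_additive.
- by move=> k; exact: mcons.
- apply/trivIsetP => /= i j _ _ ij; rewrite -preimage_setI.
  by move/trivIsetP : tF => /(_ _ _ _ _ ij) ->//; rewrite preimage_set0.
- by rewrite -preimage_bigcup; exact: mcons.
Qed.

HB.instance Definition _ := isMeasure.Build _ _ _
  leb_step leb_step0 leb_step_ge0 leb_step_sigma_additive.

Let leb_step_sigma_finite : sigma_finite setT leb_step.
Proof.
have /sigma_finiteP[F [TF ndF Foo]] := sigma_finiteT (@lebesgue_measure R).
have /sigma_finiteP[G [TG ndG Goo]] := sigma_finiteT mu.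
exists (fun k => @uncons_pt n @^-1` (F k `*` G k)).
  rewrite -preimage_bigcup (_ : \bigcup_i _ = setT) ?preimage_setT//.
  rewrite predeqE => -[x y]; split => // _.
  have [k _ Fkx] : (\bigcup_i F i) x by rewrite -TF.
  have [l _ Gly] : (\bigcup_i G i) y by rewrite -TG.
  exists (maxn k l) => //; split.
  - by move: x Fkx; exact/subsetPset/ndF/leq_maxl.
  - by move: y Gly; exact/subsetPset/ndG/leq_maxr.
move=> k; have [mF Fk] := Foo k; have [mG Gk] := Goo k; split.
  rewrite -[X in measurable X]setTI; apply: measurable_uncons_pt => //.
  exact: measurableX.
rewrite /leb_step /pushforward -comp_preimage (_ : _ \o _ = id); last first.
  by apply/funext => z; exact: cons_ptK.
by rewrite preimage_id product_measure1E// lte_mul_pinfty// ge0_fin_numE.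
Qed.

HB.instance Definition _ :=
  Measure_isSigmaFinite.Build _ _ _ leb_step leb_step_sigma_finite.
End step.

Fixpoint leb N : {sigma_finite_measure set (N.-tuple R) -> \bar R} :=
  if N is n.+1 then leb_step (leb n) else \d_([tuple]).

Lemma leb_box N (A : 'I_N -> set (measurableTypeR R)) :
  (forall i, measurable (A i)) ->
  leb N [set x | forall i, A i (tnth x i)] =
  (\prod_(i < N) lebesgue_measure (A i))%E.
Proof.
elim: N A => [|n IH] A mA.
  by rewrite big_ord0 /= diracE mem_set// => -[].
rewrite big_ord_recl -IH; last by move=> i; exact: mA.
rewrite -product_measure1E//; last first.
  rewrite (_ : mkset _ =
      \bigcap_(i in [set: 'I_n]) ((@tnth n R ^~ i) @^-1` A (lift ord0 i))).
    apply: fin_bigcap_measurable => // i _.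
    by rewrite -[X in measurable X]setTI; apply: measurable_tnth => //; exact: mA.
  by apply/seteqP; split => [x Ax i _|x Ax i]; exact: Ax.
rewrite /= /leb_step /pushforward; congr (_ _).
apply/seteqP; split => [[a x] Aax|[a x] [/= Aa Ax] i].
  split => [|i]; first by have := Aax ord0.
  by have := Aax (lift ord0 i); rewrite /= tnthS.
by case: (unliftP ord0 i) => [j ->|->]; [rewrite tnthS; exact: Ax|].
Qed.

End lebesgue_measure_tuple.

Arguments leb : clear implicits.

Section fractional_p_Laplacian.
Variables (R : realType) (N : nat).
Implicit Types (s p q t : R) (x y : N.-tuple R).

Local Notation mu := (leb R N).

Definition eucl_dist x y : R :=
  Num.sqrt (\sum_(i < N) (tnth x i - tnth y i) ^+ 2).

Definition eucl_norm x : R := Num.sqrt (\sum_(i < N) tnth x i ^+ 2).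

Definition Phi p (z : R) : R := `|z| `^ (p - 2) * z.

Definition pL_kernel s p (f : N.-tuple R -> R) x y : R :=
  Phi p (f x - f y) / eucl_dist x y `^ (N%:R + s * p).

(** [is_PV s p f x l]: the principal value defining L_(s,p)(f)(x) exists and
    equals [l].  The truncated integrals are required to converge absolutely,
    since [Rintegral] is total. *)
Definition is_PV s p (f : N.-tuple R -> R) x (l : R) : Prop :=
  (forall e, 0 < e ->
     mu.-integrable [set y | e < eucl_dist x y] (EFin \o pL_kernel s p f x)) /\
  (\int[mu]_(y in [set y | e < eucl_dist x y]) pL_kernel s p f x y)%R
    @[e --> 0^'+] --> l.

Definition singular_solution s p C T t x : R :=
  C * (T - t) `^ (2 - p)^-1 * eucl_norm x `^ (- (s * p / (2 - p))).

Definition is_C_infty s p C : Prop :=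
  0 < C /\
  forall T, 0 < T -> forall t x, 0 < t < T -> eucl_norm x != 0 ->
    exists l, is_PV s p (singular_solution s p C T t) x l /\
      is_derive t 1 (fun r => singular_solution s p C T r x) (- l).

Definition energy s p (f : N.-tuple R -> R) : \bar R :=
  ((2 * p)^-1%:E * \int[(mu \x mu)%E]_z
    (`|f z.1 - f z.2| `^ p / eucl_dist z.1 z.2 `^ (N%:R + s * p))%:E)%E.

Definition in_subdiff s p (f w : N.-tuple R -> R) : Prop :=
  [/\ f \in Lfun mu 2%:E, w \in Lfun mu 2%:E, (energy s p f < +oo)%E &
    forall g, g \in Lfun mu 2%:E ->
      (energy s p f + (\int[mu]_x (w x * (g x - f x)))%R%:E
        <= energy s p g)%E].

Definition norm_dist q (f g : N.-tuple R -> R) : \bar R :=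
  'N[mu]_(q%:E)[EFin \o (f \- g)].

Definition L2_derivative (u : R -> N.-tuple R -> R) t (w : N.-tuple R -> R) :=
  w \in Lfun mu 2%:E /\
  norm_dist 2 (fun x => (u (t + h) x - u t x) / h) w @[h --> 0^'] --> 0%E.

(** [u] is the trajectory t |-> S_t u0 of the gradient flow of [energy s p] in
    L^2, i.e. the curve singled out by Brezis' theorem on semigroups generated by
    subdifferentials: continuous on [0, oo), Lipschitz on [d, oo) for every d > 0,
    and - u'(t) is a subgradient at u(t) for almost every t > 0. *)
Definition L2_semigroup_solution s p (u0 : N.-tuple R -> R)
    (u : R -> N.-tuple R -> R) : Prop :=
  [/\ u0 \in Lfun mu 2%:E,
      forall t, 0 <= t -> u t \in Lfun mu 2%:E,
      {ae mu, forall x, u 0 x = u0 x},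
      forall t, 0 <= t ->
        norm_dist 2 (u r) (u t) @[r --> within [set r | 0 <= r] (nbhs t)]
          --> 0%E &
      (forall d, 0 < d -> exists K : R, forall a b, d <= a -> d <= b ->
         (norm_dist 2 (u a) (u b) <= (K * `|a - b|)%:E)%E) /\
      {ae @lebesgue_measure R, forall t, 0 < t ->
         exists w, L2_derivative u t w /\ in_subdiff s p (u t) (\- w)}].

(** The extension of the semigroup to L^q: by contractivity, S_t u0 is the L^q
    limit of S_t f_n for f_n in L^q `&` L^2 converging to u0 in L^q. *)
Definition Lq_semigroup_solution s p q (u0 : N.-tuple R -> R)
    (u : R -> N.-tuple R -> R) : Prop :=
  [/\ u0 \in Lfun mu q%:E,
      forall t, 0 <= t -> u t \in Lfun mu q%:E &
      exists (f : nat -> N.-tuple R -> R) (v : nat -> R -> N.-tuple R -> R),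
      [/\ forall n, f n \in Lfun mu q%:E,
          forall n, L2_semigroup_solution s p (f n) (v n),
          norm_dist q (f n) u0 @[n --> \oo] --> 0%E &
          forall t, 0 <= t -> norm_dist q (v n t) (u t) @[n --> \oo] --> 0%E]].

(** A monotone limit may a priori be infinite, hence values in [\bar R]. *)
Definition minimal_solution s p (u0 : N.-tuple R -> R)
    (u : R -> N.-tuple R -> \bar R) : Prop :=
  {ae mu, forall x, 0 <= u0 x} /\
  exists (f : nat -> N.-tuple R -> R) (v : nat -> R -> N.-tuple R -> R),
  [/\ forall n, f n \in Lfun mu 1%E /\ f n \in Lfun mu +oo%E,
      {ae mu, forall x, forall n, 0 <= f n x <= f n.+1 x},
      {ae mu, forall x, f n x @[n --> \oo] --> u0 x},
      forall n, L2_semigroup_solution s p (f n) (v n) &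
      forall t, 0 <= t ->
        {ae mu, forall x, (v n t x)%:E @[n --> \oo] --> u t x}].

Definition is_solution s p (u0 : N.-tuple R -> R)
    (u : R -> N.-tuple R -> \bar R) : Prop :=
  (exists q v, [/\ 1 <= q, Lq_semigroup_solution s p q u0 v &
     forall t, 0 <= t -> {ae mu, forall x, u t x = (v t x)%:E}]) \/
  minimal_solution s p u0 u.

Definition vanishes_from (u : R -> N.-tuple R -> \bar R) T : Prop :=
  forall t, T <= t -> {ae mu, forall x, u t x = 0%E}.

Definition is_extinction_time (u : R -> N.-tuple R -> \bar R) T : Prop :=
  [/\ 0 <= T, vanishes_from u T &
      forall T', 0 <= T' -> vanishes_from u T' -> T <= T'].

End fractional_p_Laplacian.

(* Main.v *)
Require Import Defs.
From HB Require Import structures.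
From mathcomp Require Import all_boot all_order all_algebra.
From mathcomp Require Import all_classical all_reals all_analysis.
From mathcomp Require Import measurable_realfun ring lra.

(** Let [U] be the singular solution of amplitude [C * (T' - t) `^ (2 - p)^-1].  Its
    initial value dominates the datum as soon as [T' >= (A / C) `^ (2 - p)], and it
    vanishes at the time [T'].  So the theorem is a comparison principle between a
    solution [u] and [U]; as [- u] is also a solution, comparing both [u] and [- u]
    with [U] gives [u = 0] from that time on.

    The comparison takes place in the weak framework of the gradient flow.  The
    barrier is [V = min U M], which is bounded and Lipschitz; the increasing limit
    in [M] is taken at the end.  The excess is measured by the integral of
    [huber (u - V - delta)]: its derivative [clip01 (u - V - delta)] takes values
    in [0, 1] and lives on a set of finite measure, hence is an admissible test
    function for the subdifferential of the energy.  Four facts carry the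
    argument.

    First, the nonlocal operator at [V] is at least minus the time derivative of
    [V]: where [V = U] because [V <= U] touches [U] there and [U] solves the
    equation, and on the plateau because [V] is maximal there.  The principal
    values are bounded uniformly enough to be integrated: [U] is homogeneous and
    radial, so that a bound for the truncated operator at a single point is carried
    to all others by similarities ([homogeneous_truncated_pL_bounded]).

    Second, the subgradient inequality tested with the truncated excess puts the
    operator on [V] instead of [u] ([barrier_energy_inequality]): the distant pairs
    of points are treated by convexity of the power [p], and the close ones carry
    an arbitrarily small part of the energy.

    Third, these two facts give a left difference quotient for the excess which is
    at most [e], for every [e > 0] and almost every time.  The excess is locally
    Lipschitz from one side in time, so it is nonincreasing
    ([left_dini_nonincreasing], [huber_excess_nonincreasing],
    [barrier_comparison]).

    Fourth, semigroup solutions in L^q and minimal solutions are limits of those in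
    L^2.  The excess beyond a height [delta > 0] is controlled by convergence in any
    L^q, so that the comparison passes to the limit as a statement on measures of
    superlevel sets ([Lq_limit_nonpositive]); minimal solutions are treated through
    their approximations, which have smaller data.

    It remains to see that the infimum of the times from which [u] vanishes is
    attained.  This is the continuity of [u] in time, known in L^2.  In L^q it follows
    from the contraction property of the semigroup, which is the same energy
    argument with two solutions ([subdiff_T_monotone], [L2_T_contraction],
    [Lq_vanishing_right_closed]); a minimal solution dominates its approximations in
    L^2, which vanish with it. *)

Set Implicit Arguments.
Unset Strict Implicit.
Unset Printing Implicit Defensive.

Import Order.TTheory GRing.Theory Num.Theory.
Import numFieldNormedType.Exports.

Local Open Scope classical_set_scope.
Local Open Scope ring_scope.

(** * Convexity inequalities for powers of absolute values *)

Section scalar_inequalities.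
Context {R : realType}.
Implicit Types (a b c p x y z : R).

Lemma Phi0 p : Phi p 0 = 0 :> R.
Proof. by rewrite /Phi mulr0. Qed.

Lemma PhiN p z : Phi p (- z) = - Phi p z.
Proof. by rewrite /Phi normrN mulrN. Qed.

Lemma Phi_ge0E p z : 1 < p -> 0 <= z -> Phi p z = z `^ (p - 1).
Proof.
move=> p1; rewrite le_eqVlt => /predU1P[<-|z0].
  by rewrite Phi0 powR0// subr_eq0 gt_eqF.
rewrite /Phi gtr0_norm// -{2}(powRr1 (ltW z0)) -powRD; last first.
  by rewrite (gt_eqF z0) implybT.
by congr (_ `^ _); lra.
Qed.

Lemma normr_Phi p z : 1 < p -> `|Phi p z| = `|z| `^ (p - 1).
Proof.
move=> p1; rewrite -(Phi_ge0E p1)// /Phi normrM (ger0_norm (powR_ge0 _ _)).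
by rewrite normr_id.
Qed.

Lemma Phi_ge0 p z : 0 <= z -> 0 <= Phi p z.
Proof. by move=> z0; rewrite /Phi mulr_ge0 ?powR_ge0. Qed.

Lemma Phi_homo p : 1 < p -> {homo Phi p : x y / x <= y}.
Proof.
move=> p1 x y xy.
have pos u v : 0 <= u -> u <= v -> Phi p u <= Phi p v.
  move=> u0 uv; have v0 := le_trans u0 uv.
  rewrite !Phi_ge0E// ge0_ler_powR// ?nnegrE//; lra.
have [x0|x0] := leP 0 x; first exact: pos.
have [y0|y0] := leP 0 y.
  apply: (@le_trans _ _ 0); last exact: Phi_ge0.
  by rewrite -oppr_ge0 -PhiN Phi_ge0//; lra.
by rewrite -lerN2 -!PhiN; apply: pos; lra.
Qed.

Lemma PhiM p a z : 1 < p -> 0 <= a -> Phi p (a * z) = a `^ (p - 1) * Phi p z.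
Proof.
move=> p1 a0; rewrite {1}/Phi normrM powRM// (ger0_norm a0) mulrACA.
by congr (_ * _); rewrite -(Phi_ge0E p1 a0) /Phi ger0_norm.
Qed.

(** Convexity of |z|^p, whose derivative is p Phi(z): it is Young's inequality
    t s^(p-1) <= t^p / p + s^p / p', with p' the conjugate exponent of p. *)
Lemma normr_powR_tangent p a b : 1 < p ->
  `|b| `^ p + p * Phi p b * (a - b) <= `|a| `^ p.
Proof.
move=> p1; have p0 : 0 < p by lra.
have q0 : 0 < p / (p - 1) by rewrite divr_gt0//; lra.
have := @conjugate_powR _ `|a| (`|b| `^ (p - 1)) p (p / (p - 1))
  (normr_ge0 _) (powR_ge0 _ _) p0 q0.
have -> : p^-1 + (p / (p - 1))^-1 = 1 by field; rewrite ?subr_eq0 ?gt_eqF.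
move=> /(_ erefl); rewrite -powRrM (_ : (p - 1) * (p / (p - 1)) = p); last first.
  by field; rewrite subr_eq0 gt_eqF.
have -> : `|b| `^ p / (p / (p - 1)) = `|b| `^ p * (p - 1) / p.
  by field; rewrite ?subr_eq0 ?gt_eqF.
rewrite -mulrDl ler_pdivlMr// => Y.
have bb : Phi p b * b = `|b| `^ p.
  rewrite /Phi -mulrA -expr2 -real_normK ?num_real// expr2 mulrA.
  have := Phi_ge0E p1 (normr_ge0 b); rewrite /Phi normr_id => ->.
  by rewrite mulrC mulr_powRB1.
have ba : Phi p b * a <= `|a| * `|b| `^ (p - 1).
  rewrite -normr_Phi// mulrC; apply: le_trans (ler_norm _) _.
  by rewrite normrM.
have : p * (Phi p b * a) <= p * (`|a| * `|b| `^ (p - 1)) by rewrite ler_pM2l.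
rewrite (_ : p * Phi p b * (a - b) = p * (Phi p b * a) - p * (Phi p b * b)); last by ring.
rewrite bb.
lra.
Qed.

(** The relation between an increment of a truncated function and the increment
    of the function itself. *)
Definition between0 c z := 0 <= c <= z \/ z <= c <= 0.

Lemma between0_norm c a b : between0 c (a - b) ->
  `|a - c| <= Num.max `|a| `|b|.
Proof.
rewrite le_max => -[/andP[c0 cz]|/andP[cz c0]]; apply/orP;
  have [ac|ac] := leP 0 (a - c).
- by left; rewrite ger0_norm//; have := ler_norm a; lra.
- right; rewrite ltr0_norm//; have := ler_norm (- b); rewrite normrN; lra.
- by right; rewrite ger0_norm//; have := ler_norm b; lra.
- left; rewrite ltr0_norm//; have := ler_norm (- a); rewrite normrN; lra.
Qed.

(** The convexity inequality at [a - c], where [Phi p (a - c)] may be replaced by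
    [Phi p b] because [a - c] lies between [b] and [a].  With [a], [b],
    [c] the increments of a solution, of a barrier and of the truncated excess, the
    operator applied to the barrier appears in place of that of the solution. *)
Lemma normr_powR_sub p a b c : 1 < p -> between0 c (a - b) ->
  `|a - c| `^ p - `|a| `^ p <= - (p * (Phi p b * c)).
Proof.
move=> p1 cab; have := @normr_powR_tangent p a (a - c) p1.
rewrite (_ : a - (a - c) = c); last by ring.
suff : p * (Phi p b * c) <= p * Phi p (a - c) * c by lra.
rewrite -mulrA ler_pM2l; last by lra.
case: cab => /andP[h1 h2].
  by apply: ler_wpM2r => //; apply: Phi_homo => //; lra.
by apply: ler_wnM2r => //; apply: Phi_homo => //; lra.
Qed.

Lemma powR_between p a b c : 0 <= p -> between0 c (a - b) ->
  `|a - c| `^ p <= `|a| `^ p + `|b| `^ p.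
Proof.
move=> p0 /between0_norm; rewrite le_max => /orP[] h.
  by rewrite ler_wpDr ?powR_ge0// ge0_ler_powR ?nnegrE.
by rewrite ler_wpDl ?powR_ge0// ge0_ler_powR ?nnegrE.
Qed.

(** [a - c] and [b + c] are the two points of a symmetric pair between [a] and
    [b]; exchanging them replaces [c] by [a - b - c], so that one may assume that
    they lie in the same order as [a] and [b].  Then the two tangent inequalities,
    once added, conclude by monotonicity of [Phi p]. *)
Lemma normr_powR_exchange p a b c : 1 < p -> between0 c (a - b) ->
  `|a - c| `^ p + `|b + c| `^ p <= `|a| `^ p + `|b| `^ p.
Proof.
move=> p1.
suff half d : between0 d (a - b) -> 0 <= d * (a - b - d - d) ->
    `|a - d| `^ p + `|b + d| `^ p <= `|a| `^ p + `|b| `^ p.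
  move=> cab; have [h|h] := leP 0 (c * (a - b - c - c)); first exact: half.
  have := half (a - b - c).
  rewrite (_ : a - (a - b - c) = b + c); last by ring.
  rewrite (_ : b + (a - b - c) = a - c); last by ring.
  move=> H; rewrite addrC; apply: H.
    by case: cab => /andP[h1 h2]; [left|right]; lra.
  case: cab => /andP[h1 h2].
    by apply: mulr_ge0; [lra|rewrite leNgt; apply/negP => ?; nra].
  by apply: mulr_le0; [lra|rewrite leNgt; apply/negP => ?; nra].
move=> dab hd.
have h1 := @normr_powR_tangent p a (a - d) p1.
have h2 := @normr_powR_tangent p b (b + d) p1.
suff : 0 <= p * (d * (Phi p (a - d) - Phi p (b + d))) by lra.
apply: mulr_ge0; first by lra.
case: dab => /andP[h3 h4].
  rewrite mulr_ge0// subr_ge0.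
  have [->|d0] := eqVneq d 0.
    by apply: Phi_homo => //; lra.
  by apply: Phi_homo => //; rewrite pmulr_rge0 in hd; lra.
rewrite mulr_le0// subr_le0.
have [->|d0] := eqVneq d 0.
  by apply: Phi_homo => //; lra.
by apply: Phi_homo => //; rewrite nmulr_rge0 in hd; lra.
Qed.

Lemma measurable_Phi p : measurable_fun setT (@Phi R p).
Proof.
apply: measurable_funM => //.
exact: (measurableT_comp (measurable_powR _)).
Qed.

End scalar_inequalities.

(** * The Huber function *)

Section huber.
Context {R : realType}.
Implicit Types (y z : R).

Definition clip01 z : R := Num.min (Num.max z 0) 1.

(** A convex primitive of [clip01].  It is quadratic near [0], hence integrable
    along square-integrable functions, and of linear growth, hence controlled by
    the L^1 norm of the positive part. *)
Definition huber z : R := clip01 z * z - clip01 z ^+ 2 / 2.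

Lemma clip01_cases z : [\/ z <= 0 /\ clip01 z = 0, 0 <= z <= 1 /\ clip01 z = z |
  1 <= z /\ clip01 z = 1].
Proof.
rewrite /clip01 /Num.min /Num.max.
have [z0|z0] := ltP z 0; first by apply: Or31; rewrite ltr01; split; [lra|].
by have [z1|z1] := ltP z 1; [apply: Or32|apply: Or33]; split => //; lra.
Qed.

Lemma clip01_ge0 z : 0 <= clip01 z.
Proof. by have [[? ->]|[? ->]|[? ->]] := clip01_cases z; lra. Qed.

Lemma clip01_le1 z : clip01 z <= 1.
Proof. by have [[? ->]|[? ->]|[? ->]] := clip01_cases z; lra. Qed.

Lemma clip01_le0 z : z <= 0 -> clip01 z = 0.
Proof. by have [[? ->]|[? ->]|[? ->]] := clip01_cases z; lra. Qed.

Lemma clip01_le_normr z : clip01 z <= `|z|.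
Proof.
by have := ler_norm z; have := normr_ge0 z;
  have [[? ->]|[? ->]|[? ->]] := clip01_cases z; lra.
Qed.

Lemma between0_clip01 y z : between0 (clip01 y - clip01 z) (y - z).
Proof.
rewrite /between0.
by have [[? ->]|[? ->]|[? ->]] := clip01_cases y;
   have [[? ->]|[? ->]|[? ->]] := clip01_cases z; lra.
Qed.

Lemma huber_le0 z : z <= 0 -> huber z = 0.
Proof. by move=> z0; rewrite /huber clip01_le0// mul0r expr0n/= mul0r subr0. Qed.

Lemma huber_ge0 z : 0 <= huber z.
Proof. by rewrite /huber; have [[? ->]|[? ->]|[? ->]] := clip01_cases z; nra. Qed.

Lemma huber_gt0 z : 0 < z -> 0 < huber z.
Proof. by rewrite /huber; have [[? ->]|[? ->]|[? ->]] := clip01_cases z; nra. Qed.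

Lemma huber_le_normr z : huber z <= `|z|.
Proof.
have := ler_norm z; have := normr_ge0 z.
by rewrite /huber; have [[? ->]|[? ->]|[? ->]] := clip01_cases z; nra.
Qed.

Lemma huber_le_sqr z : huber z <= z ^+ 2.
Proof. by rewrite /huber; have [[? ->]|[? ->]|[? ->]] := clip01_cases z; nra. Qed.

Lemma huber_tangent y z : huber y - huber z <= clip01 y * (y - z).
Proof.
(* [huber z] is the maximum of [k * z - k ^+ 2 / 2] over [k] in [0, 1]. *)
suff : clip01 y * z - clip01 y ^+ 2 / 2 <= huber z by rewrite {2}/huber; lra.
rewrite /huber; have := clip01_ge0 y; have := clip01_le1 y.
move: (clip01 y) => k k1 k0.
have [[h ->]|[h ->]|[h ->]] := clip01_cases z.
- by have : k * z <= 0 by [rewrite mulr_ge0_le0]; have := sqr_ge0 k; lra.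
- by have := sqr_ge0 (z - k); lra.
- have : 0 <= (1 - k) * (z - 1) by rewrite mulr_ge0//; lra.
  by have := sqr_ge0 (1 - k); lra.
Qed.

Lemma huber_homo : {homo huber : y z / y <= z}.
Proof.
move=> y z yz; have := @huber_tangent y z; have := clip01_ge0 y; nra.
Qed.

Lemma measurable_clip01 : measurable_fun setT clip01.
Proof. by apply: measurable_minr => //; exact: measurable_maxr. Qed.

Lemma measurable_huber : measurable_fun setT huber.
Proof.
apply: measurable_funB.
  by apply: measurable_funM => //; exact: measurable_clip01.
by apply: measurable_funM => //; apply: measurable_funX; exact: measurable_clip01.
Qed.

End huber.

(** * Euclidean geometry of tuples *)

Section euclidean_space.
Context {R : realType} {N : nat}.
Implicit Types (x y z h : N.-tuple R) (l : R).

Definition taddt x y : N.-tuple R := [tuple tnth x i + tnth y i | i < N].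
Definition tscale l x : N.-tuple R := [tuple l * tnth x i | i < N].
Definition toppt x : N.-tuple R := tscale (-1) x.
Definition tdot x y : R := \sum_(i < N) tnth x i * tnth y i.

Lemma tnth_taddt x y i : tnth (taddt x y) i = tnth x i + tnth y i.
Proof. by rewrite tnth_mktuple. Qed.

Lemma tnth_tscale l x i : tnth (tscale l x) i = l * tnth x i.
Proof. by rewrite tnth_mktuple. Qed.

Lemma tnth_toppt x i : tnth (toppt x) i = - tnth x i.
Proof. by rewrite tnth_mktuple mulN1r. Qed.

Definition tnthE := (tnth_taddt, tnth_toppt, tnth_tscale).

Lemma tscaleA a b x : tscale a (tscale b x) = tscale (a * b) x.
Proof. by apply: eq_from_tnth => i; rewrite !tnthE mulrA. Qed.

Lemma tscale1 x : tscale 1 x = x.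
Proof. by apply: eq_from_tnth => i; rewrite !tnthE mul1r. Qed.

Lemma taddtC x y : taddt x y = taddt y x.
Proof. by apply: eq_from_tnth => i; rewrite !tnthE addrC. Qed.

Lemma taddtK x y : taddt (taddt x y) (toppt y) = x.
Proof. by apply: eq_from_tnth => i; rewrite !tnthE addrK. Qed.

Lemma taddtNK x y : taddt (taddt x (toppt y)) y = x.
Proof. by apply: eq_from_tnth => i; rewrite !tnthE subrK. Qed.

Lemma tdotC x y : tdot x y = tdot y x.
Proof. by apply: eq_bigr => i _; rewrite mulrC. Qed.

Lemma tdotDl x y z : tdot (taddt x y) z = tdot x z + tdot y z.
Proof.
by rewrite -big_split/=; apply: eq_bigr => i _; rewrite tnthE mulrDl.
Qed.

Lemma tdotDr x y z : tdot x (taddt y z) = tdot x y + tdot x z.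
Proof. by rewrite tdotC tdotDl !(tdotC x). Qed.

Lemma tdotZl l x y : tdot (tscale l x) y = l * tdot x y.
Proof. by rewrite mulr_sumr; apply: eq_bigr => i _; rewrite tnthE mulrA. Qed.

Lemma tdotZr l x y : tdot x (tscale l y) = l * tdot x y.
Proof. by rewrite tdotC tdotZl tdotC. Qed.

Lemma tdot_ge0 x : 0 <= tdot x x.
Proof. by apply: sumr_ge0 => i _; rewrite -expr2 sqr_ge0. Qed.

Lemma eucl_normE x : eucl_norm x = Num.sqrt (tdot x x).
Proof. by congr Num.sqrt; apply: eq_bigr => i _; rewrite expr2. Qed.

Lemma eucl_norm_ge0 x : 0 <= eucl_norm x.
Proof. exact: sqrtr_ge0. Qed.

Lemma eucl_norm_sqr x : eucl_norm x ^+ 2 = tdot x x.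
Proof. by rewrite eucl_normE sqr_sqrtr// tdot_ge0. Qed.

Lemma eucl_dist_subE x y : eucl_dist x y = eucl_norm (taddt x (toppt y)).
Proof. by congr Num.sqrt; apply: eq_bigr => i _; rewrite !tnthE. Qed.

Lemma eucl_distC x y : eucl_dist x y = eucl_dist y x.
Proof. by congr Num.sqrt; apply: eq_bigr => i _; rewrite -sqrrN opprB. Qed.

Lemma eucl_dist_ge0 x y : 0 <= eucl_dist x y.
Proof. exact: sqrtr_ge0. Qed.

Lemma eucl_norm_scale l x : eucl_norm (tscale l x) = `|l| * eucl_norm x.
Proof.
rewrite !eucl_normE tdotZl tdotZr mulrA -expr2 sqrtrM ?sqr_ge0//.
by rewrite sqrtr_sqr.
Qed.

Lemma eucl_norm_opp x : eucl_norm (toppt x) = eucl_norm x.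
Proof. by rewrite eucl_norm_scale normrN1 mul1r. Qed.

Lemma eucl_norm_eq0 x : eucl_norm x = 0 -> forall i, tnth x i = 0.
Proof.
move=> /eqP; rewrite eucl_normE sqrtr_eq0 => h i; apply/eqP.
have : tdot x x == 0 by rewrite eq_le h tdot_ge0.
rewrite psumr_eq0 => [/allP/(_ i)|j _]; last by rewrite -expr2 sqr_ge0.
by rewrite mem_index_enum => /(_ isT); rewrite -expr2 sqrf_eq0.
Qed.

(** Expand the square norm of [|y| x - |x| y]. *)
Lemma cauchy_schwarz x y : tdot x y <= eucl_norm x * eucl_norm y.
Proof.
have [x0|x0] := eqVneq (eucl_norm x) 0.
  by rewrite x0 mul0r /tdot big1// => i _; rewrite eucl_norm_eq0// mul0r.
have [y0|y0] := eqVneq (eucl_norm y) 0.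
  by rewrite y0 mulr0 /tdot big1// => i _; rewrite (eucl_norm_eq0 y0) mulr0.
have xp : 0 < eucl_norm x by rewrite lt_def x0 eucl_norm_ge0.
have yp : 0 < eucl_norm y by rewrite lt_def y0 eucl_norm_ge0.
have := tdot_ge0 (taddt (tscale (eucl_norm y) x) (toppt (tscale (eucl_norm x) y))).
rewrite !(tdotDl, tdotDr, tdotZl, tdotZr) -!eucl_norm_sqr (tdotC y x).
move: (eucl_norm x) (eucl_norm y) (tdot x y) xp yp => a b c a0 b0 h.
have : 0 <= 2 * (a * b) * (a * b - c) by nra.
by rewrite pmulr_rge0 ?subr_ge0// mulr_gt0// mulr_gt0.
Qed.

Lemma eucl_norm_tri x y : eucl_norm (taddt x y) <= eucl_norm x + eucl_norm y.
Proof.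
rewrite -(@ler_pXn2r _ 2)// ?nnegrE ?addr_ge0 ?eucl_norm_ge0//.
rewrite eucl_norm_sqr !(tdotDl, tdotDr) -!eucl_norm_sqr (tdotC y x).
have := cauchy_schwarz x y; nra.
Qed.

Lemma eucl_norm_lipschitz x y :
  `|eucl_norm x - eucl_norm y| <= eucl_dist x y.
Proof.
have half (u v : N.-tuple R) : eucl_norm u - eucl_norm v <= eucl_dist u v.
  rewrite lerBlDr eucl_dist_subE -{1}(taddtNK u v).
  exact: eucl_norm_tri.
by rewrite ler_norml half andbT lerNl opprB eucl_distC half.
Qed.

Lemma le_tnth_eucl_norm x i : `|tnth x i| <= eucl_norm x.
Proof.
rewrite eucl_normE -sqrtr_sqr ler_wsqrtr// /tdot (bigD1 i)//= expr2.
by rewrite lerDl sumr_ge0// => j _; rewrite -expr2 sqr_ge0.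
Qed.

Lemma eucl_norm_le_sum x : eucl_norm x <= \sum_(i < N) `|tnth x i|.
Proof.
rewrite eucl_normE -[leRHS]ger0_norm ?sumr_ge0// -sqrtr_sqr ler_wsqrtr//.
rewrite expr2 mulr_suml; apply: ler_sum => i _.
rewrite -expr2 -real_normK ?num_real// expr2 ler_wpM2l// (bigD1 i)//=.
by rewrite lerDl sumr_ge0.
Qed.

(** The reflection in the hyperplane orthogonal to [n]; for [n = 0] the factor
    is [0 / 0 = 0] and the map is the identity. *)
Definition householder n x : N.-tuple R :=
  taddt x (tscale (- (2 * tdot x n / tdot n n)) n).

Lemma householderD n x y :
  householder n (taddt x y) = taddt (householder n x) (householder n y).
Proof.
by apply: eq_from_tnth => i; rewrite !(tnthE, tdotDl); ring.
Qed.

Lemma householder_scale n l x :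
  householder n (tscale l x) = tscale l (householder n x).
Proof.
by apply: eq_from_tnth => i; rewrite !(tnthE, tdotZl); ring.
Qed.

Lemma householderK n : involutive (householder n).
Proof.
move=> x; have [n0|n0] := eqVneq (tdot n n) 0.
  by rewrite /householder !n0 invr0 !mulr0 oppr0;
    apply: eq_from_tnth => i; rewrite !tnthE; ring.
apply: eq_from_tnth => i.
rewrite /householder !(tnthE, tdotDl, tdotZl).
by field.
Qed.

Lemma tdot_householder n x : tdot (householder n x) (householder n x) = tdot x x.
Proof.
have [n0|n0] := eqVneq (tdot n n) 0.
  rewrite /householder n0 invr0 mulr0 oppr0.
  by rewrite !(tdotDl, tdotDr, tdotZl, tdotZr); ring.
rewrite /householder !(tdotDl, tdotDr, tdotZl, tdotZr) (tdotC n x).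
by field.
Qed.

Lemma householder_exchange x y : tdot x x = tdot y y ->
  householder (taddt x (toppt y)) x = y.
Proof.
move=> xy; have [n0|n0] := eqVneq (eucl_norm (taddt x (toppt y))) 0.
  apply: eq_from_tnth => i; have := eucl_norm_eq0 n0 i.
  by rewrite !tnthE => h; rewrite h; lra.
have h : tdot (taddt x (toppt y)) (taddt x (toppt y)) =
    2 * tdot x (taddt x (toppt y)).
  by rewrite !(tdotDl, tdotDr, tdotZl, tdotZr) (tdotC y x) -xy; ring.
rewrite /householder -h divff; last by rewrite -eucl_norm_sqr expf_neq0.
by apply: eq_from_tnth => i; rewrite !tnthE; ring.
Qed.

Lemma measurable_tnth_comp d (T : measurableType d) (f : T -> N.-tuple R) i :
  measurable_fun setT f -> measurable_fun setT (fun t => tnth (f t) i).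
Proof. by move=> mf; exact: (measurableT_comp (measurable_tnth i)). Qed.

Lemma measurable_taddt d (T : measurableType d) (f g : T -> N.-tuple R) :
  measurable_fun setT f -> measurable_fun setT g ->
  measurable_fun setT (fun t => taddt (f t) (g t)).
Proof.
move=> mf mg; apply/measurable_fun_tnthP => i; rewrite /comp.
under eq_fun do rewrite tnthE.
by apply: measurable_funD; exact: measurable_tnth_comp.
Qed.

Lemma measurable_tscale d (T : measurableType d) (a : T -> R)
    (f : T -> N.-tuple R) : measurable_fun setT a ->
  measurable_fun setT f -> measurable_fun setT (fun t => tscale (a t) (f t)).
Proof.
move=> ma mf; apply/measurable_fun_tnthP => i; rewrite /comp.
under eq_fun do rewrite tnthE.
by apply: measurable_funM => //; exact: measurable_tnth_comp.
Qed.

Lemma measurable_tdot d (T : measurableType d) (f g : T -> N.-tuple R) :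
  measurable_fun setT f -> measurable_fun setT g ->
  measurable_fun setT (fun t => tdot (f t) (g t)).
Proof.
move=> mf mg; apply: measurable_sum => i.
by apply: measurable_funM => //; exact: measurable_tnth_comp.
Qed.

Lemma measurable_sqrtr : measurable_fun setT (@Num.sqrt R).
Proof. by apply: continuous_measurable_fun; exact: sqrt_continuous. Qed.

Lemma measurable_eucl_norm d (T : measurableType d) (f : T -> N.-tuple R) :
  measurable_fun setT f -> measurable_fun setT (fun t => eucl_norm (f t)).
Proof.
move=> mf; under eq_fun do rewrite eucl_normE.
by apply: (measurableT_comp measurable_sqrtr); exact: measurable_tdot.
Qed.

Lemma measurable_eucl_dist d (T : measurableType d) (f g : T -> N.-tuple R) :
  measurable_fun setT f -> measurable_fun setT g ->
  measurable_fun setT (fun t => eucl_dist (f t) (g t)).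
Proof.
move=> mf mg; under eq_fun do rewrite eucl_dist_subE.
apply: measurable_eucl_norm; apply: measurable_taddt => //.
exact: measurable_tscale.
Qed.

Lemma measurable_householder n : measurable_fun setT (householder n).
Proof.
apply: measurable_taddt => //; apply: measurable_tscale => //.
apply: measurable_funN; apply: measurable_funM => //.
by apply: measurable_funM => //; exact: measurable_tdot.
Qed.

End euclidean_space.

(** * Translations, linear maps and the Lebesgue measure *)

Section lebesgue_invariance.
Context {R : realType}.

Lemma lebesgue_measure_shift (h : R) (A : set (measurableTypeR R)) :
  measurable A -> pushforward (@lebesgue_measure R)
    ((fun a => a + h) : measurableTypeR R -> measurableTypeR R) A =
  lebesgue_measure A.
Proof.
have mh : measurable_fun setT ((fun a => a + h) : measurableTypeR R -> measurableTypeR R).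
  exact: measurable_funD.
pose mh1 := isMeasurableFun.Build _ _ _ _ _ mh.
pose f : {mfun _ >-> _} := HB.pack ((fun a => a + h) : measurableTypeR R -> measurableTypeR R) mh1.
move=> mA; apply/esym.
apply: (@lebesgue_measure_unique _ (pushforward (@lebesgue_measure R) f)) => //.
move=> _ [[a b]] _ <-.
transitivity (lebesgue_measure (`]a - h, b - h]%classic : set (measurableTypeR R))).
  rewrite !lebesgue_measure_itv/= !lte_fin ltrD2r.
  by case: ifPn => // _; rewrite -!EFinB; congr EFin; ring.
rewrite /pushforward; congr (lebesgue_measure _).
by apply/seteqP; split => x /=; rewrite !in_itv/= ltrBlDr lerBrDr.
Qed.

Lemma measurable_preimage_fun d d' (T : measurableType d) (T' : measurableType d')
    (f : T -> T') (A : set T') :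
  measurable_fun setT f -> measurable A -> measurable (f @^-1` A).
Proof. by move=> mf mA; rewrite -[X in measurable X]setTI; exact: mf. Qed.

Lemma lebE n (E : set (n.+1.-tuple R)) :
  leb R n.+1 E = (\int[@lebesgue_measure R]_a
     leb R n [set x : n.-tuple R | E (cons_pt (a, x))])%E.
Proof.
rewrite /= /leb_step /pushforward /product_measure1.
apply: eq_integral => a _ /=; congr (leb R n _).
by apply/seteqP; split => x; rewrite /xsection/= inE.
Qed.

Lemma measurable_leb_section n (E : set (n.+1.-tuple R)) : measurable E ->
  measurable_fun setT (fun a : measurableTypeR R =>
     leb R n [set x : n.-tuple R | E (cons_pt (a, x))]).
Proof.
move=> mE; have mE' := measurable_preimage_fun (@measurable_cons_pt R n) mE.
have := measurable_fun_xsection (leb R n) mE'.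
apply: eq_measurable_fun => a _ /=; congr (leb R n _).
by apply/seteqP; split => x; rewrite /xsection/= inE.
Qed.

(** By induction on the dimension: a section of a translate is a translate of a
    section. *)
Lemma leb_shift n (h : n.-tuple R) (E : set (n.-tuple R)) : measurable E ->
  leb R n [set x | E (taddt x h)] = leb R n E.
Proof.
elim: n h E => [|n IH] h E mE.
  congr (leb R 0 _); apply/seteqP.
  by split => x /=; rewrite (tuple0 x) (tuple0 (taddt _ _)).
rewrite !lebE.
pose t : n.-tuple R := [tuple of behead h].
have ht : h = [tuple of thead h :: t] by exact: tuple_eta.
have secE a : [set x | E (taddt (cons_pt (a, x)) h)] =
    [set x | [set y : n.-tuple R | E (cons_pt (a + thead h, y))] (taddt x t)].
  suff eqt (x : n.-tuple R) : taddt (cons_pt (a, x)) h = cons_pt (a + thead h, taddt x t).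
    by apply/seteqP; split => x /=; rewrite eqt.
  rewrite {1}ht; apply: eq_from_tnth => i; rewrite tnthE.
  by case: (unliftP ord0 i) => [j|] ->; rewrite ?tnthS ?tnth0 ?tnthE.
have mEa a : measurable [set y : n.-tuple R | E (cons_pt (a, y))].
  apply: (measurable_preimage_fun (f := fun y : n.-tuple R => cons_pt (a, y))) => //.
  by apply: (measurableT_comp (@measurable_cons_pt R n)); exact: measurable_pair1.
under eq_integral => a _ do rewrite secE IH//.
pose g (a : measurableTypeR R) := leb R n [set x : n.-tuple R | E (cons_pt (a, x))].
pose sh : measurableTypeR R -> measurableTypeR R := fun a => a + thead h.
have msh : measurable_fun setT sh by exact: measurable_funD.
rewrite -[LHS]/(\int[@lebesgue_measure R]_a (g \o sh) a)%E.
rewrite -[LHS](@ge0_integral_pushforward _ _ _ _ _ _ msh (@lebesgue_measure R) setT)//.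
- by apply: eq_measure_integral => A mA _; exact: lebesgue_measure_shift.
- exact: measurable_leb_section.
Qed.

Lemma leb_setI_cst n U (P : set U) (u : U) (A : set (n.-tuple R)) :
  leb R n [set x | P u /\ A x] = ((\1_P u : R)%:E * leb R n A)%E.
Proof.
rewrite indicE; have [p|np] := pselect (P u).
  rewrite mem_set// mul1e; congr (leb R n _).
  by apply/seteqP; split => x //= [].
rewrite memNset// mul0e -(measure0 (leb R n)); congr (leb R n _).
by apply/seteqP; split => x //= [].
Qed.

(** Tonelli for sets, in terms of sections written as comprehensions. *)
Lemma leb_sections n (A : set (n.-tuple R * n.-tuple R)) : measurable A ->
  (\int[leb R n]_x leb R n [set y | A (x, y)] =
   \int[leb R n]_y leb R n [set x | A (x, y)])%E.
Proof.
move=> mA; have := indic_fubini_tonelli (leb R n) (leb R n) mA.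
rewrite (indic_fubini_tonelli_FE _ mA) (indic_fubini_tonelli_GE _ mA).
rewrite /= => e; transitivity (\int[leb R n]_x leb R n (xsection A x))%E.
  apply: eq_integral => x _; congr (leb R n _).
  by apply/seteqP; split => y; rewrite /xsection/= inE.
rewrite e; apply: eq_integral => y _; congr (leb R n _).
by apply/seteqP; split => x; rewrite /ysection/= inE.
Qed.

(** The image of the Lebesgue measure under a linear bijection [S] is
    translation invariant, hence proportional to the Lebesgue measure: both
    sides are Fubini integrals of the indicator of [E (x + S y) /\ F (S y)],
    once [y] has been translated by the preimage of [- x].  A reference set [F] of
    known measure then gives the constant without determinants. *)
Lemma leb_linear n (S S' : n.-tuple R -> n.-tuple R) (E F : set (n.-tuple R)) :
  measurable_fun setT S -> cancel S' S ->
  (forall x y, S (taddt x y) = taddt (S x) (S y)) ->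
  measurable E -> measurable F ->
  (leb R n E * leb R n (S @^-1` F) =
   leb R n (S @^-1` E) * leb R n (toppt @^-1` F))%E.
Proof.
move=> mS S'K SD mE mF.
have mSF := measurable_preimage_fun mS mF.
have mSE := measurable_preimage_fun mS mE.
have mT : measurable_fun setT (@toppt R n) by exact: measurable_tscale.
have mNF := measurable_preimage_fun mT mF.
have mS2 : measurable_fun setT (fun z : n.-tuple R * n.-tuple R => S z.2).
  exact: measurableT_comp.
pose A := [set z : n.-tuple R * n.-tuple R | F (S z.2) /\ E (taddt z.1 (S z.2))].
pose B := [set z : n.-tuple R * n.-tuple R | E (S z.2) /\ F (taddt (S z.2) (toppt z.1))].
have mA : measurable A.
  apply: measurableI; first exact: (measurable_preimage_fun mS2).
  apply: (measurable_preimage_fun (f := fun z : n.-tuple R * n.-tuple R => taddt z.1 (S z.2))) => //.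
  exact: measurable_taddt.
have mB : measurable B.
  apply: measurableI; first exact: (measurable_preimage_fun mS2).
  apply: (measurable_preimage_fun (f := fun z : n.-tuple R * n.-tuple R => taddt (S z.2) (toppt z.1))) => //.
  apply: measurable_taddt => //; exact: measurable_tscale.
have mE' z : measurable [set x | E (taddt x z)].
  apply: (measurable_preimage_fun (f := fun x => taddt x z)) => //.
  exact: measurable_taddt.
transitivity (\int[leb R n]_y leb R n [set x | A (x, y)])%E.
  under eq_integral => y _ do
    rewrite /A/= (leb_setI_cst (S @^-1` F) y) leb_shift//.
  rewrite ge0_integralZr//; last by apply/measurable_EFinP; exact: measurable_indic.
  by rewrite integral_indic// setIT muleC.
rewrite -leb_sections//.
transitivity (\int[leb R n]_x leb R n [set y | B (x, y)])%E.
  apply: eq_integral => x _.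
  rewrite -(@leb_shift _ (S' x) [set y | B (x, y)]); last first.
    apply: (measurable_preimage_fun (f := fun y => (x, y))) => //.
    exact: measurable_pair1.
  congr (leb R n _); apply/seteqP; split => y; rewrite /A /B/= SD S'K taddtK.
    by rewrite taddtC => -[].
  by rewrite taddtC => -[].
rewrite leb_sections//.
have secB y : leb R n [set x | B (x, y)] =
    ((\1_(S @^-1` E) y)%:E * leb R n (toppt @^-1` F))%E.
  rewrite -(leb_shift (toppt (S y)) mNF) -leb_setI_cst; congr (leb R n _).
  suff e x : toppt (taddt x (toppt (S y))) = taddt (S y) (toppt x).
    by apply/seteqP; split => x /=; rewrite e.
  by apply: eq_from_tnth => i; rewrite !tnthE; ring.
under eq_integral => y _ do rewrite secB.
rewrite ge0_integralZr//; last by apply/measurable_EFinP; exact: measurable_indic.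
by rewrite integral_indic// setIT.
Qed.

End lebesgue_invariance.

(** * Similarities and change of variables *)

Section lebesgue_similarity.
Context {R : realType} {n : nat}.
Local Notation mu := (leb R n).
Local Notation T := (n.-tuple R).
Implicit Types (l r : R).

Definition cube (r : R) : set T := [set x | forall i, `|tnth x i| <= r].

Lemma cubeE r : cube r = [set x | forall i, `[- r, r]%classic (tnth x i)].
Proof.
by apply/seteqP; split => x h i; have := h i; rewrite /= in_itv/= ler_norml.
Qed.

Lemma leb_cube r : 0 <= r -> mu (cube r) = ((2 * r) ^+ n)%:E.
Proof.
move=> r0; rewrite cubeE (leb_box (A := fun _ => `[- r, r]%classic))//.
rewrite lebesgue_measure_itv/= lte_fin.
have -> : (if - r < r then (r%:E - (- r)%:E)%E else 0%E) = (2 * r)%:E.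
  case: ifPn => [_|]; first by rewrite -EFinB; congr EFin; ring.
  by rewrite -leNgt => h; congr EFin; lra.
by rewrite prodEFin prodr_const card_ord.
Qed.

Lemma measurable_cube r : measurable (cube r).
Proof.
rewrite (_ : cube r = \bigcap_(i in [set: 'I_n]) ((@tnth n R ^~ i) @^-1` `[- r, r]%classic)).
  apply: fin_bigcap_measurable => // i _.
  by apply: measurable_preimage_fun => //; exact: measurable_tnth.
by rewrite cubeE; apply/seteqP; split => x h i; [move=> _|]; exact: h.
Qed.

Definition cball (r : R) : set T := [set x | eucl_norm x <= r].

Lemma measurable_norm_pred (P : set R) : measurable P ->
  measurable [set x : T | P (eucl_norm x)].
Proof.
move=> mP; apply: (measurable_preimage_fun (f := fun x : T => eucl_norm x)) => //.
exact: measurable_eucl_norm.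
Qed.

Lemma measurable_cball r : measurable (cball r).
Proof.
rewrite (_ : cball r = [set x : T | `]-oo, r]%classic (eucl_norm x)]).
  by apply: measurable_norm_pred.
by apply/seteqP; split => x; rewrite /cball/= in_itv.
Qed.

Lemma leb_cball_le r : 0 <= r -> (mu (cball r) <= ((2 * r) ^+ n)%:E)%E.
Proof.
move=> r0; rewrite -leb_cube//; apply: le_measure; rewrite ?inE.
- exact: measurable_cball.
- exact: measurable_cube.
- by move=> x h i; apply: le_trans h; exact: le_tnth_eucl_norm.
Qed.

(** The ball contains the cube of half-side [1 / (n + 1)]. *)
Lemma leb_cball1_gt0 : (0 < mu (cball 1))%E.
Proof.
pose r : R := n.+1%:R^-1.
have r0 : 0 < r by rewrite invr_gt0.
apply: (@lt_le_trans _ _ (mu (cube r))).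
  by rewrite leb_cube ?ltW// lte_fin exprn_gt0// mulr_gt0.
apply: le_measure; rewrite ?inE.
- exact: measurable_cube.
- exact: measurable_cball.
- move=> x h; apply: le_trans (eucl_norm_le_sum x) _.
  apply: (@le_trans _ _ (\sum_(i < n) r)); first by apply: ler_sum => i _; exact: h.
  rewrite sumr_const card_ord -mulr_natr mulrC ler_pdivrMr// mul1r.
  by rewrite ler_nat.
Qed.

Lemma mule_fin_inj (b : R) (x y : \bar R) : b != 0 ->
  (x * b%:E = y * b%:E)%E -> x = y.
Proof.
move=> b0 /(congr1 (fun z => z * (b^-1)%:E)%E).
by rewrite -!muleA -!EFinM mulfV// !mule1.
Qed.

(** The reference set of [leb_linear] is a cube, whose measure is explicit. *)
Lemma leb_scale l (E : set T) : 0 < l -> measurable E ->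
  mu (tscale l @^-1` E) = ((l^-1 ^+ n)%:E * mu E)%E.
Proof.
move=> l0 mE; have l0' : l != 0 by rewrite gt_eqF.
have := @leb_linear _ n (tscale l) (tscale l^-1) E (cube 1) _ _ _ mE (measurable_cube 1).
rewrite (_ : tscale l @^-1` cube 1 = cube l^-1); last first.
  apply/seteqP; split => x h i; have := h i; rewrite tnthE normrM (gtr0_norm l0).
    by rewrite mulrC -ler_pdivlMr// mul1r.
  by rewrite mulrC -ler_pdivlMr// mul1r.
rewrite (_ : toppt @^-1` cube 1 = cube 1); last first.
  by apply/seteqP; split => x h i; have := h i; rewrite tnthE normrN.
rewrite !leb_cube ?invr_ge0 ?ltW// => H.
have mS : measurable_fun setT (tscale l : T -> T) by exact: measurable_tscale.
have SK : cancel (tscale l^-1) (tscale l : T -> T).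
  by move=> x; rewrite tscaleA mulfV// tscale1.
have SD x y : tscale l (taddt x y) = taddt (tscale l x) (tscale l y) :> T.
  by apply: eq_from_tnth => i; rewrite !tnthE mulrDr.
move: {H SK mS}(H mS SK SD).
rewrite mulr1 => /(congr1 (fun z => z * ((2 ^+ n)^-1)%:E)%E).
rewrite -!muleA -!EFinM mulfV ?expf_neq0// mule1 => <-.
by rewrite muleC exprMn mulrAC mulfV ?expf_neq0// mul1r.
Qed.

(** The reference set of [leb_linear] is a ball, which a reflection preserves. *)
Lemma leb_householder m (E : set T) : measurable E ->
  mu (householder m @^-1` E) = mu E.
Proof.
move=> mE.
have := @leb_linear _ n (householder m) (householder m) E (cball 1)
  (measurable_householder m) (householderK m) (householderD m) mE (measurable_cball 1).
rewrite (_ : householder m @^-1` cball 1 = cball 1); last first.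
  by apply/seteqP; split => x; rewrite /cball/= !eucl_normE tdot_householder.
rewrite (_ : toppt @^-1` cball 1 = cball 1); last first.
  by apply/seteqP; split => x; rewrite /cball/= eucl_norm_opp.
have bfin : mu (cball 1) \is a fin_num.
  rewrite ge0_fin_numE//; apply: le_lt_trans (leb_cball_le _) _ => //.
  by rewrite ltry.
rewrite -(fineK bfin) => /mule_fin_inj-> //.
by rewrite gt_eqF// fine_gt0// leb_cball1_gt0 ltey_eq bfin.
Qed.

(** One scaling and one reflection: enough to reach every nonzero point from a
    given unit vector. *)
Definition similarity l m x : T := tscale l (householder m x).

Lemma measurable_similarity l m : measurable_fun setT (similarity l m).
Proof. by apply: measurable_tscale => //; exact: measurable_householder. Qed.

Lemma leb_similarity l m (E : set T) : 0 < l -> measurable E ->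
  mu (similarity l m @^-1` E) = ((l^-1 ^+ n)%:E * mu E)%E.
Proof.
move=> l0 mE; rewrite -leb_scale//.
rewrite -(@leb_householder m (tscale l @^-1` E))//.
by apply: measurable_preimage_fun => //; exact: measurable_tscale.
Qed.

Lemma eucl_norm_similarity l m x : 0 <= l ->
  eucl_norm (similarity l m x) = l * eucl_norm x.
Proof.
by move=> l0; rewrite eucl_norm_scale ger0_norm// !eucl_normE tdot_householder.
Qed.

Lemma eucl_dist_similarity l m x y : 0 <= l ->
  eucl_dist (similarity l m x) (similarity l m y) = l * eucl_dist x y.
Proof.
move=> l0; rewrite !eucl_dist_subE -(eucl_norm_similarity m _ l0).
rewrite /similarity householderD /toppt householder_scale.
by congr eucl_norm; apply: eq_from_tnth => i; rewrite !tnthE; ring.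
Qed.

Lemma similarity_transitive x0 x : eucl_norm x0 = 1 -> eucl_norm x != 0 ->
  exists m, similarity (eucl_norm x) m x0 = x.
Proof.
move=> x01 xn0; pose e := tscale (eucl_norm x)^-1 x.
exists (taddt x0 (toppt e)); rewrite /similarity householder_exchange.
  by rewrite tscaleA mulfV// tscale1.
rewrite -!eucl_norm_sqr eucl_norm_scale normfV ger0_norm ?eucl_norm_ge0//.
by rewrite x01 mulVf.
Qed.

Lemma ge0_integral_similarity l m (g : T -> \bar R) : 0 < l ->
  measurable_fun setT g -> (forall x, 0 <= g x)%E ->
  (\int[mu]_x g x = (l ^+ n)%:E * \int[mu]_x g (similarity l m x))%E.
Proof.
move=> l0 mg g0.
have ln0 : (0 <= l^-1 ^+ n)%R by rewrite exprn_ge0// invr_ge0 ltW.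
have -> : (\int[mu]_x g (similarity l m x) = (l^-1 ^+ n)%:E * \int[mu]_x g x)%E.
  have mS := @measurable_similarity l m.
  rewrite -[LHS](@ge0_integral_pushforward _ _ _ _ _ _ mS mu setT)//.
  rewrite -(ge0_integral_mscale mu measurableT (NngNum ln0))//.
  apply: eq_measure_integral => A mA _.
  by rewrite [LHS](leb_similarity m l0 mA).
by rewrite muleA -EFinM -exprMn mulfV ?gt_eqF// expr1n mul1e.
Qed.

Lemma gt0_muleBr (a : R) (x y : \bar R) : 0 < a ->
  (a%:E * (x - y) = a%:E * x - a%:E * y)%E.
Proof.
move=> a0; case: x y => [x| |] [y| |];
  rewrite /= ?(gt0_muley, gt0_muleNy, lte_fin)//=.
by rewrite -EFinM mulrBr.
Qed.

Lemma gt0_fineMl (a : R) (x : \bar R) : 0 < a -> fine (a%:E * x) = a * fine x.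
Proof.
move=> a0; case: x => [x| |] //=.
  by rewrite gt0_muley ?lte_fin//= mulr0.
by rewrite gt0_muleNy ?lte_fin//= mulr0.
Qed.

(** The positive and negative parts are transformed separately; the positive factor
    distributes over their difference even when both are infinite. *)
Lemma Rintegral_similarity l m (g : T -> R) : 0 < l ->
  measurable_fun setT g ->
  \int[mu]_x g x = l ^+ n * \int[mu]_x g (similarity l m x).
Proof.
move=> l0 mg; have mg' : measurable_fun setT (EFin \o g) by exact/measurable_EFinP.
rewrite /Rintegral integralE.
rewrite (@ge0_integral_similarity l m ((EFin \o g)^\+)%E)//; last exact: measurable_funepos.
rewrite (@ge0_integral_similarity l m ((EFin \o g)^\-)%E)//; last exact: measurable_funeneg.
have ln0 : 0 < l ^+ n by rewrite exprn_gt0.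
rewrite -gt0_muleBr// gt0_fineMl//; congr (_ * fine _).
by rewrite [RHS]integralE; congr (_ - _)%E; apply: eq_integral => x _; rewrite ?funeposE ?funenegE.
Qed.

Lemma ge0_integral_shift h (g : T -> \bar R) :
  measurable_fun setT g -> (forall x, 0 <= g x)%E ->
  (\int[mu]_x g (taddt x h) = \int[mu]_x g x)%E.
Proof.
move=> mg g0.
have mh : measurable_fun setT (fun x : T => taddt x h) by exact: measurable_taddt.
rewrite -[LHS](@ge0_integral_pushforward _ _ _ _ _ _ mh mu setT)//.
by apply: eq_measure_integral => A mA _; rewrite /pushforward -[RHS](leb_shift h).
Qed.

End lebesgue_similarity.

(** * The Levy density *)

Section kernel_integrability.
Context {R : realType} {n : nat}.
Local Notation mu := (leb R n).
Local Notation T := (n.-tuple R).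
Implicit Types (r s p : R) (h x y : T).

(** A dyadic comparison test: [f] is dominated by the sum of the [g k]. *)
Lemma ge0_integral_geometric_lty (f : T -> R) (g : nat -> T -> R) (C a : R) :
  measurable_fun setT f -> (forall h, 0 <= f h) ->
  (forall k, measurable_fun setT (g k)) -> (forall k h, 0 <= g k h) ->
  (forall h, exists k, f h <= g k h) ->
  0 <= C -> 0 <= a < 1 ->
  (forall k, (\int[mu]_h (g k h)%:E <= (C * a ^+ k)%:E)%E) ->
  (\int[mu]_h (f h)%:E < +oo)%E.
Proof.
move=> mf f0 mg g0 fg C0 /andP[a0 a1] ig.
apply: (@le_lt_trans _ _ (\int[mu]_h (\sum_(k <oo) (g k h)%:E))%E).
  apply: ge0_le_integral => //.
  - by move=> h _; rewrite lee_fin.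
  - exact/measurable_EFinP.
  - apply: ge0_emeasurable_sum => k.
      by move=> h _; rewrite lee_fin.
    by move=> _; exact/measurable_EFinP.
  - move=> h _; have [k fk] := fg h.
    apply: (@le_trans _ _ (g k h)%:E); first by rewrite lee_fin.
    apply: le_trans (nneseries_lim_ge k.+1 _); last by move=> *; rewrite lee_fin.
    rewrite big_nat_recr//= leeDr// sume_ge0// => *.
    by rewrite lee_fin.
rewrite integral_nneseries//; last 2 first.
  - by move=> k; exact/measurable_EFinP.
  - by move=> k h _; rewrite lee_fin.
apply: (@le_lt_trans _ _ (\sum_(k <oo) (C * a ^+ k)%:E)%E).
  apply: lee_nneseries => k _; last exact: ig.
  by move=> _; apply: integral_ge0 => h _; rewrite lee_fin.
have cv : series (geometric C a) @ \oo --> C * (1 - a)^-1.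
  by apply: cvg_geometric_series; rewrite ger0_norm.
have -> : (\sum_(k <oo) (C * a ^+ k)%:E)%E = (C * (1 - a)^-1)%:E.
  apply/cvg_lim => //.
  rewrite (_ : (fun m => _) = EFin \o series (geometric C a)); last first.
    by apply/funext => m; rewrite /= /series/= sumEFin.
  by apply: cvg_EFin => //; near=> m.
by rewrite ltry.
Unshelve. all: by end_near. Qed.

Lemma powr2_bounds r : 1 <= r -> exists k, 2 ^+ k <= r < 2 ^+ k.+1.
Proof.
move=> r1; have r0 : 0 <= r by lra.
have /andP[t1 t2] := truncn_itv r0.
have t0 : (0 < Num.truncn r)%N.
  by rewrite -ltnS -(@ltr_nat R) (le_lt_trans _ t2).
have /andP[l1 l2] := trunc_log_bounds (isT : (1 < 2)%N) t0.
exists (trunc_log 2 (Num.truncn r)); apply/andP; split.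
  by rewrite -natrX (le_trans _ t1)// ler_nat.
by rewrite -natrX (lt_le_trans t2)// ler_nat.
Qed.

(** The singular density [|h|^-(n + s p)] is integrable at infinity, but only
    against [|h|^p] at the origin; this factor is the modulus of continuity, to
    the power [p], of a bounded Lipschitz function. *)
Definition levy_density s p h : R :=
  Num.min (eucl_norm h) 1 `^ p / eucl_norm h `^ (n%:R + s * p).

Lemma levy_density_ge0 s p h : 0 <= levy_density s p h.
Proof. by rewrite mulr_ge0 ?invr_ge0 ?powR_ge0. Qed.

Lemma measurable_funV d (U : measurableType d) (f : U -> R) :
  measurable_fun setT f -> (forall u, 0 <= f u) ->
  measurable_fun setT (fun u => (f u)^-1).
Proof.
move=> mf f0; under eq_fun do rewrite -powR_inv1//.
exact: (measurableT_comp (measurable_powR _)).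
Qed.

Lemma measurable_inv_dist_powR s p d (U : measurableType d) (f : U -> R) :
  measurable_fun setT f ->
  measurable_fun setT (fun u => (f u `^ (n%:R + s * p))^-1).
Proof.
move=> mf; apply: measurable_funV; last by move=> u; exact: powR_ge0.
exact: (measurableT_comp (measurable_powR _)).
Qed.

Lemma measurable_levy_density s p : measurable_fun setT (levy_density s p).
Proof.
have mn : measurable_fun setT (@eucl_norm R n) by exact: measurable_eucl_norm.
apply: measurable_funM; last exact: measurable_inv_dist_powR.
apply: (measurableT_comp (measurable_powR _)) => //.
exact: measurable_minr.
Qed.

(** In the annulus [2^-(k+1) <= |h| <= 2^-k] the density is at most [A k], and in
    [2^k <= |h| <= 2^(k+1)] at most [B k].  Multiplied by the volumes of the balls,
    these bounds become geometric of ratios [2^-(p - s p)] and [2^-(s p)]. *)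
Lemma integral_levy_density_lty s p : 0 < s < 1 -> 1 < p ->
  (\int[mu]_h (levy_density s p h)%:E < +oo)%E.
Proof.
move=> /andP[s0 s1] p1.
have sp0 : 0 < s * p by nra.
have spp : s * p < p by nra.
set gam := n%:R + s * p.
have gam0 : 0 < gam by rewrite ltr_wpDl// ler0n.
pose e : nat -> R := fun k => 2^-1 ^+ k.
have e0 k : 0 < e k by rewrite exprn_gt0.
have e2 k : e k * 2 ^+ k = 1 by rewrite -exprMn mulVf// expr1n.
have eS k : e k = 2 * e k.+1 by rewrite /e exprS mulrA mulfV// mul1r.
pose A k := 2 `^ gam * (e k `^ p / e k `^ gam).
pose B k : R := ((2 ^+ k) `^ gam)^-1.
have A0 k : 0 <= A k by rewrite !mulr_ge0 ?invr_ge0 ?powR_ge0.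
have B0 k : 0 <= B k by rewrite invr_ge0 powR_ge0.
pose g k h := A k * \1_(cball (e k)) h + B k * \1_(cball (2 ^+ k.+1)) h.
pose a := Num.max (2^-1 `^ (p - s * p)) (2^-1 `^ (s * p)).
pose C := 2 `^ gam * 2 ^+ n + 4 ^+ n.
have h0 : 0 <= 2^-1 :> R by [].
have pow_e k z : e k `^ z = (2^-1 `^ z) ^+ k.
  by rewrite /e -!powR_mulrn ?powR_ge0// -!powRrM mulrC.
have half1 (z : R) : 0 < z -> 2^-1 `^ z < 1.
  move=> z0; have := @gt0_ltr_powR _ z z0 2^-1 1; rewrite powR1.
  by apply; rewrite ?nnegrE//; lra.
apply: (@ge0_integral_geometric_lty _ g C a).
- exact: measurable_levy_density.
- exact: levy_density_ge0.
- move=> k; apply: measurable_funD; apply: measurable_funM => //;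
  by apply: measurable_indic; exact: measurable_cball.
- by move=> k h; rewrite addr_ge0// mulr_ge0// indicE.
- move=> h; have [h00|hn0] := eqVneq (eucl_norm h) 0.
    exists 0; apply: (@le_trans _ _ 0); last first.
      by rewrite addr_ge0// mulr_ge0// indicE.
    by rewrite /levy_density h00 powR0 ?gt_eqF// ?invr0 ?mulr0.
  have hp : 0 < eucl_norm h by rewrite lt_def hn0 eucl_norm_ge0.
  have [h1|h1] := leP (eucl_norm h) 1.
    have [|k /andP[k1 k2]] := @powr2_bounds (eucl_norm h)^-1.
      by rewrite invf_ge1.
    have hk : eucl_norm h <= e k.
      by rewrite /e exprVn -[leLHS]invrK lef_pV2// posrE// ?exprn_gt0// invr_gt0.
    have hk' : e k.+1 <= eucl_norm h.
      by rewrite /e exprVn -[leRHS]invrK lef_pV2 ?posrE ?exprn_gt0 ?invr_gt0// ltW.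
    exists k; rewrite /g indicE mem_set// mulr1 ler_wpDr//.
      by rewrite mulr_ge0// indicE.
    rewrite /levy_density (min_idPl h1) /A mulrCA.
    rewrite -/gam ler_pM ?invr_ge0 ?powR_ge0//.
      by rewrite ge0_ler_powR ?nnegrE ?eucl_norm_ge0 ?(ltW (e0 k))//; lra.
    have -> : 2 `^ gam / e k `^ gam = (e k.+1 `^ gam)^-1.
      rewrite (eS k) powRM ?(ltW (e0 _))// invfM mulrA mulfV ?mul1r ?gt_eqF ?powR_gt0//.
    by rewrite lef_pV2 ?posrE ?powR_gt0// ge0_ler_powR ?nnegrE ?eucl_norm_ge0 ?(ltW (e0 _)) ?(ltW gam0).
  have [|k /andP[k1 k2]] := @powr2_bounds (eucl_norm h); first exact: ltW.
  exists k; rewrite /g [X in _ + _ * X]indicE mem_set ?mulr1; last exact: ltW.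
  rewrite ler_wpDl//; first by rewrite mulr_ge0// indicE.
  rewrite /levy_density (min_idPr (ltW h1)) powR1 mul1r /B.
  rewrite lef_pV2 ?posrE ?powR_gt0 ?exprn_gt0//.
  by rewrite ge0_ler_powR ?nnegrE ?exprn_ge0 ?eucl_norm_ge0 ?(ltW gam0).
- by rewrite addr_ge0// ?mulr_ge0 ?powR_ge0 ?exprn_ge0.
- by rewrite le_max powR_ge0/= gt_max !half1// subr_gt0.
- move=> k; rewrite /g; under eq_integral do rewrite EFinD.
  rewrite ge0_integralD//; last 4 first.
  - by move=> h _; rewrite lee_fin mulr_ge0// indicE.
  - apply/measurable_EFinP; apply: measurable_funM => //.
    by apply: measurable_indic; exact: measurable_cball.
  - by move=> h _; rewrite lee_fin mulr_ge0// indicE.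
  - apply/measurable_EFinP; apply: measurable_funM => //.
    by apply: measurable_indic; exact: measurable_cball.
  under eq_integral do rewrite EFinM.
  under [X in (_ + X)%E]eq_integral do rewrite EFinM.
  rewrite !ge0_integralZl_EFin//; last 2 first.
  - by apply/measurable_EFinP; apply: measurable_indic; exact: measurable_cball.
  - by apply/measurable_EFinP; apply: measurable_indic; exact: measurable_cball.
  rewrite !integral_indic// ?setIT; last 2 first.
  - exact: measurable_cball.
  - exact: measurable_cball.
  apply: (@le_trans _ _ ((A k)%:E * ((2 * e k) ^+ n)%:E +
      (B k)%:E * ((2 * 2 ^+ k.+1) ^+ n)%:E)%E).
    apply: leeD; apply: lee_wpmul2l; rewrite ?lee_fin//;
    by apply: leb_cball_le; rewrite ?exprn_ge0// ltW.
  rewrite -!EFinM -EFinD lee_fin [leRHS]mulrDl.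
  apply: lerD.
    rewrite (_ : A k * _ = 2 `^ gam * 2 ^+ n * (e k) `^ (p - s * p)).
      rewrite ler_wpM2l ?mulr_ge0 ?powR_ge0 ?exprn_ge0// pow_e.
      by rewrite lerXn2r ?nnegrE ?powR_ge0// ?le_max ?powR_ge0// lexx.
    rewrite /A exprMn (@powRB _ (e k)); last by rewrite (gt_eqF (e0 k)) implybT.
    rewrite /gam (@powRD _ (e k)); last by rewrite (gt_eqF (e0 k)) implybT.
    rewrite powR_mulrn ?(ltW (e0 k))//.
    have h1 : e k ^+ n != 0 by rewrite expf_neq0// gt_eqF.
    have h2 : e k `^ (s * p) != 0 by rewrite gt_eqF// powR_gt0.
    move: h1 h2; move: (e k ^+ n) (e k `^ (s * p)) (e k `^ p) (2 `^ _) (2 ^+ n).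
    by move=> x1 x2 x3 x4 x5 h1 h2; field; rewrite h1 h2.
  rewrite (_ : B k * _ = 4 ^+ n * (e k) `^ (s * p)).
    rewrite ler_wpM2l ?exprn_ge0// pow_e.
    by rewrite lerXn2r ?nnegrE ?powR_ge0// ?le_max ?powR_ge0// lexx orbT.
  rewrite /B /gam powRD; last by rewrite gt_eqF ?exprn_gt0// implybT.
  rewrite powR_mulrn ?exprn_ge0// exprS mulrA -natrM exprMn.
  rewrite /e exprVn -(@powR_inv1 _ (2 ^+ k)) ?exprn_ge0// -powRrM mulN1r powRN.
  have h1 : (2 ^+ k) ^+ n != 0 :> R by rewrite !expf_neq0.
  have h2 : (2 ^+ k) `^ (s * p) != 0 :> R by rewrite gt_eqF// powR_gt0// exprn_gt0.
  move: h1 h2; move: ((2 ^+ k) ^+ n) ((2 ^+ k) `^ (s * p)).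
  by move=> x1 x2 h1 h2; field; rewrite h1 h2.
Qed.

End kernel_integrability.

(** * The truncated operator *)

Section truncated_operator.
Context {R : realType} {N : nat}.
Local Notation mu := (leb R N).
Local Notation T := (N.-tuple R).
Implicit Types (e l : R) (f V : T -> R) (x y : T).

Definition far e x : set T := [set y | e < eucl_dist x y].

Definition truncated_pL s p f e x : R :=
  \int[mu]_(y in far e x) pL_kernel s p f x y.

Lemma measurable_far e x : measurable (far e x).
Proof.
rewrite (_ : far e x = (eucl_dist x) @^-1` `]e, +oo[%classic).
  by apply: measurable_preimage_fun => //; exact: measurable_eucl_dist.
by apply/seteqP; split => y; rewrite /far/= in_itv/= andbT.
Qed.

Lemma measurable_pL_kernel s p f : measurable_fun setT f ->
  measurable_fun setT (fun z : T * T => pL_kernel s p f z.1 z.2).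
Proof.
move=> mf; apply: measurable_funM; last first.
  apply: (measurable_inv_dist_powR s p (f := fun z : T * T => eucl_dist z.1 z.2)).
  exact: measurable_eucl_dist.
apply: (measurableT_comp (measurable_Phi p)).
by apply: measurable_funB; exact: (measurableT_comp mf).
Qed.

Lemma measurable_pL_kernel1 s p f x : measurable_fun setT f ->
  measurable_fun setT (pL_kernel s p f x).
Proof.
move=> mf.
exact: (measurableT_comp (measurable_pL_kernel s p mf) (measurable_pair1 x)).
Qed.

Definition levy_kernel s p x y : R := levy_density s p (taddt y (toppt x)).

Lemma levy_kernelE s p x y : levy_kernel s p x y =
  Num.min (eucl_dist x y) 1 `^ p / eucl_dist x y `^ (N%:R + s * p).
Proof. by rewrite /levy_kernel /levy_density -eucl_dist_subE eucl_distC. Qed.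

Lemma levy_kernel_ge0 s p x y : 0 <= levy_kernel s p x y.
Proof. exact: levy_density_ge0. Qed.

Lemma levy_kernelC s p x y : levy_kernel s p x y = levy_kernel s p y x.
Proof. by rewrite !levy_kernelE eucl_distC. Qed.

Lemma measurable_levy_kernel s p d (U : measurableType d) (f g : U -> T) :
  measurable_fun setT f -> measurable_fun setT g ->
  measurable_fun setT (fun u => levy_kernel s p (f u) (g u)).
Proof.
move=> mf mg; apply: (measurableT_comp (measurable_levy_density s p)).
by apply: measurable_taddt => //; exact: measurable_tscale.
Qed.

Definition levy_mass s p : \bar R := (\int[mu]_h (levy_density s p h)%:E)%E.

Lemma integral_levy_kernel s p x :
  (\int[mu]_y (levy_kernel s p x y)%:E = levy_mass s p)%E.
Proof.
apply: (@ge0_integral_shift _ _ (toppt x) (fun h => (levy_density s p h)%:E)).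
- by apply/measurable_EFinP; exact: measurable_levy_density.
- by move=> h; rewrite lee_fin levy_density_ge0.
Qed.

Lemma far_kernel_le s p e x y : 0 < p -> 0 < e -> far e x y ->
  (eucl_dist x y `^ (N%:R + s * p))^-1 <=
  (Num.min e 1 `^ p)^-1 * levy_kernel s p x y.
Proof.
move=> p0 e0 xy; have m0 : 0 < Num.min e 1 by rewrite lt_min e0/=.
have mp0 : 0 < Num.min e 1 `^ p by rewrite powR_gt0.
rewrite levy_kernelE mulrA ler_peMl ?invr_ge0 ?powR_ge0//.
rewrite ler_pdivlMl// mulr1 ge0_ler_powR ?nnegrE ?(ltW p0)// ?(ltW m0)//.
  by rewrite le_min eucl_dist_ge0/=.
by rewrite le_min !ge_min lexx orbT (ltW xy).
Qed.

Lemma integrable_levy_kernel s p x : 0 < s < 1 -> 1 < p ->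
  mu.-integrable setT (fun y => (levy_kernel s p x y)%:E).
Proof.
move=> hs hp; apply/integrableP; split.
  by apply/measurable_EFinP; exact: measurable_levy_kernel.
under eq_integral do rewrite gee0_abs ?lee_fin ?levy_kernel_ge0//.
by rewrite integral_levy_kernel; exact: integral_levy_density_lty.
Qed.

Lemma integrable_bounded_kernel s p f M e x : 0 < s < 1 -> 1 < p -> 0 < e ->
  measurable_fun setT f -> (forall y, `|f x - f y| <= M) ->
  mu.-integrable (far e x) (EFin \o pL_kernel s p f x).
Proof.
move=> hs hp e0 mf fM.
set c := M `^ (p - 1) * (Num.min e 1 `^ p)^-1.
have : mu.-integrable (far e x) (fun y => (c * levy_kernel s p x y)%:E).
  under eq_fun do rewrite EFinM.
  apply: integrableZl => //; first exact: measurable_far.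
  apply: integrableS (integrable_levy_kernel x hs hp) => //.
  exact: measurable_far.
apply: le_integrable; first exact: measurable_far.
  apply/measurable_EFinP; apply: measurable_funTS.
  exact: measurable_pL_kernel1.
move=> y xy; rewrite /= lee_fin [leRHS]ger0_norm; last first.
  by rewrite !mulr_ge0 ?invr_ge0 ?powR_ge0 ?levy_kernel_ge0.
rewrite /pL_kernel normrM normr_Phi// ger0_norm ?invr_ge0 ?powR_ge0//.
rewrite /c -mulrA ler_pM ?powR_ge0 ?invr_ge0 ?powR_ge0//; last first.
  by apply: far_kernel_le => //; lra.
rewrite ge0_ler_powR ?nnegrE//; first lra.
exact: le_trans (fM x).
Qed.

(** Near [0] the truncations are bounded because they converge; away from [0]
    because the kernel is absolutely integrable there. *)
Lemma truncated_pL_bounded s p f x l : is_PV s p f x l ->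
  exists K, forall e, 0 < e -> `|truncated_pL s p f e x| <= K.
Proof.
move=> [intf /cvgrPdist_lt /(_ 1 ltr01)].
rewrite near_withinE => -[d /= d0 hd].
pose d2 := d / 2; have d20 : 0 < d2 by rewrite divr_gt0.
pose I := \int[mu]_(y in far d2 x) `|pL_kernel s p f x y|.
exists (Num.max (`|l| + 1) I) => e e0; rewrite le_max.
have [ed|de] := leP e d2; apply/orP; [left|right].
  have := hd e; rewrite /ball/= sub0r normrN gtr0_norm// => /(_ _ e0) h.
  have /h {}h : e < d by rewrite (le_lt_trans ed)// /d2; lra.
  rewrite -[X in `|X|](subrK l) addrC (le_trans (ler_normD _ _))// lerD2l.
  by rewrite distrC ltW.
have sub : far e x `<=` far d2 x by move=> y; exact: lt_trans.
have int_abs : mu.-integrable (far d2 x) (EFin \o (fun y => `|pL_kernel s p f x y|)).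
  exact: integrable_abse (intf _ d20).
apply: (le_trans (le_normr_Rintegral _ (intf _ e0))); first exact: measurable_far.
rewrite /I /Rintegral fine_le//.
- apply: integrable_fin_num; first exact: measurable_far.
  exact: (integrableS (measurable_far _ _) (measurable_far _ _) sub int_abs).
- by apply: integrable_fin_num => //; exact: measurable_far.
- apply: ge0_subset_integral => //; try exact: measurable_far.
  by have /integrableP[] := int_abs.
Qed.

(** Homogeneity: the change of variables turns the singular kernel and the
    function into powers of the ratio, and the truncation radius into [e / l]. *)
Lemma truncated_pL_similarity s p f (b : R) l m e x0 : 1 < p -> 0 < l ->
  measurable_fun setT f ->
  (forall y, f (similarity l m y) = l `^ (- b) * f y) ->
  mu.-integrable (far (e / l) x0) (EFin \o pL_kernel s p f x0) ->
  truncated_pL s p f e (similarity l m x0) =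
  l `^ (- (b * (p - 1) + s * p)) * truncated_pL s p f (e / l) x0.
Proof.
move=> p1 l0 mf fS intf; set x := similarity l m x0.
have mfar e' x' (g : T -> R) : measurable_fun setT g ->
    measurable_fun setT (g \_ (far e' x')).
  move=> mg; apply/(measurable_restrictT _ (measurable_far e' x')).
  exact: measurable_funTS.
rewrite /truncated_pL Rintegral_mkcond (Rintegral_similarity m l0); last first.
  by apply: mfar; exact: measurable_pL_kernel1.
rewrite [in RHS]Rintegral_mkcond.
set g := (pL_kernel s p f x0 \_ (far (e / l) x0)).
have -> : \int[mu]_y (pL_kernel s p f x \_ (far e x)) (similarity l m y) =
    \int[mu]_y (l `^ (- (b * (p - 1) + s * p + N%:R)) * g y).
  apply: eq_Rintegral => y _; rewrite /g !patchE.
  have -> : (similarity l m y \in far e x) = (y \in far (e / l) x0).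
    apply/idP/idP; rewrite !inE /far/= /x eucl_dist_similarity ?ltW//;
    by rewrite ltr_pdivrMr// mulrC.
  case: ifPn => _; last by rewrite mulr0.
  rewrite /pL_kernel /x !fS eucl_dist_similarity ?ltW// -mulrBr.
  rewrite PhiM ?powR_ge0// (powRM _ (ltW l0) (eucl_dist_ge0 _ _)) invfM.
  rewrite -[in LHS]powRN -powRrM mulrACA -powRD; last by rewrite (gt_eqF l0) implybT.
  by congr (_ `^ _ * _); ring.
rewrite RintegralZl//; last first.
  by rewrite /g -restrict_EFin; apply/(integrable_mkcond _ (measurable_far _ _)).
rewrite mulrA -(powR_mulrn N (ltW l0)) -powRD; last by rewrite (gt_eqF l0) implybT.
by congr (_ `^ _ * _); ring.
Qed.

(** A principal value at one unit vector bounds all truncations there; similarities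
    carry this bound to all points away from the origin.  The power of
    [r0] is the homogeneity factor, nonincreasing in [eucl_norm x]. *)
Lemma homogeneous_truncated_pL_bounded s p f (b r0 : R) x0 l0 :
  1 < p -> 0 < r0 -> 0 <= b * (p - 1) + s * p -> measurable_fun setT f ->
  (forall l m y, 0 < l -> f (similarity l m y) = l `^ (- b) * f y) ->
  eucl_norm x0 = 1 -> is_PV s p f x0 l0 ->
  exists K, forall e x, 0 < e -> r0 <= eucl_norm x ->
    `|truncated_pL s p f e x| <= K.
Proof.
move=> p1 r00 g0 mf fS x01 PV; have [K hK] := truncated_pL_bounded PV.
exists (r0 `^ (- (b * (p - 1) + s * p)) * K) => e x e0 rx.
have xp : 0 < eucl_norm x by exact: lt_le_trans rx.
have [|m <-] := @similarity_transitive _ _ x0 x x01; first by rewrite gt_eqF.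
have el : 0 < e / eucl_norm x by rewrite divr_gt0.
rewrite (truncated_pL_similarity (b := b))//; last 2 first.
- by move=> y; exact: fS.
- exact: PV.1.
rewrite normrM ger0_norm ?powR_ge0// ler_pM ?powR_ge0 ?hK//.
rewrite !powRN lef_pV2 ?posrE ?powR_gt0// ge0_ler_powR ?nnegrE// ltW//.
Qed.

Lemma eq_truncated_pL s p f g e x : {ae mu, forall y, f y = g y} -> f x = g x ->
  measurable_fun setT f -> measurable_fun setT g ->
  truncated_pL s p f e x = truncated_pL s p g e x.
Proof.
move=> fg fgx mf mg; congr fine; apply: ae_eq_integral.
- exact: measurable_far.
- by apply/measurable_EFinP; apply: measurable_funTS; exact: measurable_pL_kernel1.
- by apply/measurable_EFinP; apply: measurable_funTS; exact: measurable_pL_kernel1.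
- by apply: filterS fg => y fgy _; rewrite /pL_kernel fgx fgy.
Qed.

Lemma ae_eucl_norm_neq0 : (0 < N)%N -> {ae mu, forall x, eucl_norm x != 0}.
Proof.
move=> N0; exists (cball 0); split.
- exact: measurable_cball.
- apply/eqP; rewrite -measure_le0 (le_trans (leb_cball_le _))//.
  by rewrite mulr0 expr0n gt_eqF.
- by move=> x /= /negP; rewrite negbK /cball/= => /eqP->.
Qed.

(** At a contact point from below the kernel only increases, as [Phi p] is
    nondecreasing. *)
Lemma truncated_pL_le s p f V e x : 1 < p ->
  mu.-integrable (far e x) (EFin \o pL_kernel s p f x) ->
  mu.-integrable (far e x) (EFin \o pL_kernel s p V x) ->
  V x = f x -> (forall y, V y <= f y) ->
  truncated_pL s p f e x <= truncated_pL s p V e x.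
Proof.
move=> p1 intf intV Vx Vf; apply: le_Rintegral => //; first exact: measurable_far.
move=> y _; rewrite ler_wpM2r ?invr_ge0 ?powR_ge0// Vx Phi_homo//.
by rewrite lerD2l lerN2.
Qed.

Lemma truncated_pL_ge0 s p V e x : (forall y, V y <= V x) ->
  0 <= truncated_pL s p V e x.
Proof.
move=> Vx; apply: Rintegral_ge0 => y _.
by rewrite mulr_ge0 ?invr_ge0 ?powR_ge0// Phi_ge0// subr_ge0.
Qed.

End truncated_operator.

(** * Capped powers of the norm *)

Section barrier.
Context {R : realType} {N : nat}.
Local Notation T := (N.-tuple R).
Implicit Types (c b r M : R) (x y : T).

(** The cap is put on the norm rather than on the values: as [0 `^ (- b) = 0], a cap
    on the values would leave a discontinuity at the origin. *)
Definition barrier c b r x : R := c * Num.max (eucl_norm x) r `^ (- b).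

Lemma barrier_far c b r x : r <= eucl_norm x ->
  barrier c b r x = c * eucl_norm x `^ (- b).
Proof. by move=> h; rewrite /barrier (max_idPl h). Qed.

Lemma barrier_near c b r x : eucl_norm x <= r ->
  barrier c b r x = c * r `^ (- b).
Proof. by move=> h; rewrite /barrier (max_idPr h). Qed.

Lemma barrier_ge0 c b r x : 0 <= c -> 0 <= barrier c b r x.
Proof. by move=> c0; rewrite mulr_ge0// powR_ge0. Qed.

Lemma ler_powRN b u v : 0 <= b -> 0 < u -> u <= v -> v `^ (- b) <= u `^ (- b).
Proof.
move=> b0 u0 uv; have v0 := lt_le_trans u0 uv.
by rewrite !powRN lef_pV2 ?posrE ?powR_gt0// ge0_ler_powR ?nnegrE// ltW.
Qed.

Lemma barrier_le c b r x : 0 <= c -> 0 <= b -> 0 < r ->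
  barrier c b r x <= c * r `^ (- b).
Proof.
by move=> c0 b0 r0; rewrite ler_wpM2l// ler_powRN// le_max lexx orbT.
Qed.

Lemma barrier_le_powR c b r x : 0 <= c -> 0 <= b -> eucl_norm x != 0 ->
  barrier c b r x <= c * eucl_norm x `^ (- b).
Proof.
move=> c0 b0 x0; rewrite ler_wpM2l// ler_powRN// ?le_max ?lexx//.
by rewrite lt_def x0 eucl_norm_ge0.
Qed.

Lemma barrier_minE c b r M x : 0 <= c -> 0 <= b -> 0 < r ->
  c * r `^ (- b) = M -> eucl_norm x != 0 ->
  barrier c b r x = Num.min (c * eucl_norm x `^ (- b)) M.
Proof.
move=> c0 b0 r0 <- x0; have [h|h] := leP r (eucl_norm x).
  by rewrite barrier_far// (min_idPl _)// ler_wpM2l// ler_powRN.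
rewrite (barrier_near _ _ (ltW h)) (min_idPr _)// ler_wpM2l// ler_powRN ?(ltW h)//.
by rewrite lt_def x0 eucl_norm_ge0.
Qed.

(** For [b <= 1] one has [u <= u `^ b]; otherwise this is convexity. *)
Lemma powR_sub1_le b u : 0 < b -> 0 <= u <= 1 ->
  1 - u `^ b <= (1 + b) * (1 - u).
Proof.
move=> b0 /andP[u0 u1]; have [b1|b1] := leP b 1.
  have : u <= u `^ b.
    move: u0; rewrite le_eqVlt => /predU1P[<-|u0]; first exact: powR_ge0.
    by apply: ger1_powR => //; rewrite u0.
  nra.
have := @normr_powR_tangent _ b u 1 b1.
rewrite (ger0_norm u0) normr1 powR1 /Phi normr1 powR1; nra.
Qed.

Lemma barrier_lipschitz c b r : 0 <= c -> 0 < b -> 0 < r -> forall x y,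
  `|barrier c b r x - barrier c b r y| <=
  c * r `^ (- b) * (1 + b) / r * eucl_dist x y.
Proof.
move=> c0 b0 r0.
suff half (u v : R) : r <= u -> u <= v -> `|u `^ (- b) - v `^ (- b)| <=
    r `^ (- b) * (1 + b) / r * (v - u).
  move=> x y; rewrite /barrier -mulrBr normrM (ger0_norm c0) -!mulrA.
  rewrite ler_wpM2l// !mulrA.
  set u := Num.max _ _; set v := Num.max _ _.
  have ru : r <= u by rewrite le_max lexx orbT.
  have rv : r <= v by rewrite le_max lexx orbT.
  have uv : `|u - v| <= eucl_dist x y.
    apply: le_trans (eucl_norm_lipschitz x y); rewrite /u /v.
    by rewrite ler_norml; apply/andP; split; have := ler_norm (eucl_norm x - eucl_norm y);
      have := lerNnormlW (lexx `|eucl_norm x - eucl_norm y|);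
      rewrite /Num.max; case: ifPn; case: ifPn; rewrite -?leNgt; lra.
  apply: (@le_trans _ _ (r `^ (- b) * (1 + b) / r * `|u - v|)); last first.
    by rewrite ler_wpM2l// !mulr_ge0 ?powR_ge0 ?invr_ge0 ?(ltW r0)//; lra.
  have [le_uv|lt_vu] := leP u v.
    by rewrite (le_trans (half _ _ ru le_uv))// distrC ger0_norm ?subr_ge0.
  rewrite distrC (le_trans (half _ _ rv (ltW lt_vu)))// ger0_norm ?subr_ge0//.
  exact: ltW.
move=> ru uv; have u0 : 0 < u by lra.
have v0 : 0 < v by lra.
rewrite ger0_norm ?subr_ge0 ?ler_powRN// ?(ltW b0)//.
have -> : u `^ (- b) - v `^ (- b) = u `^ (- b) * (1 - (u / v) `^ b).
  rewrite powRM ?invr_ge0 ?ltW// -(powR_inv1 (ltW v0)) -powRrM mulN1r.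
  rewrite mulrBr mulr1 mulrA -powRD; last by rewrite (gt_eqF u0) implybT.
  by rewrite addNr powRr0 mul1r.
apply: (@le_trans _ _ (r `^ (- b) * ((1 + b) * (1 - u / v)))).
  rewrite ler_pM ?powR_ge0 ?ler_powRN ?(ltW b0)//.
    rewrite subr_ge0; apply: (@le_trans _ _ (1 `^ b)); last by rewrite powR1.
    rewrite ge0_ler_powR ?nnegrE ?divr_ge0 ?(ltW b0) ?(ltW u0) ?(ltW v0)//.
    by rewrite ler_pdivrMr// mul1r.
  apply: powR_sub1_le => //; rewrite divr_ge0 ?(ltW u0) ?(ltW v0)//=.
  by rewrite ler_pdivrMr// mul1r.
rewrite -!mulrA ler_wpM2l ?powR_ge0// ler_wpM2l//; first by lra.
rewrite (_ : 1 - u / v = v^-1 * (v - u)); last by field; rewrite gt_eqF.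
rewrite ler_wpM2r ?subr_ge0// lef_pV2 ?posrE//; lra.
Qed.

Lemma measurable_barrier c b r : measurable_fun setT (barrier c b r).
Proof.
have mn : measurable_fun setT (@eucl_norm R N) by exact: measurable_eucl_norm.
apply: measurable_funM => //.
apply: (measurableT_comp (measurable_powR _)).
exact: measurable_maxr.
Qed.

End barrier.

(** * Square-integrable functions and products of measures *)

Section square_integrable.
Context {d} {T : measurableType d} {R : realType}.
Variable mu : {measure set T -> \bar R}.
Implicit Types (f g : T -> R).

Lemma Lfun_measurable p f : f \in Lfun mu p -> measurable_fun setT f.
Proof. by move=> /andP[]; rewrite inE. Qed.

Lemma Lfun_fin_norm p f : f \in Lfun mu p -> ('N[mu]_p[EFin \o f] < +oo)%E.
Proof. by move=> /andP[_]; rewrite inE. Qed.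

Lemma Lfun2P f : f \in Lfun mu 2%:E <->
  measurable_fun setT f /\ mu.-integrable setT (fun x => (f x ^+ 2)%:E).
Proof.
split=> [f2|[mf f2]].
  by split; [exact: Lfun_measurable f2|exact: Lfun2_integrable_sqr].
rewrite inE; apply/andP; split; rewrite inE//= /finite_norm unlock.
apply: poweR_lty; have /integrableP[_] := f2; apply: le_lt_trans.
rewrite le_eqVlt; apply/orP; left; apply/eqP; apply: eq_integral => x _ /=.
by rewrite powR_mulrn// normrX.
Qed.

Lemma Lfun2_dominated f g : f \in Lfun mu 2%:E -> measurable_fun setT g ->
  (forall x, `|g x| <= `|f x|) -> g \in Lfun mu 2%:E.
Proof.
move=> /Lfun2P[mf f2] mg gf; apply/Lfun2P; split => //.
apply: le_integrable f2 => //.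
  by apply/measurable_EFinP; exact: measurable_funX.
move=> x _ /=; rewrite lee_fin !normrX.
by rewrite lerXn2r ?nnegrE.
Qed.

Lemma Lfun2D f g : f \in Lfun mu 2%:E -> g \in Lfun mu 2%:E ->
  (fun x => f x + g x) \in Lfun mu 2%:E.
Proof.
move=> /Lfun2P[mf f2] /Lfun2P[mg g2]; apply/Lfun2P; split.
  exact: measurable_funD.
have : mu.-integrable setT (fun x => (2 * f x ^+ 2 + 2 * g x ^+ 2)%:E).
  under eq_fun do rewrite EFinD !EFinM.
  by apply: integrableD => //; apply: integrableZl.
apply: le_integrable => //.
  by apply/measurable_EFinP; apply: measurable_funX; exact: measurable_funD.
move=> x _ /=; rewrite lee_fin ger0_norm ?sqr_ge0//.
rewrite ger0_norm; last by rewrite addr_ge0// mulr_ge0// sqr_ge0.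
by have := sqr_ge0 (f x - g x); nra.
Qed.

Lemma Lfun2N f : f \in Lfun mu 2%:E -> (\- f) \in Lfun mu 2%:E.
Proof.
move=> f2; apply: (Lfun2_dominated f2) => [|x]; last by rewrite /= normrN.
by apply: measurable_funN; exact: Lfun_measurable f2.
Qed.

Lemma Lfun2B f g : f \in Lfun mu 2%:E -> g \in Lfun mu 2%:E ->
  (fun x => f x - g x) \in Lfun mu 2%:E.
Proof. by move=> f2 /Lfun2N g2; exact: Lfun2D. Qed.

Lemma Lfun2M_integrable f g : f \in Lfun mu 2%:E -> g \in Lfun mu 2%:E ->
  mu.-integrable setT (fun x => (f x * g x)%:E).
Proof. by move=> f2 g2; apply/Lfun1_integrable; exact: Lfun2_mul_Lfun1. Qed.

Lemma markov_ge (c : R) (h : T -> R) : 0 <= c -> measurable_fun setT h ->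
  (forall x, 0 <= h x) ->
  (c%:E * mu [set x | (c <= h x)%R] <= \int[mu]_x (h x)%:E)%E.
Proof.
move=> c0 mh h0.
have mS : measurable [set x | c <= h x].
  rewrite (_ : [set x | _] = h @^-1` `[c, +oo[%classic); last first.
    by apply/seteqP; split => x /=; rewrite in_itv/= andbT.
  by rewrite -[X in measurable X]setTI; exact: mh.
rewrite -[X in (_ * mu X)%E]setIT -integral_indic// -ge0_integralZl_EFin//; last first.
  by apply/measurable_EFinP; exact: measurable_indic.
apply: ge0_le_integral => //.
- by move=> x _; rewrite -EFinM lee_fin mulr_ge0// indicE.
- under eq_fun do rewrite -EFinM.
  by apply/measurable_EFinP; apply: measurable_funM => //; exact: measurable_indic.
- by apply/measurable_EFinP.
- move=> x _; rewrite -EFinM lee_fin indicE; have [/set_mem xS|_] := boolP (x \in _).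
    by rewrite mulr1.
  by rewrite mulr0.
Qed.

Lemma Lfun2_superlevel_lty (c : R) f : 0 < c -> f \in Lfun mu 2%:E ->
  (mu [set x | (c < f x)%R] < +oo)%E.
Proof.
move=> c0 /Lfun2P[mf f2].
have c20 : 0 < c ^+ 2 by rewrite exprn_gt0.
have mS : measurable [set x | c < f x].
  rewrite (_ : [set x | _] = f @^-1` `]c, +oo[%classic); last first.
    by apply/seteqP; split => x /=; rewrite in_itv/= andbT.
  by rewrite -[X in measurable X]setTI; exact: mf.
have mf2 : measurable_fun setT (fun x => f x ^+ 2) by exact: measurable_funX.
have mS2 : measurable [set x | c ^+ 2 <= f x ^+ 2].
  rewrite (_ : [set x | _] = (fun x => f x ^+ 2) @^-1` `[c ^+ 2, +oo[%classic); last first.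
    by apply/seteqP; split => x /=; rewrite in_itv/= andbT.
  by rewrite -[X in measurable X]setTI; exact: mf2.
apply: (@le_lt_trans _ _ (mu [set x | (c ^+ 2 <= f x ^+ 2)%R])).
  apply: le_measure; rewrite ?inE// => x /= cf.
  by rewrite lerXn2r ?nnegrE ?ltW// (lt_trans c0).
have := @markov_ge (c ^+ 2) (fun x => f x ^+ 2) (ltW c20) mf2 (fun x => sqr_ge0 _).
have : (\int[mu]_x (f x ^+ 2)%:E < +oo)%E.
  have /integrableP[_] := f2; apply: le_lt_trans.
  by rewrite le_eqVlt; apply/orP; left; apply/eqP; apply: eq_integral => x _;
    rewrite gee0_abs// lee_fin sqr_ge0.
move=> lt /le_lt_trans/(_ lt); apply: contraTT; rewrite -!leNgt !leye_eq => /eqP ->.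
by rewrite gt0_muley ?lte_fin.
Qed.

End square_integrable.

Section real_fubini.
Context {d} {T : measurableType d} {R : realType}.
Variable mu : {sigma_finite_measure set T -> \bar R}.
Implicit Types (f : T * T -> R).

Lemma Rintegral_prod f (F : T -> R) :
  (mu \x mu)%E.-integrable setT (EFin \o f) ->
  (forall x, (\int[mu]_y (f (x, y))%:E)%E = (F x)%:E) ->
  mu.-integrable setT (EFin \o F) /\
  \int[(mu \x mu)%E]_z f z = \int[mu]_x F x.
Proof.
move=> intf FE; have := integrable_fubini_F intf.
have -> : fubini_F mu (EFin \o f) = EFin \o F by apply/funext => x; exact: FE.
move=> iF; split=> //; rewrite /Rintegral -integral12_prod_meas1//.
by congr fine; apply: eq_integral => x _; exact: FE.
Qed.

Lemma integrable_prod_swap f :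
  (mu \x mu)%E.-integrable setT (EFin \o f) ->
  (mu \x mu)%E.-integrable setT (fun z => (f (z.2, z.1))%:E).
Proof.
move=> intf; have mf : measurable_fun setT (EFin \o f) by exact: measurable_int intf.
have mfs : measurable_fun setT (fun z : T * T => (f (z.2, z.1))%:E).
  by apply: (measurableT_comp mf); exact: measurable_swap.
by apply/(integrable21ltyP _ _ mfs) => /=; exact/(integrable12ltyP _ _ mf).
Qed.

Lemma Rintegral_prod_swap f :
  (mu \x mu)%E.-integrable setT (EFin \o f) ->
  \int[(mu \x mu)%E]_z f (z.2, z.1) = \int[(mu \x mu)%E]_z f z.
Proof.
move=> intf; rewrite /Rintegral -(integral12_prod_meas1 intf).
by rewrite -(integral21_prod_meas1 (integrable_prod_swap intf)).
Qed.

End real_fubini.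

(** * Testing the subdifferential of the energy *)

Section energy_tests.
Context {R : realType} {N : nat}.
Local Notation mu := (leb R N).
Local Notation T := (N.-tuple R).
Local Notation mu2 := (mu \x mu)%E.
Implicit Types (s p e : R) (f g v z w chi V : T -> R).

Definition energy_density s p f (z : T * T) : R :=
  `|f z.1 - f z.2| `^ p / eucl_dist z.1 z.2 `^ (N%:R + s * p).

Lemma energy_density_ge0 s p f u : 0 <= energy_density s p f u.
Proof. by rewrite mulr_ge0 ?invr_ge0 ?powR_ge0. Qed.

Lemma measurable_energy_density s p f : measurable_fun setT f ->
  measurable_fun setT (energy_density s p f).
Proof.
move=> mf; apply: measurable_funM; last first.
  apply: (measurable_inv_dist_powR s p (f := fun z : T * T => eucl_dist z.1 z.2)).
  exact: measurable_eucl_dist.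
apply: (measurableT_comp (measurable_powR _)).
apply: (measurableT_comp (@normr_measurable _ setT)).
by apply: measurable_funB; exact: (measurableT_comp mf).
Qed.

Lemma energy_lty_integrable s p f : 1 < p -> measurable_fun setT f ->
  (energy s p f < +oo)%E ->
  mu2.-integrable setT (EFin \o energy_density s p f).
Proof.
move=> p1 mf fin; apply/integrableP; split.
  by apply/measurable_EFinP; exact: measurable_energy_density.
have p0 : 0 < (2 * p)^-1 by rewrite invr_gt0; lra.
under eq_integral do rewrite /= ger0_norm ?energy_density_ge0//.
move: fin; rewrite /energy; set I := (\int[_]_z _)%E => fin.
rewrite -/I; move: fin; apply: contraTT; rewrite -!leNgt !leye_eq => /eqP ->.
by rewrite gt0_muley// lte_fin.
Qed.

Lemma integrable_energyE s p f :
  mu2.-integrable setT (EFin \o energy_density s p f) ->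
  energy s p f = ((2 * p)^-1 * \int[mu2]_u energy_density s p f u)%:E.
Proof.
move=> intf; rewrite /energy EFinM; congr (_ * _)%E.
by rewrite /Rintegral fineK//; exact: integrable_fin_num.
Qed.

(** The subgradient inequality at [v] with competitor [v - chi]: the time derivative
    [w] of a solution is minus a subgradient. *)
Lemma subdiff_test s p v w chi : 1 < p ->
  in_subdiff s p v (\- w) -> chi \in Lfun mu 2%:E ->
  mu2.-integrable setT (EFin \o energy_density s p (fun x => v x - chi x)) ->
  \int[mu]_x (w x * chi x) <= (2 * p)^-1 *
    (\int[mu2]_u energy_density s p (fun x => v x - chi x) u -
     \int[mu2]_u energy_density s p v u).
Proof.
move=> p1 [v2 w2 fin sub] chi2 intg.
have intv := energy_lty_integrable p1 (Lfun_measurable v2) fin.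
have := sub _ (Lfun2B v2 chi2).
rewrite (integrable_energyE intv) (integrable_energyE intg) -EFinD lee_fin.
rewrite (_ : \int[mu]_x _ = \int[mu]_x (w x * chi x)).
  by rewrite mulrBr => h; rewrite lerBrDl.
by apply: eq_Rintegral => x _ /=; ring.
Qed.

Lemma clip01_sub_le (u a : R) : 0 <= a -> clip01 (u - a) <= `|u|.
Proof.
move=> a0; have [ua|ua] := leP u a; first by rewrite clip01_le0 ?subr_le0.
rewrite (le_trans (clip01_le_normr _))// !ger0_norm; lra.
Qed.

Lemma clip01_sub_Lfun2 f (a : T -> R) : f \in Lfun mu 2%:E ->
  measurable_fun setT a -> (forall x, 0 <= a x) ->
  (fun x => clip01 (f x - a x)) \in Lfun mu 2%:E.
Proof.
move=> f2 ma a0; apply: (Lfun2_dominated f2).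
  apply: (measurableT_comp measurable_clip01).
  by apply: measurable_funB => //; exact: Lfun_measurable f2.
by move=> x; rewrite ger0_norm ?clip01_ge0// clip01_sub_le.
Qed.

(** The positive part of [f - a] is dominated by [f], and [huber] by the square. *)
Lemma huber_sub_integrable f (a : T -> R) : f \in Lfun mu 2%:E ->
  measurable_fun setT a -> (forall x, 0 <= a x) ->
  mu.-integrable setT (fun x => (huber (f x - a x))%:E).
Proof.
move=> f2 ma a0; have [mf f22] := (Lfun2P _ _).1 f2.
apply: le_integrable f22 => //.
  apply/measurable_EFinP; apply: (measurableT_comp measurable_huber).
  exact: measurable_funB.
move=> x _ /=; rewrite lee_fin ger0_norm ?huber_ge0// ger0_norm ?sqr_ge0//.
have [fa|af] := leP (f x - a x) 0; first by rewrite huber_le0// sqr_ge0.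
apply: (le_trans (huber_le_sqr _)); have h : f x - a x <= f x by rewrite gerBl.
by rewrite lerXn2r ?nnegrE ?(ltW af)// (le_trans (ltW af)).
Qed.

(** Monotonicity of the subdifferential, tested with a truncation of [v - z]:
    moving [v] down and [z] up by the same [chi] cannot increase the energy. *)
Lemma subdiff_T_monotone s p v z w w' (delta : R) : 1 < p -> 0 < delta ->
  in_subdiff s p v (\- w) -> in_subdiff s p z (\- w') ->
  w \in Lfun mu 2%:E -> w' \in Lfun mu 2%:E ->
  \int[mu]_x ((w x - w' x) * clip01 (v x - z x - delta)) <= 0.
Proof.
move=> p1 d0 sv sz w2 w'2.
have inv2p : 0 < (2 * p)^-1 by rewrite invr_gt0; lra.
set chi := fun x => clip01 (v x - z x - delta).
have [v2 _ vfin _] := sv; have [z2 _ zfin _] := sz.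
have mv := Lfun_measurable v2; have mz := Lfun_measurable z2.
have chi2 : chi \in Lfun mu 2%:E.
  by apply: (@clip01_sub_Lfun2 _ (fun=> delta)) => //; [exact: Lfun2B|move=> _; exact: ltW].
have mchi := Lfun_measurable chi2.
have intv := energy_lty_integrable p1 mv vfin.
have intz := energy_lty_integrable p1 mz zfin.
have exch u : energy_density s p (fun x => v x - chi x) u +
    energy_density s p (fun x => z x - - chi x) u <=
    energy_density s p v u + energy_density s p z u.
  rewrite /energy_density -!mulrDl ler_wpM2r ?invr_ge0 ?powR_ge0//.
  have := @between0_clip01 _ (v u.1 - z u.1 - delta) (v u.2 - z u.2 - delta).
  rewrite (_ : _ - _ - (_ - _ - _) = (v u.1 - v u.2) - (z u.1 - z u.2)); last by ring.
  move=> /(normr_powR_exchange p1); congr (_ `^ _ + _ `^ _ <= _);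
  by congr `|_|; rewrite /chi; ring.
have intvz : mu2.-integrable setT (fun u => (energy_density s p v u + energy_density s p z u)%:E).
  by under eq_fun do rewrite EFinD; exact: integrableD.
have dom f : measurable_fun setT f ->
    (forall u, energy_density s p f u <= energy_density s p v u + energy_density s p z u) ->
    mu2.-integrable setT (EFin \o energy_density s p f).
  move=> mf h; apply: le_integrable intvz => //.
    by apply/measurable_EFinP; exact: measurable_energy_density.
  move=> u _ /=; rewrite lee_fin ger0_norm ?energy_density_ge0//.
  by rewrite ger0_norm ?addr_ge0 ?energy_density_ge0.
have int1 : mu2.-integrable setT (EFin \o energy_density s p (fun x => v x - chi x)).
  apply: dom => [|u]; first exact: measurable_funB.
  apply: le_trans (exch u); rewrite lerDl; exact: energy_density_ge0.
have int2 : mu2.-integrable setT (EFin \o energy_density s p (fun x => z x - - chi x)).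
  apply: dom => [|u]; first by apply: measurable_funB => //; exact: measurable_funN.
  apply: le_trans (exch u); rewrite lerDr; exact: energy_density_ge0.
have t1 := subdiff_test p1 sv chi2 int1.
have t2 := subdiff_test p1 sz (Lfun2N chi2) int2.
rewrite (_ : \int[mu]_x _ = \int[mu]_x (w x * chi x) + \int[mu]_x (w' x * (\- chi) x)).
  apply: (le_trans (lerD t1 t2)); rewrite -mulrDr.
  rewrite pmulr_rle0//.
  have : \int[mu2]_u (energy_density s p (fun x => v x - chi x) u +
      energy_density s p (fun x => z x - - chi x) u) <=
    \int[mu2]_u (energy_density s p v u + energy_density s p z u).
    apply: le_Rintegral => [//|||u _]; last exact: exch.
      exact: (integrableD measurableT int1 int2).
    exact: (integrableD measurableT intv intz).
  by rewrite RintegralD// RintegralD// addrACA -opprD subr_le0.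
rewrite -RintegralD//.
- by apply: eq_Rintegral => x _ /=; rewrite /chi; ring.
- exact: Lfun2M_integrable.
- by apply: Lfun2M_integrable => //; exact: Lfun2N.
Qed.

End energy_tests.

(** * The equation tested with the excess over a barrier *)

Section barrier_energy.
Context {R : realType} {N : nat}.
Local Notation mu := (leb R N).
Local Notation T := (N.-tuple R).
Local Notation mu2 := (mu \x mu)%E.
Context (s p : R) (hs : 0 < s < 1) (hp : 1 < p).
Context (v V w : T -> R) (delta L M : R).
Hypotheses (delta0 : 0 < delta) (L0 : 0 <= L)
  (mV : measurable_fun setT V) (V0 : forall x, 0 <= V x)
  (VM : forall x, V x <= M)
  (VL : forall x y, `|V x - V y| <= L * eucl_dist x y).
Hypotheses (sub : in_subdiff s p v (\- w)).

Let p0 : 0 < p. Proof. exact: lt_trans hp. Qed.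
Let p_ge0 : 0 <= p. Proof. exact: ltW. Qed.
Let p1_ge0 : 0 <= p - 1. Proof. by rewrite subr_ge0 ltW. Qed.
Let inv2p : 0 < (2 * p)^-1. Proof. by rewrite invr_gt0 mulr_gt0. Qed.

Let v2 : v \in Lfun mu 2%:E. Proof. by case: sub. Qed.
Let mv : measurable_fun setT v. Proof. exact: Lfun_measurable v2. Qed.

Let S : set T := [set x | delta < v x].
Let mS : measurable S.
Proof.
rewrite (_ : S = v @^-1` `]delta, +oo[%classic).
  exact: measurable_preimage_fun.
by apply/seteqP; split => x /=; rewrite in_itv/= andbT.
Qed.
Let Sfin : (mu S < +oo)%E. Proof. exact: Lfun2_superlevel_lty. Qed.

Let chi (x : T) : R := clip01 (v x - V x - delta).

Let chi2 : chi \in Lfun mu 2%:E.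
Proof.
rewrite (_ : chi = fun x => clip01 (v x - (V x + delta))).
  apply: clip01_sub_Lfun2 => //; first exact: measurable_funD.
  by move=> x; rewrite addr_ge0// ltW.
by apply/funext => x; rewrite /chi opprD addrA.
Qed.
Let mchi : measurable_fun setT chi. Proof. exact: Lfun_measurable chi2. Qed.
Let chi_ge0 x : 0 <= chi x. Proof. exact: clip01_ge0. Qed.

Let chi_S x : chi x <= \1_S x.
Proof.
rewrite indicE; have [/set_mem xS|xS] := boolP (x \in S).
  by rewrite clip01_le1.
rewrite /chi clip01_le0//; have : ~ S x by move=> h; rewrite mem_set in xS.
move=> /negP; rewrite -leNgt => h; rewrite subr_le0.
by rewrite (le_trans _ h)// gerBl.
Qed.

(** The excess lives in [S], of finite measure, so the Levy mass is integrable over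
    the pairs that meet [S]. *)
Let integrable_S_levy :
  mu2.-integrable setT (fun z => (\1_S z.1 * levy_kernel s p z.1 z.2)%:E).
Proof.
have mS1 : measurable_fun setT (fun z : T * T => \1_S z.1 : R).
  by apply: (measurableT_comp (measurable_indic mS)).
have ml : measurable_fun setT (fun z : T * T => levy_kernel s p z.1 z.2).
  exact: measurable_levy_kernel.
apply/integrable12ltyP => /=.
  by apply/measurable_EFinP; exact: measurable_funM.
have e (x : T) : (\int[mu]_y `|(\1_S x * levy_kernel s p x y)%:E| =
    (\1_S x)%:E * @levy_mass R N s p)%E.
  have ind0 : 0 <= \1_S x :> R by rewrite indicE.
  under eq_integral => y _.
    rewrite gee0_abs; last by rewrite lee_fin mulr_ge0// levy_kernel_ge0.
    by rewrite EFinM; over.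
  rewrite -(integral_levy_kernel s p x); apply: ge0_integralZl_EFin.
  - exact: measurableT.
  - by move=> y _; rewrite lee_fin levy_kernel_ge0.
  - by apply/measurable_EFinP; exact: measurable_levy_kernel.
  - exact: ind0.
under eq_integral do rewrite e.
rewrite ge0_integralZr//; last 2 first.
- by apply/measurable_EFinP; exact: measurable_indic.
- by apply: integral_ge0 => h _; rewrite lee_fin levy_density_ge0.
rewrite integral_indic// setIT lte_mul_pinfty ?measure_ge0//.
  by rewrite ge0_fin_numE.
exact: integral_levy_density_lty.
Qed.

Let weight (z : T * T) : R := \1_S z.1 * levy_kernel s p z.1 z.2 +
  \1_S z.2 * levy_kernel s p z.1 z.2.

Let integrable_weight : mu2.-integrable setT (EFin \o weight).
Proof.
have swap := integrable_prod_swap integrable_S_levy.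
have -> : EFin \o weight = ((fun z => (\1_S z.1 * levy_kernel s p z.1 z.2)%:E) \+
    (fun z => (\1_S z.2 * levy_kernel s p z.2 z.1)%:E))%E.
  apply/funext => z; rewrite /= -EFinD; congr (_ + _ * _)%:E.
  exact: levy_kernelC.
exact: (integrableD measurableT integrable_S_levy swap).
Qed.

Let weight_ge0 z : 0 <= weight z.
Proof. by rewrite addr_ge0// mulr_ge0 ?levy_kernel_ge0// indicE. Qed.

Let g (x : T) : R := v x - chi x.
Let mg : measurable_fun setT g. Proof. exact: measurable_funB. Qed.

Let LM := Num.max L M.
Let M0 : 0 <= M. Proof. exact: le_trans (V0 [tuple 0 | _ < N]) (VM _). Qed.
Let LM0 : 0 <= LM. Proof. by rewrite le_max L0. Qed.

Let V_osc x y : `|V x - V y| <= M.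
Proof.
have h1 := V0 x; have h2 := V0 y; have h3 := VM x; have h4 := VM y.
rewrite ler_norml; apply/andP; split.
  by rewrite lerBrDl (le_trans _ h1)// subr_le0.
by rewrite lerBlDr (le_trans h3)// lerDl.
Qed.

Let V_density z : energy_density s p V z <= LM `^ p * levy_kernel s p z.1 z.2.
Proof.
rewrite /energy_density levy_kernelE mulrA ler_wpM2r ?invr_ge0 ?powR_ge0//.
rewrite -powRM//; last by rewrite le_min eucl_dist_ge0/=.
rewrite ge0_ler_powR ?nnegrE ?mulr_ge0//.
  by rewrite le_min eucl_dist_ge0/=.
rewrite /Num.min; case: ifPn => _.
  by rewrite (le_trans (VL _ _))// ler_wpM2r ?eucl_dist_ge0// le_max lexx.
by rewrite mulr1 (le_trans (V_osc _ _))// le_max lexx orbT.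
Qed.

Let between_chi x y : between0 (chi x - chi y) ((v x - v y) - (V x - V y)).
Proof.
have := @between0_clip01 _ (v x - V x - delta) (v y - V y - delta).
by congr between0; ring.
Qed.

(** The competitor has finite energy: where [chi] varies, its increments lie between
    those of [v] and those of the Lipschitz bounded [V]. *)
Let g_density z :
  energy_density s p g z <= energy_density s p v z + LM `^ p * weight z.
Proof.
have gE : g z.1 - g z.2 = v z.1 - v z.2 - (chi z.1 - chi z.2).
  by rewrite /g; ring.
have wge : 0 <= LM `^ p * weight z by rewrite mulr_ge0 ?powR_ge0.
have [c0|c0] := eqVneq (chi z.1 - chi z.2) 0.
  by rewrite {1}/energy_density gE c0 subr0 lerDl.
apply: (@le_trans _ _ (energy_density s p v z + energy_density s p V z)).
  rewrite /energy_density -mulrDl ler_wpM2r ?invr_ge0 ?powR_ge0// gE.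
  exact: powR_between.
rewrite lerD2l (le_trans (V_density z))// ler_wpM2l ?powR_ge0//.
rewrite /weight -mulrDl ler_peMl ?levy_kernel_ge0// !indicE.
have [_|n1] := boolP (z.1 \in S); first by rewrite lerDl.
have [_|n2] := boolP (z.2 \in S); first by rewrite lerDr.
have out x : x \notin S -> chi x = 0.
  move=> xS; apply/le_anti; rewrite chi_ge0 andbT.
  by rewrite (le_trans (chi_S x))// indicE (negbTE xS).
by move: c0; rewrite !out// subrr eqxx.
Qed.

Let intv : mu2.-integrable setT (EFin \o energy_density s p v).
Proof. by apply: energy_lty_integrable => //; case: sub. Qed.

Let intg : mu2.-integrable setT (EFin \o energy_density s p g).
Proof.
have : mu2.-integrable setT (fun z => (energy_density s p v z + LM `^ p * weight z)%:E).
  exact: (integrableD measurableT intv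
    (integrableZl measurableT (LM `^ p) integrable_weight)).
apply: le_integrable => //.
  by apply/measurable_EFinP; exact: measurable_energy_density.
move=> z _ /=; rewrite lee_fin ger0_norm ?energy_density_ge0//.
by rewrite ger0_norm ?g_density// addr_ge0 ?energy_density_ge0// mulr_ge0 ?powR_ge0.
Qed.

Let cutoff (n : nat) : R := n.+1%:R^-1.
Let cutoff_gt0 n : 0 < cutoff n. Proof. by rewrite invr_gt0. Qed.

Let farset n : set (T * T) := [set z | far (cutoff n) z.1 z.2].
Let measurable_farset n : measurable (farset n).
Proof.
rewrite (_ : farset n = (fun z : T * T => eucl_dist z.1 z.2) @^-1`
    `]cutoff n, +oo[%classic).
  by apply: measurable_preimage_fun => //; exact: measurable_eucl_dist.
by apply/seteqP; split => z; rewrite /farset /far/= in_itv/= andbT.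
Qed.

Let gain (z : T * T) : R := energy_density s p g z - energy_density s p v z.
Let integrable_gain : mu2.-integrable setT (EFin \o gain).
Proof. exact: (integrableB measurableT intg intv). Qed.

Let near_gain n (z : T * T) : R := gain z * \1_(~` farset n) z.
Let far_gain n (z : T * T) : R := gain z * \1_(farset n) z.

Let integrable_part (A : set (T * T)) : measurable A ->
  mu2.-integrable setT (fun z => (gain z * \1_A z)%:E).
Proof.
move=> mA; apply: le_integrable integrable_gain => //.
  apply/measurable_EFinP; apply: measurable_funM; last exact: measurable_indic.
  by apply/measurable_EFinP; exact: measurable_int integrable_gain.
move=> z _ /=; rewrite lee_fin normrM ler_piMr// indicE.
by case: (z \in A); rewrite ?normr1 ?normr0.
Qed.

(** The part of the energy gain carried by close pairs is an infinitesimal,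
    since the gain is integrable on the whole of the product. *)
Let near_gain_cvg : \int[mu2]_z near_gain n z @[n --> \oo] --> 0.
Proof.
have : (\int[mu2]_z (near_gain n z)%:E)%E @[n --> \oo] --> (\int[mu2]_z (cst 0 z))%E.
  apply: (@dominated_cvg _ _ _ _ _ measurableT _ _ (fun z => `|(gain z)%:E|%E)) => //.
  - move=> n; have /integrableP[+ _] := integrable_part (measurableC (measurable_farset n)).
    exact.
  - move=> z _; have [d0|d0] := eqVneq (eucl_dist z.1 z.2) 0.
      rewrite (_ : (fun n => _) = cst 0%E); first exact: cvg_cst.
      apply/funext => n; rewrite /near_gain /gain /energy_density d0.
      have h : N%:R + s * p != 0.
        by rewrite gt_eqF// ltr_wpDl// mulr_gt0//; case/andP: hs.
      by rewrite powR0// invr0 !mulr0 subrr mul0r.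
    have dp : 0 < eucl_dist z.1 z.2 by rewrite lt_def d0 eucl_dist_ge0.
    apply: cvg_near_cst; near=> n.
    rewrite /near_gain indicE memNset ?mulr0//= => -[]; rewrite /farset/far/=.
    by near: n; exact: near_infty_natSinv_lt (PosNum dp).
  - exact: integrable_abse.
  - move=> n z _; rewrite lee_fin normrM ler_piMr// indicE.
    by case: (z \in _); rewrite ?normr1 ?normr0.
rewrite integral0 => /fine_cvgP[_]; exact.
Unshelve. all: by end_near. Qed.

(** Pairs at a distance at least [cutoff n] contribute the truncated operator of [V]
    against [chi], after symmetrisation. *)
Let flux n (z : T * T) : R :=
  chi z.1 * (pL_kernel s p V z.1 z.2 * \1_(farset n) z).

Let measurable_flux n : measurable_fun setT (flux n).
Proof.
apply: measurable_funM; first exact: (measurableT_comp mchi).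
by apply: measurable_funM; [exact: measurable_pL_kernel|exact: measurable_indic].
Qed.

Let integrable_flux n : mu2.-integrable setT (EFin \o flux n).
Proof.
set c := M `^ (p - 1) * (Num.min (cutoff n) 1 `^ p)^-1.
have c0 : 0 <= c by rewrite mulr_ge0 ?invr_ge0 ?powR_ge0.
have := integrableZl measurableT c integrable_S_levy; apply: le_integrable => //.
  by apply/measurable_EFinP; exact: measurable_flux.
move=> z _ /=; rewrite lee_fin [leRHS]ger0_norm; last first.
  by rewrite mulr_ge0 ?c0// mulr_ge0 ?levy_kernel_ge0.
rewrite /flux normrM [leRHS]mulrCA ler_pM//; first by rewrite ger0_norm.
rewrite indicE; have [/set_mem zf|_] := boolP (z \in farset n); last first.
  by rewrite mulr0 normr0 mulr_ge0 ?levy_kernel_ge0.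
rewrite mulr1 /pL_kernel normrM normr_Phi//.
rewrite [X in _ * X <= _]ger0_norm ?invr_ge0 ?powR_ge0// /c -mulrA.
rewrite ler_pM ?powR_ge0 ?invr_ge0 ?powR_ge0//.
  by rewrite ge0_ler_powR ?nnegrE.
exact: far_kernel_le.
Qed.

Let far_gain_le n z :
  far_gain n z <= - (p * (flux n z + flux n (z.2, z.1))).
Proof.
rewrite /far_gain /flux !indicE.
have -> : ((z.2, z.1) \in farset n) = (z \in farset n).
  by apply/idP/idP; rewrite !inE /farset /far/= eucl_distC.
have [_|_] := boolP (z \in farset n); last by rewrite !mulr0 addr0 mulr0 oppr0.
rewrite !mulr1 /gain /energy_density -mulrBl /pL_kernel/=.
rewrite (eucl_distC z.2) -(opprB (V z.1)) PhiN.
set K := (_ `^ _)^-1; have K0 : 0 <= K by rewrite invr_ge0 powR_ge0.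
have gE : g z.1 - g z.2 = v z.1 - v z.2 - (chi z.1 - chi z.2).
  by rewrite /g; ring.
have := ler_wpM2r K0 (normr_powR_sub hp (between_chi z.1 z.2)).
rewrite -gE => /le_trans; apply; rewrite le_eqVlt; apply/orP; left; apply/eqP.
by ring.
Qed.

Let flux_integral n :
  mu.-integrable setT (fun x => (chi x * truncated_pL s p V (cutoff n) x)%:E) /\
  \int[mu2]_z flux n z = \int[mu]_x (chi x * truncated_pL s p V (cutoff n) x).
Proof.
apply: Rintegral_prod; first exact: integrable_flux.
move=> x; have intx := integrable_bounded_kernel hs hp (cutoff_gt0 n) mV (V_osc x).
rewrite /truncated_pL EFinM /Rintegral fineK; last first.
  by apply: integrable_fin_num => //; exact: measurable_far.
rewrite -integralZl//; last exact: measurable_far.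
rewrite [RHS]integral_mkcond; apply: eq_integral => y _.
rewrite patchE /flux/= indicE -EFinM.
have -> : ((x, y) \in farset n) = (y \in far (cutoff n) x).
  by apply/idP/idP; rewrite !inE.
by case: ifPn => _; rewrite ?mulr1 ?mulr0.
Qed.

Let truncated_inequality n :
  \int[mu]_x (w x * chi x) <= (2 * p)^-1 * \int[mu2]_z near_gain n z -
    \int[mu]_x (chi x * truncated_pL s p V (cutoff n) x).
Proof.
apply: le_trans (subdiff_test hp sub chi2 intg) _.
have [_ <-] := flux_integral n.
rewrite -RintegralB//.
have -> : \int[mu2]_z (energy_density s p g z - energy_density s p v z) =
    \int[mu2]_z near_gain n z + \int[mu2]_z far_gain n z.
  rewrite -RintegralD//; last 2 first.
  - exact: integrable_part (measurableC (measurable_farset n)).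
  - exact: integrable_part (measurable_farset n).
  apply: eq_Rintegral => z _; rewrite /near_gain /far_gain -mulrDr /gain.
  by rewrite !indicE in_setC; case: (z \in _); rewrite ?(addr0, add0r) mulr1.
have ifl := integrable_flux n; have ifs := integrable_prod_swap ifl.
have isum := integrableD measurableT ifl ifs.
have : \int[mu2]_z far_gain n z <=
    \int[mu2]_z (- p * (flux n z + flux n (z.2, z.1))).
  apply: le_Rintegral => //.
  - exact: integrable_part (measurable_farset n).
  - exact: (integrableZl measurableT (- p) isum).
  - by move=> z _; rewrite mulNr; exact: far_gain_le.
rewrite RintegralZl// RintegralD// Rintegral_prod_swap// => h.
rewrite mulrDr lerD2l.
apply: (le_trans (ler_wpM2l (ltW inv2p) h)).
by rewrite le_eqVlt; apply/orP; left; apply/eqP; field; rewrite gt_eqF.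
Qed.

Context (low : T -> R) (K : R).
Hypotheses (mlow : measurable_fun setT low) (lowK : forall x, `|low x| <= K)
  (VK : forall e x, 0 < e -> - K <= truncated_pL s p V e x)
  (Vlow : forall x eta, 0 < eta ->
     \forall n \near \oo, low x - eta <= truncated_pL s p V n.+1%:R^-1 x).

Let K0 : 0 <= K. Proof. exact: le_trans (lowK [tuple 0 | _ < N]). Qed.

Let integrable_indicS (k : R) : mu.-integrable setT (fun x => (k * \1_S x)%:E).
Proof.
under eq_fun do rewrite EFinM.
apply: integrableZl => //; apply/integrableP; split.
  by apply/measurable_EFinP; exact: measurable_indic.
under eq_integral do rewrite gee0_abs ?lee_fin//.
by rewrite integral_indic// setIT.
Qed.

Let integrable_low : mu.-integrable setT (fun x => (chi x * low x)%:E).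
Proof.
apply: le_integrable (integrable_indicS K) => //.
  by apply/measurable_EFinP; exact: measurable_funM.
move=> x _ /=; rewrite lee_fin normrM (ger0_norm (chi_ge0 x)) [leRHS]ger0_norm.
  by rewrite mulrC ler_pM.
by rewrite mulr_ge0// indicE.
Qed.

(** Only the negative part of the error is estimated: this is the part that a
    one-sided limit bound on the operator controls. *)
Let defect n x := Num.min
  (chi x * truncated_pL s p V (cutoff n) x - chi x * low x) 0.

Let defect_le n x : `|defect n x| <= 2 * K * \1_S x.
Proof.
have d0 : defect n x <= 0 by rewrite ge_min lexx orbT.
rewrite ler0_norm// lerNl le_min; apply/andP; split; last first.
  by rewrite oppr_le0 !mulr_ge0// indicE.
rewrite -mulrBr lerNl -mulrN opprB.
apply: (@le_trans _ _ (chi x * (2 * K))).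
  rewrite ler_wpM2l// (_ : 2 * K = K - - K); last by ring.
  rewrite lerB ?VK ?cutoff_gt0// (le_trans (ler_norm _))//.
by rewrite mulrC ler_wpM2l// mulr_ge0.
Qed.

Let measurable_defect n : measurable_fun setT (defect n).
Proof.
apply: measurable_minr => //; apply: measurable_funB.
  by apply/measurable_EFinP; case: (flux_integral n) => /measurable_int.
exact: measurable_funM.
Qed.

Let integrable_defect n : mu.-integrable setT (EFin \o defect n).
Proof.
apply: le_integrable (integrable_indicS (2 * K)) => //.
  by apply/measurable_EFinP; exact: measurable_defect.
move=> x _ /=; rewrite lee_fin [leRHS]ger0_norm ?defect_le//.
by rewrite !mulr_ge0// indicE.
Qed.

Let defect_cvg : \int[mu]_x defect n x @[n --> \oo] --> 0.
Proof.
have : (\int[mu]_x (defect n x)%:E)%E @[n --> \oo] --> (\int[mu]_x (cst 0 x))%E.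
  apply: (@dominated_cvg _ _ _ _ _ measurableT _ _ (fun x => (2 * K * \1_S x)%:E)) => //.
  - by move=> n; apply/measurable_EFinP; exact: measurable_defect.
  - move=> x _; apply: cvg_EFin; first by near=> n.
    apply/cvgrPdist_le => e e0; near=> n.
    rewrite sub0r normrN ler0_norm ?ge_min ?lexx ?orbT// lerNl le_min oppr_le0 (ltW e0) andbT.
    rewrite -mulrBr; apply: (@le_trans _ _ (chi x * - e)).
      by rewrite mulrN lerN2 ler_piMl ?clip01_le1// ltW.
    rewrite ler_wpM2l// lerBrDl; near: n; exact: Vlow.
  - by move=> n x _; rewrite lee_fin defect_le.
rewrite integral0 => /fine_cvgP[_]; exact.
Unshelve. all: by end_near. Qed.

(** The equation tested with [chi] while the operator falls on [V], which need not
    have finite energy.  Far pairs are handled by convexity, which yields the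
    truncated operator of [V]; close pairs carry a vanishing part of the energy.
    As the truncations are bounded from below uniformly by [- K], the lower bound
    [low] of their limit may be used under the integral. *)
Lemma barrier_energy_inequality :
  mu.-integrable setT (fun x => (chi x * low x)%:E) /\
  \int[mu]_x (w x * chi x) <= - \int[mu]_x (chi x * low x).
Proof.
split; first exact: integrable_low.
have cv : (2 * p)^-1 * \int[mu2]_z near_gain n z -
    \int[mu]_x (chi x * low x) - \int[mu]_x defect n x @[n --> \oo] -->
    (2 * p)^-1 * 0 - \int[mu]_x (chi x * low x) - 0.
  apply: cvgB; last exact: defect_cvg.
  apply: cvgB; last exact: cvg_cst.
  by apply: cvgMr; exact: near_gain_cvg.
rewrite mulr0 sub0r subr0 in cv; rewrite -(cvg_lim _ cv)//.
apply: limr_ge; first by apply/cvg_ex; eexists; exact: cv.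
near=> n; apply: (le_trans (truncated_inequality n)).
rewrite -addrA -opprD lerD2l lerN2 -(RintegralD measurableT integrable_low (integrable_defect n)).
apply: le_Rintegral => //.
- exact: (integrableD measurableT integrable_low (integrable_defect n)).
- by case: (flux_integral n).
- by move=> x _; rewrite -lerBrDl ge_min lexx.
Unshelve. all: by end_near. Qed.

End barrier_energy.

(** * The norm of L^2 *)

Section l2norm.
Context {d} {T : measurableType d} {R : realType}.
Variable mu : {measure set T -> \bar R}.
Implicit Types (f g : T -> R).

Definition l2norm f : R := fine ('N[mu]_(2%:E)[EFin \o f])%E.

Lemma l2norm_ge0 f : 0 <= l2norm f.
Proof. by rewrite fine_ge0// Lnorm_ge0. Qed.

Lemma l2normE f : f \in Lfun mu 2%:E -> ('N[mu]_(2%:E)[EFin \o f])%E = (l2norm f)%:E.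
Proof.
by move=> /Lfun_fin_norm f2; rewrite fineK// ge0_fin_numE// Lnorm_ge0.
Qed.

Lemma l2norm_tri f g : f \in Lfun mu 2%:E -> g \in Lfun mu 2%:E ->
  l2norm (fun x => f x + g x) <= l2norm f + l2norm g.
Proof.
move=> f2 g2; rewrite -lee_fin EFinD -!l2normE//; last exact: Lfun2D.
apply: (@minkowski_EFin _ _ _ mu f g 2).
- exact: Lfun_measurable f2.
- exact: Lfun_measurable g2.
- lra.
Qed.

Lemma l2norm_cauchy_schwarz f g : f \in Lfun mu 2%:E -> g \in Lfun mu 2%:E ->
  `|\int[mu]_x (f x * g x)| <= l2norm f * l2norm g.
Proof.
move=> f2 g2; have ifg := Lfun2M_integrable f2 g2.
apply: (le_trans (le_normr_Rintegral measurableT ifg)).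
rewrite -lee_fin EFinM -!l2normE// /Rintegral fineK; last first.
  apply: integrable_fin_num => //; exact: integrable_abse ifg.
have := @hoelder _ _ _ mu f g 2 2 (Lfun_measurable f2) (Lfun_measurable g2).
by rewrite Lnorm1; apply; lra.
Qed.

Lemma l2norm_sqr f : f \in Lfun mu 2%:E ->
  \int[mu]_x (f x ^+ 2) = l2norm f ^+ 2.
Proof.
move=> f2; have := @powR_Lnorm _ _ _ mu (EFin \o f) 2.
rewrite l2normE// poweR_EFin powR_mulrn ?l2norm_ge0// => e.
apply: EFin_inj; rewrite e ?pnatr_eq0// /Rintegral fineK.
  by apply: eq_integral => x _ /=; rewrite powR_mulrn// real_normK ?num_real.
by apply: integrable_fin_num => //; case/Lfun2P: f2.
Qed.

Lemma l2norm_le f g : f \in Lfun mu 2%:E -> g \in Lfun mu 2%:E ->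
  (forall x, `|f x| <= `|g x|) -> l2norm f <= l2norm g.
Proof.
move=> f2 g2 fg; rewrite -(@ler_pXn2r _ 2)// ?nnegrE ?l2norm_ge0//.
rewrite -!l2norm_sqr//; apply: le_Rintegral => //.
- by case/Lfun2P: f2.
- by case/Lfun2P: g2.
- by move=> x _; rewrite -real_normK ?num_real// -[leRHS]real_normK ?num_real// lerXn2r ?nnegrE.
Qed.

Lemma l2normN f : l2norm (\- f) = l2norm f.
Proof.
rewrite /l2norm (_ : EFin \o _ = \- (EFin \o f))%E// (oppe_Lnorm mu (EFin \o f))//.
Qed.

End l2norm.

(** * Monotonicity from left difference quotients *)

Section left_dini.
Context {R : realType}.
Local Notation lam := (@lebesgue_measure R).
Implicit Types (phi : R -> R) (b c e r t K : R).

Lemma open_left_interval (U : set R) t : open U -> U t ->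
  exists2 e, 0 < e & forall r, t - e <= r <= t -> U r.
Proof.
move=> oU Ut; have /nbhs_ballP[e /= e0 sub] := open_nbhs_nbhs (conj oU Ut).
exists (e / 2); first by rewrite divr_gt0.
move=> r /andP[r1 r2]; apply: sub; rewrite /ball/= ger0_norm; lra.
Qed.

(** A continuous induction from [b] down to [c].  The exceptional null set is
    covered by an open set [U] of small measure: there, the one-sided Lipschitz
    bound lets [phi] increase by at most [K] times the measure of [U].  Left
    quotients are the right ones here: a convex functional of the solution at
    time [t] is compared with earlier times through its tangent at [t]. *)
Lemma left_dini_nonincreasing phi c b K : c <= b ->
  (forall r t, c <= r -> r <= t -> t <= b -> phi t - phi r <= K * (t - r)) ->
  {ae lam, forall t, c < t -> t <= b -> forall e, 0 < e ->
     exists2 r, c <= r < t & phi t - phi r <= e * (t - r)} ->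
  phi b <= phi c.
Proof.
move=> cb lip0 [A [mA A0 subA]].
pose k := Num.max K 0; have k0 : 0 <= k by rewrite le_max lexx orbT.
have lip r t : c <= r -> r <= t -> t <= b -> phi t - phi r <= k * (t - r).
  move=> cr rt tb; apply: le_trans (lip0 _ _ cr rt tb) _.
  by rewrite ler_wpM2r ?subr_ge0// le_max lexx.
have dini t : c < t -> t <= b -> ~ A t -> forall e, 0 < e ->
     exists2 r, c <= r < t & phi t - phi r <= e * (t - r).
  by move=> ct tb nA; apply: contrapT => h; apply/nA/subA => /= h'; exact/h/h'.
suff main e : 0 < e -> phi b - phi c <= e * (b - c + k).
  apply/ler_addgt0Pl => e e0.
  have bk : 0 < b - c + k + 1 by rewrite ltr_wpDl// addr_ge0// subr_ge0.
  have := main (e / (b - c + k + 1)); rewrite divr_gt0// => /(_ isT) h.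
  rewrite -lerBlDr (le_trans h)// mulrAC -mulrA ger_pMr//.
  by rewrite ler_pdivrMr// mul1r; lra.
move=> e0.
have Afin : (lam A < +oo)%E by rewrite A0.
have [U [oU AU Ue]] := lebesgue_regularity_outer mA Afin e0.
have mU : measurable U by exact: open_measurable.
have lamU : (lam U <= e%:E)%E.
  have -> : U = (U `\` A) `|` A by rewrite setUC setDUK.
  apply: (le_trans (measureU2 _ _ _)) => //; first exact: measurableD.
  by rewrite [X in (_ + X)%E]A0 adde0 ltW.
have Ufin : (lam U < +oo)%E by exact: le_lt_trans lamU (ltry _).
pose W t := U `&` `[t, b]%classic.
have mW t : measurable (W t) by exact: measurableI.
have Wfin t : lam (W t) \is a fin_num.
  rewrite ge0_fin_numE//; apply: le_lt_trans Ufin.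
  by apply: le_measure; rewrite ?inE; [exact: mW|exact: mU|exact: subIsetl].
pose m t := fine (lam (W t)).
have m_mono r t : r <= t -> m t <= m r.
  move=> rt; rewrite fine_le//; apply: le_measure; rewrite ?inE; [exact: mW|exact: mW|].
  move=> x [Ux /=]; rewrite in_itv/= => /andP[tx xb]; split => //=.
  by rewrite in_itv/= xb (le_trans rt).
have m_step r t : r <= t -> t <= b -> (forall x, r <= x <= t -> U x) ->
    m t + (t - r) <= m r.
  move=> rt tb sub; rewrite -lee_fin EFinD !fineK//.
  have -> : (t - r)%:E = lam `[r, t[%classic.
    rewrite lebesgue_measure_itv/= lte_fin; case: ltP => // tr.
    by congr EFin; lra.
  have disj : W t `&` `[r, t[%classic = set0.
    apply/seteqP; split => x //= -[[_ /=]]; rewrite !in_itv/= => /andP[h1 _] /andP[_ h2].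
    by move: (le_lt_trans h1 h2); rewrite ltxx.
  have mI : measurable (`[r, t[%classic : set (measurableTypeR R)).
    exact: measurable_itv.
  have <- := measureU lam (mW t) mI disj.
  apply: le_measure; rewrite ?inE; [|exact: mW|].
    by apply: measurableU; [exact: mW|exact: mI].
  move=> x [[Ux /=]|/=]; rewrite in_itv/= => /andP[h1 h2]; split => //=.
  - by rewrite in_itv/= h2 (le_trans rt).
  - by apply: sub; rewrite h1 ltW.
  - by rewrite in_itv/= h1 (le_trans (ltW h2)).
(* [m t] is the measure of the part of [U] still to the right of [t]. *)
pose S := [set t | c <= t <= b /\ phi b - phi t <= e * (b - t) + k * m t].
have Sb : S b.
  by rewrite /S/= cb lexx !subrr mulr0 add0r mulr_ge0// fine_ge0.
have hS : has_inf S by split; [exists b|exists c => t [/andP[]]].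
pose i := inf S.
have ci : c <= i by apply: lb_le_inf; [exists b|move=> t [/andP[]]].
have ib : i <= b by apply: ge_inf => //; case: hS.
have Si : S i.
  split; first by rewrite ci ib.
  apply/ler_addgt0Pl => eta eta0.
  have et : 0 < eta / (k + 1) by rewrite divr_gt0// ltr_wpDl.
  have [t [/andP[ct tb] St] ti] := inf_adherent et hS.
  have it : i <= t by apply: ge_inf; [case: hS|split => //; rewrite ct].
  have h1 := lip _ _ ci it tb.
  have h2 : k * m t <= k * m i by rewrite ler_wpM2l// m_mono.
  have h3 : k * (t - i) <= eta.
    apply: (@le_trans _ _ ((k + 1) * (eta / (k + 1)))).
      by rewrite ler_pM ?subr_ge0//; move: ti; rewrite -/i; lra.
    by rewrite mulrC divfK// gt_eqF// ltr_wpDl.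
  have h4 : e * (b - t) <= e * (b - i) by rewrite ler_wpM2l ?(ltW e0)//; lra.
  by rewrite -(subrK (phi t) (phi b)) -addrA; lra.
have [ic|ic] := eqVneq i c.
  case: Si => _; rewrite ic => /le_trans; apply.
  rewrite [leRHS]mulrDr lerD2l mulrC ler_wpM2r// -lee_fin fineK//.
  by apply: le_trans lamU; apply: le_measure; rewrite ?inE; [exact: mW|exact: mU|exact: subIsetl].
have lt_ci : c < i by rewrite lt_def ic.
suff [r /andP[cr ri] Sr] : exists2 r, c <= r < i & S r.
  by have := ge_inf hS.2 Sr; rewrite leNgt ri.
have [_ Si2] := Si.
have [iA|niA] := pselect (A i).
  have [eta eta0 sub] := open_left_interval oU (AU _ iA).
  exists (Num.max c (i - eta)).
    by rewrite le_max lexx/= gt_max lt_ci/=; lra.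
  set r := Num.max _ _.
  have cr : c <= r by rewrite le_max lexx.
  have er : i - eta <= r by rewrite le_max lexx orbT.
  have ri : r <= i by rewrite ge_max ci/=; lra.
  split; first by rewrite cr (le_trans ri).
  have h1 := lip _ _ cr ri ib.
  have : m i + (i - r) <= m r.
    apply: m_step => // x /andP[h2 h3]; apply: sub.
    by rewrite h3 (le_trans er).
  move=> /(ler_wpM2l k0); rewrite mulrDr => h2.
  have h3 : e * (b - i) <= e * (b - r) by rewrite ler_wpM2l ?(ltW e0)//; lra.
  lra.
have [r /andP[cr ri] h] := dini _ lt_ci ib niA e e0.
exists r; first by rewrite cr.
split; first by rewrite cr (le_trans (ltW ri)).
have h2 : k * m i <= k * m r by rewrite ler_wpM2l// m_mono// ltW.
by lra.
Qed.

End left_dini.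

(** * Evolution of the Huber excess *)

Section huber_evolution.
Context {R : realType} {N : nat}.
Local Notation mu := (leb R N).
Local Notation T := (N.-tuple R).
Local Notation lam := (@lebesgue_measure R).
Implicit Types (t r e c : R) (x : T).

(** The regularity in time shared by the semigroup solutions and their
    differences. *)
Definition L2_curve (D : R -> T -> R) : Prop :=
  [/\ forall t, 0 <= t -> D t \in Lfun mu 2%:E,
      forall t, 0 <= t -> forall e, 0 < e -> exists2 h, 0 < h &
        forall r, 0 <= r -> `|r - t| < h -> l2norm mu (fun x => D r x - D t x) < e &
      forall c, 0 < c -> exists K, forall r t, c <= r -> c <= t ->
        l2norm mu (fun x => D r x - D t x) <= K * `|r - t|].

(** [D] is a solution or a difference of two solutions, and [V] a barrier driven by a
    decreasing amplitude [a] with derivative [a']; [B] is the derivative of [V] in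
    [a], and [Vconc] the concavity of [V] in [a]. *)
Context (D V B : R -> T -> R) (a a' : R -> R) (b delta Ka Kb : R).
Hypotheses (b0 : 0 < b) (delta0 : 0 < delta) (curveD : L2_curve D)
  (mV : forall t, measurable_fun setT (V t)) (V0 : forall t x, 0 <= V t x)
  (mB : forall t, measurable_fun setT (B t))
  (Bb : forall t x, 0 <= t <= b -> 0 <= B t x <= Kb)
  (alip : forall r t, 0 <= r -> r <= t -> t <= b -> 0 <= a r - a t <= Ka * (t - r))
  (aderiv : forall t, 0 < t -> t <= b -> forall e, 0 < e -> exists2 h, 0 < h &
     forall r, t - h < r < t -> a r - a t <= (- a' t + e) * (t - r))
  (Vconc : forall r t x, 0 <= r -> r <= t -> t <= b ->
     V r x - V t x <= (a r - a t) * B t x).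

Let d t x : R := D t x - V t x - delta.
Let chi t x : R := clip01 (d t x).
Let D2 t : 0 <= t -> D t \in Lfun mu 2%:E. Proof. by case: curveD => h _ _; exact: h. Qed.
Let mD t : 0 <= t -> measurable_fun setT (D t).
Proof. by move=> /D2; exact: Lfun_measurable. Qed.

Definition huber_excess t : R := \int[mu]_x huber (D t x - V t x - delta).

Let md t : 0 <= t -> measurable_fun setT (d t).
Proof.
move=> t0; apply: measurable_funB => //; apply: measurable_funB => //; exact: mD.
Qed.

Let chi_le t x : chi t x <= `|D t x|.
Proof.
rewrite /chi /d -addrA -opprD; apply: clip01_sub_le; rewrite addr_ge0 ?V0//; exact: ltW.
Qed.

Let chi2 t : 0 <= t -> chi t \in Lfun mu 2%:E.
Proof.
move=> t0; apply: (Lfun2_dominated (D2 t0)).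
  by apply: (measurableT_comp measurable_clip01); exact: md.
by move=> x; rewrite ger0_norm ?clip01_ge0// chi_le.
Qed.

Let di0 : 0 <= delta ^- 2. Proof. by rewrite invr_ge0 sqr_ge0. Qed.

(** [chi] vanishes unless [D] exceeds [delta]: this is how the height [delta] turns
    square integrability into integrability. *)
Let chi_le_sqr t x : chi t x <= delta ^- 2 * D t x ^+ 2.
Proof.
have [dD|Dd] := leP (D t x) delta.
  rewrite /chi clip01_le0; first by rewrite (mulr_ge0 di0)// sqr_ge0.
  by rewrite /d; have := V0 t x; lra.
apply: (le_trans (clip01_le1 _)); rewrite ler_pdivlMl ?exprn_gt0// mulr1.
by rewrite lerXn2r ?nnegrE ?(ltW delta0)// ltW// (lt_trans delta0).
Qed.

Let huber_integrable t : 0 <= t ->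
  mu.-integrable setT (fun x => (huber (d t x))%:E).
Proof.
move=> t0; rewrite (_ : (fun x => _) = fun x => (huber (D t x - (V t x + delta)))%:E).
  apply: huber_sub_integrable; first exact: D2.
    exact: measurable_funD.
  by move=> x; rewrite addr_ge0// ltW.
by apply/funext => x; rewrite /d opprD addrA.
Qed.

Let chi_integrable t : 0 <= t -> mu.-integrable setT (fun x => (chi t x)%:E).
Proof.
move=> t0; have [_ D22] := (Lfun2P _ _).1 (D2 t0).
apply: le_integrable (integrableZl measurableT (delta ^- 2) D22) => //.
  by apply/measurable_EFinP; apply: (measurableT_comp measurable_clip01); exact: md.
move=> x _ /=; rewrite lee_fin ger0_norm ?clip01_ge0//.
by rewrite ger0_norm ?chi_le_sqr// (mulr_ge0 di0)// sqr_ge0.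
Qed.

Let chiB_integrable t : 0 <= t -> t <= b ->
  mu.-integrable setT (fun x => (chi t x * B t x)%:E).
Proof.
move=> t0 tb; apply: le_integrable (integrableZl measurableT Kb (chi_integrable t0)) => //.
  apply/measurable_EFinP; apply: measurable_funM => //.
  by apply: (measurableT_comp measurable_clip01); exact: md.
have tb' : 0 <= t <= b by rewrite t0.
move=> x _ /=; have /andP[B0 BK] := Bb x tb'; rewrite lee_fin.
rewrite ger0_norm ?mulr_ge0 ?clip01_ge0// ger0_norm ?mulr_ge0 ?clip01_ge0 ?(le_trans B0)//.
by rewrite mulrC ler_wpM2r ?clip01_ge0.
Qed.

Let Kb0 : 0 <= Kb.
Proof.
have b00 : 0 <= b <= b by rewrite (ltW b0) lexx.
by have /andP[h1 h2] := Bb [tuple 0 | _ < N] b00; exact: le_trans h2.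
Qed.

Let int_chiB_le t : 0 <= t -> t <= b ->
  0 <= \int[mu]_x (chi t x * B t x) <= Kb * delta ^- 2 * l2norm mu (D t) ^+ 2.
Proof.
move=> t0 tb; have tb' : 0 <= t <= b by rewrite t0.
apply/andP; split.
  apply: Rintegral_ge0 => x _; have /andP[B0 _] := Bb x tb'.
  by rewrite mulr_ge0 ?clip01_ge0.
have [_ D22] := (Lfun2P _ _).1 (D2 t0).
rewrite -l2norm_sqr ?D2// -RintegralZl//.
apply: le_Rintegral => //; first exact: chiB_integrable.
  exact: (integrableZl measurableT (Kb * delta ^- 2) D22).
move=> x _; have /andP[B0 BK] := Bb x tb'.
by rewrite mulrC -mulrA ler_pM ?clip01_ge0.
Qed.

(** Convexity of [huber] and concavity of the barrier in [a], both used at the later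
    time. *)
Let excess_sub r t : 0 <= r -> r <= t -> t <= b ->
  huber_excess t - huber_excess r <=
  \int[mu]_x (chi t x * (D t x - D r x)) +
  (a r - a t) * \int[mu]_x (chi t x * B t x).
Proof.
move=> r0 rt tb; have t0 := le_trans r0 rt.
have i1 : mu.-integrable setT (fun x => (chi t x * (D t x - D r x))%:E).
  by apply: Lfun2M_integrable; [exact: chi2|apply: Lfun2B; exact: D2].
have i2 := chiB_integrable t0 tb.
rewrite -RintegralZl// -RintegralD//; last exact: (integrableZl measurableT (a r - a t) i2).
rewrite /huber_excess -RintegralB ?huber_integrable//.
apply: le_Rintegral => //.
- exact: (integrableB measurableT (huber_integrable t0) (huber_integrable r0)).
- exact: (integrableD measurableT i1 (integrableZl measurableT (a r - a t) i2)).
move=> x _; apply: (le_trans (huber_tangent _ _)).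
rewrite mulrCA -mulrDr ler_wpM2l ?clip01_ge0//.
by have := Vconc x r0 rt tb; lra.
Qed.

(** Continuity at [0] covers a short initial interval, the Lipschitz bound the rest. *)
Let D_bounded : exists2 Q, 0 <= Q & forall t, 0 <= t -> t <= b -> l2norm mu (D t) <= Q.
Proof.
have [_ cont lip] := curveD.
have [h h0 hD] := cont 0 (lexx 0) 1 ltr01.
have h20 : 0 < h / 2 by rewrite divr_gt0.
have [K hK] := lip (h / 2) h20.
have step r t : 0 <= r -> 0 <= t ->
    l2norm mu (D r) <= l2norm mu (fun x => D r x - D t x) + l2norm mu (D t).
  move=> r0 t0; apply: le_trans (l2norm_tri (Lfun2B (D2 r0) (D2 t0)) (D2 t0)).
  rewrite le_eqVlt; apply/orP; left; apply/eqP; congr l2norm.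
  by apply/funext => x; rewrite subrK.
pose Q1 := 1 + l2norm mu (D 0); pose Q2 := `|K| * (b + h) + l2norm mu (D (h / 2)).
have Q10 : 0 <= Q1 by rewrite addr_ge0// l2norm_ge0.
have Q20 : 0 <= Q2.
  by rewrite addr_ge0 ?l2norm_ge0// mulr_ge0// addr_ge0// ltW.
exists (Q1 + Q2); first exact: addr_ge0.
move=> t t0 tb; have [th|ht] := ltP t h.
  apply: (@le_trans _ _ Q1); last by rewrite lerDl.
  apply: (le_trans (step _ _ t0 (lexx 0))); rewrite lerD2r ltW//.
  by apply: hD => //; rewrite subr0 ger0_norm.
have {}h20 := ltW h20.
apply: (@le_trans _ _ Q2); last by rewrite lerDr.
apply: (le_trans (step _ _ t0 h20)); rewrite lerD2r.
apply: (le_trans (hK _ _ _ _)); [lra|lra|].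
apply: (le_trans (ler_norm _)); rewrite normrM ler_wpM2l// normr_id ger0_norm; lra.
Qed.

Let chi_norm t : 0 <= t -> l2norm mu (chi t) <= l2norm mu (D t).
Proof.
move=> t0; apply: l2norm_le; [exact: chi2|exact: D2|move=> x].
by rewrite ger0_norm ?clip01_ge0.
Qed.

Let chi_D_le r t : 0 <= r -> 0 <= t ->
  \int[mu]_x (chi t x * (D t x - D r x)) <=
  l2norm mu (D t) * l2norm mu (fun x => D t x - D r x).
Proof.
move=> r0 t0; apply: (le_trans (ler_norm _)).
apply: (le_trans (l2norm_cauchy_schwarz (chi2 t0) (Lfun2B (D2 t0) (D2 r0)))).
by rewrite ler_wpM2r ?l2norm_ge0 ?chi_norm.
Qed.

Hypothesis energyD : {ae lam, forall t, 0 < t -> t <= b -> exists w,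
  L2_derivative D t w /\
  \int[mu]_x (w x * clip01 (D t x - V t x - delta)) <=
  - \int[mu]_x (clip01 (D t x - V t x - delta) * (- a' t * B t x))}.

(** The derivative [w] of [D] and the derivative [a'] contribute opposite terms, by
    the energy inequality; what remains is an arbitrarily small multiple of
    [t - r]. *)
Let excess_dini t : 0 < t -> t <= b -> (exists w, L2_derivative D t w /\
  \int[mu]_x (w x * chi t x) <= - \int[mu]_x (chi t x * (- a' t * B t x))) ->
  forall e, 0 < e -> exists2 h, 0 < h & forall r, 0 <= r -> t - h < r < t ->
    huber_excess t - huber_excess r <= e * (t - r).
Proof.
move=> t0 tb [w [[w2 Dw] en0]] e e0.
have t0' := ltW t0.
have en : \int[mu]_x (w x * chi t x) <= a' t * \int[mu]_x (chi t x * B t x).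
  apply: le_trans en0 _; under eq_Rintegral do rewrite mulrCA.
  by rewrite RintegralZl ?chiB_integrable// mulNr opprK.
set I := \int[mu]_x (chi t x * B t x).
have /andP[I0 _] := int_chiB_le t0' tb.
have e1 : 0 < e / 2 / (l2norm mu (D t) + 1).
  by rewrite !divr_gt0// ltr_wpDl// l2norm_ge0.
have e2 : 0 < e / 2 / (I + 1) by rewrite !divr_gt0// ltr_wpDl.
have [h1 h10 ha] := aderiv t0 tb e2.
have : \forall h \near 0^', (norm_dist 2 (fun x => (D (t + h) x - D t x) / h)%R w <
    (e / 2 / (l2norm mu (D t) + 1))%:E)%E.
  have := Dw; move/fine_cvgP => [fin /cvgrPdist_lt /(_ _ e1)].
  move: fin; apply: filterS2 => h hfin; rewrite sub0r normrN => hlt.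
  rewrite -(fineK hfin) lte_fin; apply: le_lt_trans hlt; exact: ler_norm.
rewrite near_withinE => -[h2 /= h20 hD].
exists (Num.min h1 h2); first by rewrite lt_min h10.
move=> r r0 /andP[r1 r2].
have tr0 : 0 < t - r by lra.
have rh1 : t - h1 < r by apply: le_lt_trans r1; rewrite lerB// ge_min lexx.
have rh2 : t - r < h2.
  by rewrite ltrBlDr addrC -ltrBlDr; apply: le_lt_trans r1; rewrite lerB// ge_min lexx orbT.
apply: (le_trans (excess_sub r0 (ltW r2) tb)); rewrite -/I.
have rne : r - t != 0 by rewrite subr_eq0 lt_eqF.
have {}hD := hD (r - t).
have {hD} hD : (norm_dist 2 (fun x => (D (t + (r - t)) x - D t x) / (r - t))%R w <
    (e / 2 / (l2norm mu (D t) + 1))%:E)%E.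
  by apply: hD => //; rewrite /ball/= sub0r normrN distrC gtr0_norm.
set q := fun x => (D t x - D r x) / (t - r).
have q2 : q \in Lfun mu 2%:E.
  have := @Lfun_scale _ _ _ mu _ (t - r)^-1 2 _ (Lfun2B (D2 t0') (D2 r0)).
  by rewrite (_ : _ \o* _ = q); [apply; lra|apply/funext => x].
have qE : (fun x => (D (t + (r - t)) x - D t x) / (r - t)) = q.
  by apply/funext => x; rewrite /q (addrC t) subrK -(opprB t r) -(opprB (D t x)) invrN mulrNN.
rewrite qE /norm_dist in hD.
have qw : l2norm mu (fun x => q x - w x) <= e / 2 / (l2norm mu (D t) + 1).
  by rewrite -lee_fin -l2normE ?Lfun2B//; exact: ltW hD.
have step1 : \int[mu]_x (chi t x * (D t x - D r x)) =
    (t - r) * (\int[mu]_x (chi t x * (q x - w x)) + \int[mu]_x (w x * chi t x)).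
  have i1 := Lfun2M_integrable (chi2 t0') (Lfun2B q2 w2).
  have i2 := Lfun2M_integrable w2 (chi2 t0').
  rewrite -RintegralD// -RintegralZl//; last exact: (integrableD measurableT i1 i2).
  apply: eq_Rintegral => x _; rewrite /q.
  by field; rewrite gt_eqF.
have step2 : \int[mu]_x (chi t x * (q x - w x)) <= e / 2.
  apply: (le_trans (ler_norm _)).
  apply: (le_trans (l2norm_cauchy_schwarz (chi2 t0') (Lfun2B q2 w2))).
  apply: (@le_trans _ _ ((l2norm mu (D t) + 1) * (e / 2 / (l2norm mu (D t) + 1)))).
    apply: ler_pM => //; rewrite ?l2norm_ge0//.
    by apply: (le_trans (chi_norm t0')); lra.
  by rewrite mulrC divfK// gt_eqF// ltr_wpDl ?l2norm_ge0.
have step3 : (a r - a t) * I <= (t - r) * (- a' t * I + e / 2).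
  have := ha r; rewrite rh1 r2 => /(_ isT) /(ler_wpM2r I0) /le_trans; apply.
  rewrite -/I [X in X <= _](_ : _ = (t - r) * (- a' t * I + e / 2 / (I + 1) * I)); last by ring.
  rewrite ler_wpM2l ?(ltW tr0)// lerD2l mulrAC ler_pdivrMr ?ltr_wpDl//.
  by rewrite ler_wpM2l; lra.
rewrite step1.
apply: (le_trans (lerD (ler_wpM2l (ltW tr0) (lerD step2 en)) step3)).
by rewrite -/I le_eqVlt; apply/orP; left; apply/eqP; field.
Qed.

(** The Dini criterion applies on [c, b] for all [c > 0], where [D] is Lipschitz;
    continuity at [0] then lets [c] tend to [0]. *)
Lemma huber_excess_nonincreasing : huber_excess b <= huber_excess 0.
Proof.
have [Q Q0 hQ] := D_bounded.
have [_ cont lip] := curveD.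
pose J := Ka * (Kb * delta ^- 2 * Q ^+ 2).
have Ka0 : 0 <= Ka.
  have /andP[h1 h2] := alip (lexx 0) (ltW b0) (lexx b).
  by have := le_trans h1 h2; rewrite subr0 pmulr_lge0.
have c0 : 0 <= Kb * delta ^- 2 by rewrite mulr_ge0// invr_ge0 sqr_ge0.
have J0 : 0 <= J by rewrite !mulr_ge0// sqr_ge0.
have aI r t : 0 <= r -> r <= t -> t <= b ->
    (a r - a t) * \int[mu]_x (chi t x * B t x) <= J * (t - r).
  move=> r0 rt tb; have t0 := le_trans r0 rt.
  have /andP[a1 a2] := alip r0 rt tb; have /andP[I0 I1] := int_chiB_le t0 tb.
  rewrite /J mulrAC; apply: ler_pM => //.
  apply: (le_trans I1); rewrite ler_wpM2l// lerXn2r ?nnegrE ?l2norm_ge0//.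
  exact: hQ.
have from c : 0 < c -> c <= b -> huber_excess b <= huber_excess c.
  move=> cp cb; have [K hK] := lip c cp.
  apply: (@left_dini_nonincreasing _ huber_excess c b (Q * `|K| + J)) => //.
    move=> r t cr rt tb; have r0 : 0 <= r by lra.
    have t0 := le_trans r0 rt.
    apply: (le_trans (excess_sub r0 rt tb)); rewrite [leRHS]mulrDl lerD ?aI//.
    apply: (le_trans (chi_D_le r0 t0)); rewrite -mulrA.
    apply: ler_pM; rewrite ?l2norm_ge0 ?hQ//.
    apply: (le_trans (hK t r _ _)) => //; first exact: le_trans rt.
    by rewrite ger0_norm ?subr_ge0// ler_wpM2r ?subr_ge0// ler_norm.
  apply: (@filterS _ _ (ae_filter_ringOfSetsType lam) _ _ _ energyD) => t ht ct tb e e0.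
  have tp : 0 < t by lra.
  have [h h0 hh] := excess_dini tp tb (ht tp tb) e0.
  exists (Num.max c (t - h / 2)).
    by rewrite le_max lexx/= gt_max ct/=; lra.
  apply: hh; first by rewrite le_max (ltW cp).
  by rewrite lt_max gt_max ct/=; apply/andP; split; [apply/orP; right|]; lra.
apply/ler_addgt0Pl => e e0.
have e1 : 0 < e / 2 / (Q + 1) by rewrite !divr_gt0// ltr_wpDl.
have [h h0 hh] := cont 0 (lexx 0) _ e1.
pose c := Num.min b (Num.min (h / 2) (e / 2 / (J + 1))).
have cp : 0 < c by rewrite !lt_min b0 !divr_gt0// ltr_wpDl.
have cb : c <= b by rewrite ge_min lexx.
have ch : c <= h / 2 by rewrite !ge_min lexx orbT.
have cJ : c <= e / 2 / (J + 1) by rewrite !ge_min lexx !orbT.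
apply: (le_trans (from c cp cb)).
have := excess_sub (lexx 0) (ltW cp) cb.
have h1 := aI 0 c (lexx 0) (ltW cp) cb.
have h2 := chi_D_le (lexx 0) (ltW cp).
have h3 : l2norm mu (D c) * l2norm mu (fun x => D c x - D 0 x) <= e / 2.
  apply: (@le_trans _ _ ((Q + 1) * (e / 2 / (Q + 1)))).
    apply: ler_pM; rewrite ?l2norm_ge0//.
      by apply: (le_trans (hQ _ (ltW cp) cb)); lra.
    apply/ltW/hh; first exact: ltW.
    by rewrite subr0 gtr0_norm//; lra.
  by rewrite mulrC divfK// gt_eqF// ltr_wpDl.
have h4 : J * (c - 0) <= e / 2.
  rewrite subr0; apply: (@le_trans _ _ ((J + 1) * (e / 2 / (J + 1)))).
    by apply: ler_pM => //; [exact: ltW|lra].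
  by rewrite mulrC divfK// gt_eqF// ltr_wpDl.
lra.
Qed.

End huber_evolution.

(** * Semigroup solutions in L^2 *)

Section semigroup_solutions.
Context {R : realType} {N : nat}.
Local Notation mu := (leb R N).
Local Notation T := (N.-tuple R).
Local Notation lam := (@lebesgue_measure R).
Implicit Types (s p q t r e c delta : R) (x : T) (f g : T -> R) (u v z : R -> T -> R).

Lemma norm_dist2E f g : f \in Lfun mu 2%:E -> g \in Lfun mu 2%:E ->
  norm_dist 2 f g = (l2norm mu (fun x => f x - g x))%:E.
Proof. by move=> f2 g2; rewrite /norm_dist l2normE//; exact: Lfun2B. Qed.

Lemma L2_solution_curve s p f v : L2_semigroup_solution s p f v -> L2_curve v.
Proof.
move=> [f2 v2 _ cont [lip _]]; split => //.
- move=> t t0 e e0; have /fine_cvgP[fin /cvgrPdist_lt /(_ _ e0)] := cont t t0.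
  rewrite near_withinE => /nbhs_ballP[h /= h0 sub]; exists h => // r r0 rt.
  have := sub r; rewrite /ball/= distrC => /(_ rt r0).
  rewrite sub0r normrN norm_dist2E ?v2//=; apply: le_lt_trans; exact: ler_norm.
- move=> c c0; have [K hK] := lip c c0; exists K => r t cr ct.
  have r0 : 0 <= r by apply: le_trans cr; exact: ltW.
  have t0 : 0 <= t by apply: le_trans ct; exact: ltW.
  by rewrite -lee_fin -norm_dist2E ?v2// hK.
Qed.

Lemma L2_curveB u v : L2_curve u -> L2_curve v ->
  L2_curve (fun t x => u t x - v t x).
Proof.
move=> [u2 uc ul] [v2 vc vl].
have tri r t : 0 <= r -> 0 <= t ->
    l2norm mu (fun x => u r x - v r x - (u t x - v t x)) <=
    l2norm mu (fun x => u r x - u t x) + l2norm mu (fun x => v r x - v t x).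
  move=> r0 t0; have h1 := Lfun2B (u2 _ r0) (u2 _ t0).
  have h2 := Lfun2B (v2 _ r0) (v2 _ t0).
  rewrite -(l2normN mu (fun x => v r x - v t x)).
  apply: le_trans (l2norm_tri h1 (Lfun2N h2)).
  rewrite le_eqVlt; apply/orP; left; apply/eqP; congr l2norm.
  by apply/funext => x /=; ring.
split.
- by move=> t t0; apply: Lfun2B; [exact: u2|exact: v2].
- move=> t t0 e e0; have e20 : 0 < e / 2 by rewrite divr_gt0.
  have [h1 h10 H1] := uc t t0 _ e20; have [h2 h20 H2] := vc t t0 _ e20.
  exists (Num.min h1 h2); first by rewrite lt_min h10.
  move=> r r0; rewrite lt_min => /andP[rh1 rh2].
  apply: (le_lt_trans (tri _ _ r0 t0)); rewrite [ltRHS](splitr e).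
  by rewrite ltrD ?H1 ?H2.
- move=> c c0; have [K1 H1] := ul c c0; have [K2 H2] := vl c c0.
  exists (K1 + K2) => r t cr ct.
  have r0 : 0 <= r by apply: le_trans cr; exact: ltW.
  have t0 : 0 <= t by apply: le_trans ct; exact: ltW.
  by apply: (le_trans (tri _ _ r0 t0)); rewrite mulrDl lerD ?H1 ?H2.
Qed.

Lemma difference_quotient_Lfun2 u t h : 0 <= t -> 0 <= t + h ->
  (forall r, 0 <= r -> u r \in Lfun mu 2%:E) ->
  (fun x => (u (t + h) x - u t x) / h) \in Lfun mu 2%:E.
Proof.
move=> t0 th0 u2; have := @Lfun_scale _ _ _ mu _ h^-1 2 _ (Lfun2B (u2 _ th0) (u2 _ t0)).
by apply; lra.
Qed.

Lemma L2_derivativeB u v t w w' : 0 < t ->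
  (forall r, 0 <= r -> u r \in Lfun mu 2%:E) ->
  (forall r, 0 <= r -> v r \in Lfun mu 2%:E) ->
  L2_derivative u t w -> L2_derivative v t w' ->
  L2_derivative (fun t x => u t x - v t x) t (fun x => w x - w' x).
Proof.
move=> t0 u2 v2 [w2 uw] [w2' vw]; split; first exact: Lfun2B.
have sum0 : (norm_dist 2 (fun x => (u (t + h) x - u t x) / h)%R w +
    norm_dist 2 (fun x => (v (t + h) x - v t x) / h)%R w')%E @[h --> 0^'] --> 0%E.
  by rewrite -[X in _ --> X](adde0 0%E); apply: cvgeD.
apply: (squeeze_cvge _ (cvg_cst 0%E) sum0).
near=> h; rewrite Lnorm_ge0/=.
have th : 0 <= t + h.
  have : `|h| < t by near: h; apply: dnbhs0_lt.
  by rewrite ltr_norml => /andP[h1 h2]; lra.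
have q2 := difference_quotient_Lfun2 (ltW t0) th u2.
have q2' := difference_quotient_Lfun2 (ltW t0) th v2.
have -> : (fun x => (u (t + h) x - v (t + h) x - (u t x - v t x)) / h) =
    (fun x => (u (t + h) x - u t x) / h - (v (t + h) x - v t x) / h).
  by apply/funext => x; rewrite -mulrBl; congr (_ / _); ring.
rewrite (norm_dist2E q2 w2) (norm_dist2E q2' w2').
rewrite (norm_dist2E (Lfun2B q2 q2') (Lfun2B w2 w2')).
rewrite -EFinD lee_fin -(l2normN mu (fun x => (v (t + h) x - v t x) / h - w' x)).
apply: le_trans (l2norm_tri (Lfun2B q2 w2) (Lfun2N (Lfun2B q2' w2'))).
rewrite le_eqVlt; apply/orP; left; apply/eqP; congr l2norm.
by apply/funext => x /=; ring.
Unshelve. all: by end_near. Qed.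

Lemma norm_distN q f g : norm_dist q (\- f) (\- g) = norm_dist q f g.
Proof.
rewrite /norm_dist -(oppe_Lnorm mu (EFin \o (f \- g))); congr Lnorm.
by apply/funext => x /=; congr EFin; ring.
Qed.

Lemma energyN s p f : energy s p (\- f) = energy s p f.
Proof.
congr (_ * _)%E; apply: eq_integral => z _ /=; congr ((_ `^ _ / _)%:E).
by rewrite -normrN; congr `|_|; ring.
Qed.

Lemma in_subdiffN s p f w : in_subdiff s p f w -> in_subdiff s p (\- f) (\- w).
Proof.
move=> [f2 w2 fin sub]; split; rewrite ?energyN//; [exact: Lfun2N|exact: Lfun2N|].
move=> g g2; have := sub _ (Lfun2N g2); rewrite energyN.
congr (_ + (_)%:E <= _)%E; apply: eq_Rintegral => x _ /=; ring.
Qed.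

Lemma L2_derivativeN u t w : L2_derivative u t w ->
  L2_derivative (fun t => \- u t) t (\- w).
Proof.
move=> [w2 uw]; split; first exact: Lfun2N.
rewrite (_ : (fun h => _) =
    (fun h => norm_dist 2 (fun x => (u (t + h) x - u t x) / h) w))//.
apply/funext => h; rewrite -norm_distN.
by congr norm_dist; apply/funext => x /=; ring.
Qed.

Lemma L2_semigroup_solutionN s p f v : L2_semigroup_solution s p f v ->
  L2_semigroup_solution s p (\- f) (fun t => \- v t).
Proof.
move=> [f2 v2 v0 cont [lip der]]; split.
- exact: Lfun2N.
- by move=> t t0; apply: Lfun2N; exact: v2.
- by move: v0; apply: filterS => x /= ->.
- by move=> t t0; under eq_fun do rewrite norm_distN; exact: cont.
split.
  move=> c c0; have [K hK] := lip c c0; exists K => a b ca cb.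
  by rewrite norm_distN hK.
apply: (@filterS _ _ (ae_filter_ringOfSetsType lam) _ _ _ der) => t ht t0.
have [w [uw sub]] := ht t0; exists (\- w); split; first exact: L2_derivativeN.
exact: in_subdiffN.
Qed.

(** T-contraction, in Huber form: the evolution of the difference of two solutions
    against the barrier [0], the energy inequality being the monotonicity of the
    subdifferential. *)
Lemma L2_T_contraction s p f g v z delta t : 1 < p -> 0 < delta -> 0 <= t ->
  L2_semigroup_solution s p f v -> L2_semigroup_solution s p g z ->
  \int[mu]_x huber (v t x - z t x - delta) <=
  \int[mu]_x huber (f x - g x - delta).
Proof.
move=> p1 d0 t0 solv solz.
have [f2 v2 v0 _ [_ derv]] := solv; have [g2 z2 z0 _ [_ derz]] := solz.
have mhuber (a b : T -> R) : a \in Lfun mu 2%:E -> b \in Lfun mu 2%:E ->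
    measurable_fun setT (fun x => huber (a x - b x - delta)).
  move=> a2 b2; apply: (measurableT_comp measurable_huber).
  apply: measurable_funB => //.
  by apply: measurable_funB; [exact: Lfun_measurable a2|exact: Lfun_measurable b2].
have init : \int[mu]_x huber (v 0 x - z 0 x - delta) =
    \int[mu]_x huber (f x - g x - delta).
  congr fine; apply: ae_eq_integral => //.
  - by apply/measurable_EFinP; apply: mhuber; [exact: v2|exact: z2].
  - by apply/measurable_EFinP; exact: mhuber.
  - by move: v0 z0; apply: filterS2 => x /= -> -> _.
rewrite -init; move: t0; rewrite le_eqVlt => /predU1P[<-//|tp].
have := @huber_excess_nonincreasing R N (fun t x => v t x - z t x)
  (fun _ _ => 0) (fun _ _ => 0) (fun=> 0) (fun=> 0) t delta 0 0 tp d0.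
rewrite /huber_excess => H.
under [leLHS]eq_Rintegral do rewrite -[v t _ - _]subr0.
under [leRHS]eq_Rintegral do rewrite -[v 0 _ - _]subr0.
apply: H => //.
- exact: (L2_curveB (L2_solution_curve solv) (L2_solution_curve solz)).
- by move=> r x _; rewrite lexx.
- by move=> r x _ _ _; rewrite subrr mul0r lexx.
- move=> r r0 rt e e0; exists 1 => // c /andP[_ cr].
  by rewrite subrr oppr0 add0r mulr_ge0 ?(ltW e0)// subr_ge0 ltW.
- by move=> r c x _ _ _; rewrite subrr mul0r.
apply: (@filterS2 _ _ (ae_filter_ringOfSetsType lam) _ _ _ _ derv derz) => r hv hz r0 rt.
have [w [vw subv]] := hv r0; have [w' [zw subz]] := hz r0.
exists (fun x => w x - w' x); split; first exact: L2_derivativeB.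
rewrite [X in _ <= - X](_ : _ = 0) ?oppr0; last first.
  by rewrite /Rintegral integral0_eq// => x _; rewrite !mulr0.
rewrite (_ : \int[mu]_x _ =
    \int[mu]_x ((w x - w' x) * clip01 (v r x - z r x - delta))); last first.
  by apply: eq_Rintegral => x _; rewrite addr0.
by apply: (subdiff_T_monotone p1 d0 subv subz); [case: vw|case: zw].
Qed.

End semigroup_solutions.

(** * The capped singular solution is a supersolution *)

Section singular_barrier.
Context {R : realType} {N : nat}.
Local Notation mu := (leb R N).
Local Notation T := (N.-tuple R).
Local Notation lam := (@lebesgue_measure R).
Implicit Types (t r e c : R) (x : T) (f g : T -> R) (v : R -> T -> R).

Lemma exists_unit_vector : (0 < N)%N -> exists x0 : T, eucl_norm x0 = 1.
Proof.
move=> N0; exists [tuple (i == Ordinal N0)%:R | i < N].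
rewrite eucl_normE /tdot (bigD1 (Ordinal N0))//= big1 => [|i i0].
  by rewrite tnth_mktuple eqxx mulr1 addr0 sqrtr1.
by rewrite tnth_mktuple (negbTE i0) mulr0.
Qed.

(** The singular solution capped at height [M]; the last argument of [barrier] is
    the radius at which the singular solution takes the value [M]. *)
Definition capped_singular (s p C T' M : R) t : T -> R :=
  barrier (C * (T' - t) `^ (2 - p)^-1) (s * p / (2 - p))
    ((C * (T' - t) `^ (2 - p)^-1 / M) `^ (s * p / (2 - p))^-1).

Context (s p C T' : R) (N0 : (0 < N)%N) (hs : 0 < s < 1) (p1 : 1 < p) (p2 : p < 2)
  (hC : is_C_infty N s p C) (T0 : 0 < T').

Let bet := s * p / (2 - p).
Let amp t : R := (T' - t) `^ (2 - p)^-1.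
Let amp' t : R := 'D_1 amp t.

Let C0 : 0 < C. Proof. by case: hC. Qed.
Let s0 : 0 < s. Proof. by case/andP: hs. Qed.
Let p0 : 0 < p. Proof. exact: lt_trans p1. Qed.
Let q0 : 0 < 2 - p. Proof. by rewrite subr_gt0. Qed.
Let bet0 : 0 < bet. Proof. by rewrite !mulr_gt0// invr_gt0. Qed.
Let m1 : 1 < (2 - p)^-1. Proof. by rewrite invf_gt1//; have h := p1; lra. Qed.
Let m0 : 0 < (2 - p)^-1. Proof. exact: lt_trans m1. Qed.

Let amp_gt0 t : t < T' -> 0 < amp t.
Proof. by move=> h; rewrite powR_gt0// subr_gt0. Qed.
Let amp_ge0 t : 0 <= amp t. Proof. exact: powR_ge0. Qed.

Let sing t x : R := singular_solution s p C T' t x.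

Let singE t x : sing t x = C * amp t * eucl_norm x `^ (- bet).
Proof. by []. Qed.

Let amp_derivable t : 0 < t < T' -> derivable amp t 1.
Proof.
move=> tT; have [x0 x01] := exists_unit_vector N0.
have x0n : eucl_norm x0 != 0 by rewrite x01 oner_neq0.
have [l [_ der]] := hC.2 T' T0 t x0 tT x0n.
have -> : amp = C^-1 \*: (fun r => singular_solution s p C T' r x0).
  apply/funext => r; rewrite /= /singular_solution x01 powR1 mulr1 /GRing.scale/=.
  by rewrite mulrA mulVf ?mul1r// gt_eqF.
apply: derivableZ; exact: (@ex_derive _ _ _ _ _ _ _ der).
Qed.

(** The value of the operator at the singular profile, read off from the fact
    that the singular solution solves the equation. *)
Let sing_PV t x : 0 < t < T' -> eucl_norm x != 0 ->
  is_PV s p (sing t) x (- (amp' t * (C * eucl_norm x `^ (- bet)))).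
Proof.
move=> tT xn; have [l [PV der]] := hC.2 T' T0 t x tT xn.
suff -> : - (amp' t * (C * eucl_norm x `^ (- bet))) = l by [].
have e : (fun r => singular_solution s p C T' r x) =
    (C * eucl_norm x `^ (- bet)) \*: amp.
  by apply/funext => r; rewrite /= -/(sing r x) singE /GRing.scale/=; ring.
have := @derive_val _ _ _ _ _ _ _ der; rewrite e deriveZ; last exact: amp_derivable.
rewrite /GRing.scale/= -/(amp' t) => h.
by rewrite -[RHS]opprK -h; congr (- _); ring.
Qed.

Let amp_left_derivative t : 0 < t < T' -> forall e, 0 < e ->
  exists2 h, 0 < h & forall r, t - h < r < t ->
    amp r - amp t <= (- amp' t + e) * (t - r).
Proof.
move=> tT e e0; have := amp_derivable tT; rewrite /derivable => cv.
have /cvgrPdist_lt /(_ _ e0) : h^-1 *: (amp (h *: 1 + t) - amp t) @[h --> 0^'] --> amp' t.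
  exact: cv.
rewrite near_withinE => /nbhs_ballP[h /= h0 sub]; exists h => // r /andP[r1 r2].
have tr : 0 < t - r by rewrite subr_gt0.
have := sub (r - t); rewrite /ball/= sub0r normrN distrC gtr0_norm//.
rewrite ltrBlDr addrC -ltrBlDr => /(_ r1); rewrite subr_eq0 lt_eqF// => /(_ isT).
rewrite /GRing.scale/= mulr1 subrK ltr_norml => /andP[_ h1].
have : (amp r - amp t) / (t - r) <= - amp' t + e.
  rewrite -[t - r]opprB invrN mulrN mulrC lerNl opprD opprK; lra.
by rewrite ler_pdivrMr.
Qed.

(** Convexity of the power [(2 - p)^-1 > 1]. *)
Let amp_lipschitz r t : 0 <= r -> r <= t -> t < T' ->
  0 <= amp r - amp t <= (2 - p)^-1 * T' `^ ((2 - p)^-1 - 1) * (t - r).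
Proof.
move=> r0 rt tT; have Tt : 0 < T' - t by rewrite subr_gt0.
have Tr : 0 < T' - r by lra.
rewrite subr_ge0 /amp ge0_ler_powR ?nnegrE ?(ltW m0) ?(ltW Tt) ?(ltW Tr)//=; last by lra.
have := @normr_powR_tangent _ (2 - p)^-1 (T' - t) (T' - r) m1.
rewrite !gtr0_norm// (_ : T' - t - (T' - r) = - (t - r)); last by ring.
rewrite (Phi_ge0E m1 (ltW Tr)) => h.
have : (2 - p)^-1 * (T' - r) `^ ((2 - p)^-1 - 1) * (t - r) <=
    (2 - p)^-1 * T' `^ ((2 - p)^-1 - 1) * (t - r).
  rewrite ler_wpM2r ?subr_ge0// ler_wpM2l ?(ltW m0)//.
  by have h' := m1; rewrite ge0_ler_powR ?nnegrE ?(ltW Tr) ?(ltW T0)//; lra.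
lra.
Qed.

Context (M : R) (M0 : 0 < M).

Let rad t : R := (C * amp t / M) `^ bet^-1.
Let V t : T -> R := capped_singular s p C T' M t.
Let B t x : R := if rad t <= eucl_norm x then C * eucl_norm x `^ (- bet) else 0.

Let rad_gt0 t : t < T' -> 0 < rad t.
Proof. by move=> tT; rewrite powR_gt0// divr_gt0// mulr_gt0// amp_gt0. Qed.

Let radE t : t < T' -> C * amp t * rad t `^ (- bet) = M.
Proof.
move=> tT; have c0 : 0 < C * amp t by rewrite mulr_gt0// amp_gt0.
rewrite powRN /rad -powRrM mulVf ?gt_eqF// powRr1 ?divr_ge0 ?(ltW c0) ?(ltW M0)//.
by rewrite invfM invrK mulrA mulfV ?mul1r// gt_eqF.
Qed.

Let Camp_ge0 t : 0 <= C * amp t. Proof. by rewrite mulr_ge0 ?(ltW C0). Qed.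

Let V_le_M t x : t < T' -> V t x <= M.
Proof.
move=> tT; rewrite -[leRHS](radE tT).
exact: barrier_le (Camp_ge0 t) (ltW bet0) (rad_gt0 tT).
Qed.

(** Where the barrier is not capped it is linear in [amp]; on the plateau it is
    constant, and at its maximum. *)
Let V_concave r t x : 0 <= r -> r <= t -> t < T' ->
  V r x - V t x <= (amp r - amp t) * B t x.
Proof.
move=> r0 rt tT; rewrite /B; case: ifPn => [h|].
  have xn : eucl_norm x != 0 by rewrite gt_eqF// (lt_le_trans (rad_gt0 tT)).
  rewrite [V t x](barrier_far (C * amp t) bet)// mulrBl.
  have h1 : V r x <= C * amp r * eucl_norm x `^ (- bet).
    exact: barrier_le_powR (Camp_ge0 r) (ltW bet0) xn.
  move: h1; move: (V r x) (amp r) (amp t) (eucl_norm x `^ (- bet)) => y1 y2 y3 y4; lra.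
rewrite -ltNge => h; rewrite mulr0 subr_le0 [V t x](barrier_near (C * amp t) bet (ltW h)) radE//.
by apply: V_le_M; lra.
Qed.

Let B_ge0 t x : 0 <= B t x.
Proof. by rewrite /B; case: ifP => // _; rewrite mulr_ge0 ?(ltW C0)// powR_ge0. Qed.

Let B_le t x : t < T' -> amp t * B t x <= M.
Proof.
move=> tT; rewrite /B; case: ifPn => [h|_]; last by rewrite mulr0 ltW.
rewrite mulrCA mulrA -(radE tT) ler_wpM2l// ler_powRN ?(ltW bet0)//.
exact: rad_gt0.
Qed.

Let measurable_B t : measurable_fun setT (B t).
Proof.
have mn : measurable_fun setT (@eucl_norm R N) by exact: measurable_eucl_norm.
apply: measurable_fun_ifT => //; first exact: measurable_fun_ler.
apply: measurable_funM => //.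
exact: (measurableT_comp (measurable_powR _)).
Qed.

Let measurable_sing t : measurable_fun setT (sing t).
Proof.
have mn : measurable_fun setT (@eucl_norm R N) by exact: measurable_eucl_norm.
apply: measurable_funM => //.
exact: (measurableT_comp (measurable_powR _)).
Qed.

(** Outside the plateau the barrier touches the singular profile from below.  It is
    first changed into [W] at the origin, the one point where [0 `^ (- bet) = 0]
    puts the singular profile below the barrier. *)
Let truncated_V_ge t e x : 0 < t < T' -> 0 < e -> rad t <= eucl_norm x ->
  truncated_pL s p (sing t) e x <= truncated_pL s p (V t) e x.
Proof.
move=> tT e0 rx; have /andP[t0 tT'] := tT.
have xn : eucl_norm x != 0 by rewrite gt_eqF// (lt_le_trans (rad_gt0 tT')).
pose W y := if eucl_norm y == 0 then 0 else V t y.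
have mW : measurable_fun setT W.
  apply: measurable_fun_ifT => //; last exact: measurable_barrier.
  by apply: measurable_fun_eqr => //; exact: measurable_eucl_norm.
have -> : truncated_pL s p (V t) e x = truncated_pL s p W e x.
  apply: eq_truncated_pL => //.
  - by apply: filterS (ae_eucl_norm_neq0 N0) => y yn; rewrite /W (negbTE yn).
  - by rewrite /W (negbTE xn).
  - exact: measurable_barrier.
have W0 y : 0 <= W y by rewrite /W; case: ifP => // _; exact: barrier_ge0 (Camp_ge0 t).
have WM y : W y <= M.
  by rewrite /W; case: ifP => // _; [exact: ltW|exact: V_le_M].
apply: truncated_pL_le => //.
- exact: (sing_PV tT xn).1.
- apply: (@integrable_bounded_kernel _ _ _ _ _ M) => // y.
  rewrite ler_norml lerBrDr lerBlDr; apply/andP; split.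
    by apply: le_trans (W0 x); rewrite addrC subr_le0.
  exact: ler_wpDr (W0 y) (WM x).
- by rewrite /W (negbTE xn) [V t x](barrier_far (C * amp t) bet rx).
- move=> y; rewrite /W; case: ifPn => [|yn].
    by rewrite singE mulr_ge0// powR_ge0.
  exact: barrier_le_powR (Camp_ge0 t) (ltW bet0) yn.
Qed.

Let sing_similarity t l m y : 0 < l ->
  sing t (similarity l m y) = l `^ (- bet) * sing t y.
Proof.
move=> l0; rewrite !singE eucl_norm_similarity ?(ltW l0)//.
by rewrite powRM ?(ltW l0) ?eucl_norm_ge0//; ring.
Qed.

(** The lower bound [low] for the operator is minus the time derivative of the
    barrier: outside the plateau by comparison with the singular solution, and on
    the plateau because the barrier is maximal there. *)
Let barrier_supersolution_test (delta t : R) (u w : T -> R) : 0 < delta -> 0 < t < T' ->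
  w \in Lfun mu 2%:E -> in_subdiff s p u (\- w) ->
  \int[mu]_x (w x * clip01 (u x - V t x - delta)) <=
  - \int[mu]_x (clip01 (u x - V t x - delta) * (- amp' t * B t x)).
Proof.
move=> d0 tT w2 sub; have /andP[t0 tT'] := tT.
have [x0 x01] := exists_unit_vector N0.
have x0n : eucl_norm x0 != 0 by rewrite x01 oner_neq0.
have g0 : 0 <= bet * (p - 1) + s * p.
  by rewrite addr_ge0// mulr_ge0 ?(ltW bet0) ?(ltW s0) ?(ltW p0)//; have h := p1; lra.
have [K hK] := homogeneous_truncated_pL_bounded p1 (rad_gt0 tT') g0
  (measurable_sing t) (@sing_similarity t) x01 (sing_PV tT x0n).
pose low x := - amp' t * B t x.
have Bbound x : B t x <= M / amp t.
  by rewrite ler_pdivlMr ?amp_gt0// mulrC B_le.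
pose K' := Num.max K (`|amp' t| * (M / amp t)).
have K'0 : 0 <= K'.
  by rewrite le_max mulr_ge0 ?orbT// divr_ge0 ?(ltW M0).
have := @barrier_energy_inequality R N s p hs p1 u (V t) w delta
  (C * amp t * rad t `^ (- bet) * (1 + bet) / rad t) M d0 _
  (measurable_barrier _ _ _) (fun x => barrier_ge0 _ _ _ (Camp_ge0 t))
  (fun x => V_le_M x tT') (barrier_lipschitz (Camp_ge0 t) bet0 (rad_gt0 tT'))
  sub low K'.
case.
- rewrite !mulr_ge0 ?invr_ge0 ?powR_ge0 ?(ltW C0) ?(ltW (rad_gt0 tT'))//.
  by rewrite addr_ge0// ltW.
- by apply: measurable_funM => //; exact: measurable_B.
- move=> x; rewrite /low normrM normrN le_max ler_wpM2l ?orbT//.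
  by rewrite ger0_norm ?B_ge0.
- move=> e x e0; have [rx|rx] := leP (rad t) (eucl_norm x).
    apply: le_trans (truncated_V_ge tT e0 rx).
    have := hK e x e0 rx; rewrite ler_norml => /andP[h _].
    by apply: le_trans h; rewrite lerN2 le_max lexx.
  apply: (@le_trans _ _ 0); first by rewrite oppr_le0.
  by apply: truncated_pL_ge0 => y; rewrite [V t x](barrier_near (C * amp t) bet (ltW rx)) radE// V_le_M.
- move=> x eta eta0; rewrite /low /B; case: ifPn => [rx|].
    have xn : eucl_norm x != 0 by rewrite gt_eqF// (lt_le_trans (rad_gt0 tT')).
    have [_ /cvgrPdist_lt /(_ _ eta0)] := sing_PV tT xn.
    rewrite near_withinE => -[h /= h0 hh]; near=> n.
    have n0 : 0 < n.+1%:R^-1 :> R by rewrite invr_gt0.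
    apply: le_trans (truncated_V_ge tT n0 rx).
    have := hh n.+1%:R^-1; rewrite /ball/= sub0r normrN gtr0_norm// => /(_ _ n0).
    rewrite -/(truncated_pL s p (sing t) n.+1%:R^-1 x) ltr_norml => H.
    have /H/andP[_ h2] : n.+1%:R^-1 < h.
      by near: n; exact: near_infty_natSinv_lt (PosNum h0).
    by rewrite mulNr; lra.
  rewrite -ltNge => rx; near=> n; rewrite mulr0 sub0r.
  apply: (@le_trans _ _ 0); first by rewrite oppr_le0 ltW.
  by apply: truncated_pL_ge0 => y; rewrite [V t x](barrier_near (C * amp t) bet (ltW rx)) radE// V_le_M.
by [].
Unshelve. all: by end_near. Qed.

(** The evolution of the Huber excess, for the amplitude
    [(T' - t) `^ (2 - p)^-1] of the singular solution. *)
Lemma barrier_comparison delta b f v : 0 < delta -> 0 <= b -> b < T' ->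
  L2_semigroup_solution s p f v ->
  \int[mu]_x huber (v b x - capped_singular s p C T' M b x - delta) <=
  \int[mu]_x huber (f x - capped_singular s p C T' M 0 x - delta).
Proof.
move=> d0 b0 bT sol; have [f2 v2 v0 _ [_ der]] := sol.
rewrite -/(V b) -/(V 0).
have mhuber (a : T -> R) t : a \in Lfun mu 2%:E ->
    measurable_fun setT (fun x => huber (a x - V t x - delta)).
  move=> a2; apply: (measurableT_comp measurable_huber).
  apply: measurable_funB => //; apply: measurable_funB.
    exact: Lfun_measurable a2.
  exact: measurable_barrier.
apply: (@le_trans _ _ (\int[mu]_x huber (v 0 x - V 0 x - delta))); last first.
  rewrite le_eqVlt; apply/orP; left; apply/eqP.
  congr fine; apply: ae_eq_integral => //.
  - by apply/measurable_EFinP; apply: mhuber; exact: v2.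
  - by apply/measurable_EFinP; exact: mhuber.
  - by move: v0; apply: filterS => x /= ->.
move: b0; rewrite le_eqVlt => /predU1P[<-|bp]; first exact: lexx.
apply: (@huber_excess_nonincreasing R N v V B amp amp' b delta
  ((2 - p)^-1 * T' `^ ((2 - p)^-1 - 1)) (M / amp b)) => //.
- exact: L2_solution_curve sol.
- by move=> t; exact: measurable_barrier.
- by move=> t x; exact: barrier_ge0 (Camp_ge0 t).
- move=> t x /andP[t0 tb]; rewrite B_ge0/= ler_pdivlMr ?amp_gt0//.
  apply: le_trans (B_le x (le_lt_trans tb bT)).
  rewrite mulrC ler_wpM2r ?B_ge0//.
  by have := amp_lipschitz t0 tb bT; rewrite subr_ge0 => /andP[].
- by move=> r t r0 rt tb; exact: amp_lipschitz (le_lt_trans tb bT).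
- by move=> t t0 tb e e0; apply: amp_left_derivative => //; rewrite t0 (le_lt_trans tb).
- by move=> r t x r0 rt tb; exact: V_concave (le_lt_trans tb bT).
apply: (@filterS _ _ (ae_filter_ringOfSetsType lam) _ _ _ der) => t ht t0 tb.
have [w [vw sub]] := ht t0; exists w; split => //.
by apply: barrier_supersolution_test => //; [rewrite t0 (le_lt_trans tb)|case: vw].
Qed.

Lemma capped_singularE t x : t < T' -> eucl_norm x != 0 ->
  capped_singular s p C T' M t x = Num.min (singular_solution s p C T' t x) M.
Proof.
by move=> tT xn; rewrite [LHS](barrier_minE (Camp_ge0 t) (ltW bet0) (rad_gt0 tT) (radE tT) xn).
Qed.

End singular_barrier.

(** * Comparison in measure *)

Section weak_estimates.
Context {R : realType} {N : nat}.
Local Notation mu := (leb R N).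
Local Notation T := (N.-tuple R).
Implicit Types (s p q t e C delta eta : R) (x : T) (f g a b : T -> R) (v z : R -> T -> R).

Lemma ae_le_measure (A B : set T) : measurable A -> measurable B ->
  {ae mu, forall x, A x -> B x} -> (mu A <= mu B)%E.
Proof.
move=> mA mB [Z [mZ Z0 sub]].
apply: (@le_trans _ _ (mu (B `|` Z))).
  apply: le_measure; rewrite ?inE//; first exact: measurableU.
  move=> x Ax; have [Bx|nBx] := pselect (B x); first by left.
  by right; apply: sub => /= h; exact/nBx/h.
by apply: (le_trans (measureU2 _ mB mZ)); rewrite [X in (_ + X)%E]Z0 adde0.
Qed.

Lemma measurable_ltr_set f g : measurable_fun setT f -> measurable_fun setT g ->
  measurable [set x | f x < g x].
Proof.
move=> mf mg; rewrite (_ : [set x | _] = (fun x => g x - f x) @^-1` `]0, +oo[%classic).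
  by apply: measurable_preimage_fun => //; exact: measurable_funB.
by apply/seteqP; split => x /=; rewrite in_itv/= andbT subr_gt0.
Qed.

Lemma measurable_ler_set f g : measurable_fun setT f -> measurable_fun setT g ->
  measurable [set x | f x <= g x].
Proof.
move=> mf mg; rewrite (_ : [set x | _] = (fun x => g x - f x) @^-1` `[0, +oo[%classic).
  by apply: measurable_preimage_fun => //; exact: measurable_funB.
by apply/seteqP; split => x /=; rewrite in_itv/= andbT subr_ge0.
Qed.

Lemma huber_markov delta f a (I : \bar R) : 0 < delta ->
  f \in Lfun mu 2%:E -> measurable_fun setT a -> (forall x, 0 <= a x) ->
  ((\int[mu]_x huber (f x - a x - delta))%:E <= I)%E ->
  ((huber delta)%:E * mu [set x | (a x + 2 * delta < f x)%R] <= I)%E.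
Proof.
move=> d0 f2 ma a0; have mf := Lfun_measurable f2.
have ad0 x : 0 <= a x + delta by rewrite addr_ge0// ltW.
have mad : measurable_fun setT (fun x => a x + delta) by exact: measurable_funD.
have int := huber_sub_integrable f2 mad ad0.
have e x : f x - (a x + delta) = f x - a x - delta by rewrite opprD addrA.
have mh : measurable_fun setT (fun x => huber (f x - (a x + delta))).
  by apply: (measurableT_comp measurable_huber); exact: measurable_funB.
under eq_Rintegral do rewrite -e.
rewrite /Rintegral fineK; last exact: integrable_fin_num.
move=> hI; apply: le_trans hI.
apply: le_trans (markov_ge mu (huber_ge0 delta) mh (fun x => huber_ge0 _)).
rewrite lee_wpmul2l ?lee_fin ?huber_ge0//; apply: le_measure; rewrite ?inE.
- by apply: measurable_ltr_set => //; exact: measurable_funD.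
- by apply: measurable_ler_set => //; exact: measurable_cst.
- by move=> x /= h; apply: huber_homo; lra.
Qed.

Lemma lee_natSinv (X I : \bar R) (c : R) : 0 <= c ->
  (forall k : nat, (X <= I + (c / k.+1%:R)%:E)%E) -> (X <= I)%E.
Proof.
move=> c0 h; apply/lee_addgt0Pr => e e0.
have [k ck] : exists k : nat, c / k.+1%:R <= e.
  exists (Num.truncn (c / e)); rewrite ler_pdivrMr// mulrC -ler_pdivrMr//.
  by apply/ltW/truncnS_gt.
by apply: (le_trans (h k)); rewrite leeD2l// lee_fin.
Qed.

(** The right-hand side depends only on the L^1 size of the excess beyond [delta],
    which convergence in any L^q controls. *)
Lemma L2_T_contraction_weak s p f g v z delta t : 1 < p -> 0 < delta -> 0 <= t ->
  L2_semigroup_solution s p f v -> L2_semigroup_solution s p g z ->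
  ((huber delta)%:E * mu [set x | (2 * delta < v t x - z t x)%R] <=
   \int[mu]_x (Num.max (f x - g x - delta) 0)%:E)%E.
Proof.
move=> p1 d0 t0 solv solz; have [f2 v2 _ _ _] := solv; have [g2 z2 _ _ _] := solz.
have fg2 := Lfun2B f2 g2.
have := @huber_markov delta (fun x => v t x - z t x) (fun=> 0)
  (\int[mu]_x (Num.max (f x - g x - delta) 0)%:E)%E d0 (Lfun2B (v2 _ t0) (z2 _ t0)).
move=> H; rewrite (_ : [set x | _] = [set x | (0 + 2 * delta < v t x - z t x)%R]); last first.
  by apply/seteqP; split => x /=; rewrite add0r.
apply: H => //.
under eq_Rintegral do rewrite subr0.
apply: (@le_trans _ _ (\int[mu]_x huber (f x - g x - delta))%:E).
  by rewrite lee_fin; exact: L2_T_contraction solv solz.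
have int := huber_sub_integrable fg2 (measurable_cst delta) (fun=> ltW d0).
rewrite /Rintegral fineK; last exact: integrable_fin_num.
apply: ge0_le_integral => //.
- by move=> x _; rewrite lee_fin huber_ge0.
- exact: measurable_int int.
- apply/measurable_EFinP; apply: measurable_maxr => //.
  by apply: measurable_funB => //; exact: Lfun_measurable fg2.
- move=> x _; rewrite lee_fin.
  have [h|h] := leP (f x - g x - delta) 0; first by rewrite huber_le0.
  by apply: (le_trans (huber_le_normr _)); rewrite gtr0_norm.
Qed.

(** The initial excess over the barrier capped at [M] exceeds that over the
    singular solution by at most [|f|_2^2 / M]; [M] tends to infinity. *)
Lemma singular_comparison_weak s p C (T' : R) delta t f g v : (0 < N)%N ->
  0 < s < 1 -> 1 < p -> p < 2 -> is_C_infty N s p C -> 0 < delta ->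
  0 <= t -> t < T' -> L2_semigroup_solution s p f v -> measurable_fun setT g ->
  {ae mu, forall x, f x <= singular_solution s p C T' 0 x + g x} ->
  ((huber delta)%:E * mu [set x |
      (singular_solution s p C T' t x + 2 * delta < v t x)%R] <=
   \int[mu]_x (Num.max (g x - delta) 0)%:E)%E.
Proof.
move=> N0 hs p1 p2 hC d0 t0 tT sol mg fg; have [f2 v2 _ _ _] := sol.
have T0 : 0 < T' by exact: le_lt_trans tT.
have C0 : 0 < C by case: hC.
have mf := Lfun_measurable f2.
have mn : measurable_fun setT (@eucl_norm R N) by exact: measurable_eucl_norm.
have msing r : measurable_fun setT (singular_solution s p C T' r : T -> R).
  apply: measurable_funM => //.
  exact: (measurableT_comp (measurable_powR _)).
have f22 : mu.-integrable setT (fun x => (f x ^+ 2)%:E) by case/Lfun2P: f2.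
have mgd : measurable_fun setT (fun x => Num.max (g x - delta) 0).
  by apply: measurable_maxr => //; exact: measurable_funB.
apply: (@lee_natSinv _ _ (\int[mu]_x (f x ^+ 2))).
  by apply: Rintegral_ge0 => x _; exact: sqr_ge0.
move=> k; pose M : R := k.+1%:R; have M0 : 0 < M by [].
pose V r : T -> R := capped_singular s p C T' M r.
have mV r : measurable_fun setT (V r) by exact: measurable_barrier.
have V0 r x : 0 <= V r x.
  by apply: barrier_ge0; rewrite mulr_ge0 ?powR_ge0// ltW.
have VE r : r < T' -> {ae mu, forall x,
    V r x = Num.min (singular_solution s p C T' r x) M}.
  move=> rT; apply: filterS (ae_eucl_norm_neq0 N0) => x xn.
  exact: capped_singularE.
apply: (@le_trans _ _ ((huber delta)%:E * mu [set x | (V t x + 2 * delta < v t x)%R])%E).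
  rewrite lee_wpmul2l ?lee_fin ?huber_ge0//; apply: ae_le_measure.
  - apply: measurable_ltr_set; last exact: Lfun_measurable (v2 _ t0).
    by apply: measurable_funD => //; exact: msing.
  - apply: measurable_ltr_set; last exact: Lfun_measurable (v2 _ t0).
    exact: measurable_funD.
  - apply: filterS (VE t tT) => x Vx /=; rewrite Vx; apply: le_lt_trans.
    by rewrite lerD2r ge_min lexx.
apply: huber_markov => //; first exact: v2.
have cmp := barrier_comparison N0 hs p1 p2 hC T0 M0 d0 t0 tT sol.
apply: (@le_trans _ _ (\int[mu]_x huber (f x - V 0 x - delta))%:E).
  by rewrite lee_fin; exact: cmp.
have Vd0 x : 0 <= V 0 x + delta by rewrite addr_ge0// ltW.
have mVd : measurable_fun setT (fun x => V 0 x + delta) by exact: measurable_funD.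
have int := huber_sub_integrable f2 mVd Vd0.
have e x : f x - (V 0 x + delta) = f x - V 0 x - delta by rewrite opprD addrA.
under eq_Rintegral do rewrite -e.
rewrite /Rintegral fineK; last exact: integrable_fin_num.
have -> : (fine (\int[mu]_x (f x ^+ 2)%:E) / k.+1%:R)%:E =
    (\int[mu]_x (M^-1 * f x ^+ 2)%:E)%E.
  under [RHS]eq_integral do rewrite EFinM.
  rewrite integralZl// mulrC EFinM fineK//.
  exact: integrable_fin_num.
rewrite -ge0_integralD//; last 4 first.
- by move=> x _; rewrite lee_fin le_max lexx orbT.
- exact/measurable_EFinP.
- by move=> x _; rewrite lee_fin mulr_ge0 ?invr_ge0 ?(ltW M0)// sqr_ge0.
- by apply/measurable_EFinP; apply: measurable_funM => //; exact: measurable_funX.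
apply: ae_ge0_le_integral => //.
- by move=> x _; rewrite lee_fin huber_ge0.
- exact: measurable_int int.
- move=> x _; rewrite -EFinD lee_fin addr_ge0 ?le_max ?lexx ?orbT//.
  by rewrite mulr_ge0 ?invr_ge0 ?(ltW M0)// sqr_ge0.
- under eq_fun do rewrite -EFinD; apply/measurable_EFinP; apply: measurable_funD => //.
  by apply: measurable_funM => //; exact: measurable_funX.
move: (VE 0 T0) fg; apply: filterS2 => x Vx fx _.
rewrite e -EFinD lee_fin {}Vx.
have sq0 : 0 <= M^-1 * f x ^+ 2.
  by rewrite mulr_ge0 ?invr_ge0 ?(ltW M0)// sqr_ge0.
have m0 : 0 <= Num.max (g x - delta) 0 by rewrite le_max lexx orbT.
have gm : g x - delta <= Num.max (g x - delta) 0 by rewrite le_max lexx.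
move: (singular_solution s p C T' 0 x) (Num.max _ _) fx m0 gm => y m fx m0 gm.
have [zn|zp] := leP (f x - Num.min y M - delta) 0.
  by rewrite huber_le0// addr_ge0.
apply: (le_trans (huber_le_normr _)); rewrite gtr0_norm//.
move: zp; have [h|h] := leP y M => zp.
  by rewrite ler_wpDr// (le_trans _ gm)// lerB// lerBlDl.
rewrite ler_wpDl//; apply: (@le_trans _ _ (f x)).
  by rewrite -addrA -opprD gerBl addr_ge0// ltW.
have fM : M <= f x.
  move: zp; rewrite -addrA -opprD subr_gt0 => zp.
  by apply/ltW/le_lt_trans/zp; rewrite lerDl ltW.
by rewrite ler_pdivlMl// expr2 ler_wpM2r// (le_trans _ fM)// ltW.
Qed.

(** Both bounds compare with the integral of [|a - b| ^ q]: above the height [delta]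
    the functions [1] and [|a - b|] are at most multiples of [|a - b| ^ q].  This
    threshold is what makes all exponents [q >= 1] equivalent below. *)
Lemma lq_modulus q delta eta : 1 <= q -> 0 < delta -> 0 < eta ->
  exists2 rho, 0 < rho & forall a b,
    measurable_fun setT a -> measurable_fun setT b ->
    (norm_dist q a b <= rho%:E)%E ->
    (mu [set x | (delta <= `|a x - b x|)%R] <= eta%:E)%E /\
    (\int[mu]_x (Num.max (`|a x - b x| - delta) 0)%:E <= eta%:E)%E.
Proof.
move=> q1 d0 eta0; have q0 : 0 < q by lra.
pose c := Num.min (delta `^ q) (delta `^ (q - 1)).
have c0 : 0 < c by rewrite lt_min !powR_gt0.
have ec0 : 0 < eta * c by rewrite mulr_gt0.
exists ((eta * c) `^ q^-1); first by rewrite powR_gt0.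
move=> a b ma mb ab.
have mab : measurable_fun setT (fun x => `|a x - b x|).
  by apply: (measurableT_comp (@normr_measurable _ setT)); exact: measurable_funB.
have mabq : measurable_fun setT (fun x => `|a x - b x| `^ q).
  exact: (measurableT_comp (measurable_powR _)).
have Iq : (\int[mu]_x (`|a x - b x| `^ q)%:E <= (eta * c)%:E)%E.
  have := @powR_Lnorm _ _ _ mu (EFin \o (a \- b)) q; rewrite gt_eqF// => /(_ isT) e.
  rewrite (_ : (\int[mu]_x _)%E = (\int[mu]_x (`|(EFin \o (a \- b)%R) x| `^ q))%E)//.
  rewrite -e; apply: (@le_trans _ _ (((eta * c) `^ q^-1)%:E `^ q)%E).
    by apply: gt0_ler_poweR => //; [exact: ltW|rewrite in_itv/= leey Lnorm_ge0|
      rewrite in_itv/= leey lee_fin powR_ge0].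
  by rewrite poweR_EFin -powRrM mulVf ?gt_eqF// powRr1// ltW.
split.
  have := @markov_ge _ _ _ mu (delta `^ q) (fun x => `|a x - b x| `^ q)
    (powR_ge0 _ _) mabq (fun x => powR_ge0 _ _).
  move=> /le_trans/(_ Iq) h.
  have {}h : ((delta `^ q)%:E * mu [set x | (delta <= `|a x - b x|)%R] <= (eta * c)%:E)%E.
    apply: le_trans h; rewrite lee_wpmul2l ?lee_fin ?powR_ge0//.
    apply: le_measure; rewrite ?inE.
    - by apply: measurable_ler_set => //; exact: measurable_cst.
    - by apply: measurable_ler_set => //; exact: measurable_cst.
    - move=> x /= h; rewrite ge0_ler_powR ?nnegrE ?(ltW d0) ?(ltW q0)//.
  rewrite -(@lee_pmul2l _ (delta `^ q)%:E) ?lte_fin ?powR_gt0//.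
  apply: (le_trans h); rewrite -EFinM lee_fin mulrC ler_wpM2r ?(ltW eta0)//.
  by rewrite ge_min lexx.
have dq : 0 < delta `^ (q - 1) by rewrite powR_gt0.
apply: (@le_trans _ _ (\int[mu]_x ((delta `^ (q - 1))^-1%:E * (`|a x - b x| `^ q)%:E))%E).
  apply: ge0_le_integral => //.
  - by move=> x _; rewrite lee_fin le_max lexx orbT.
  - by apply/measurable_EFinP; apply: measurable_maxr => //; exact: measurable_funB.
  - under eq_fun do rewrite -EFinM; apply/measurable_EFinP.
    exact: measurable_funM.
  - move=> x _; rewrite -EFinM lee_fin ge_max mulr_ge0 ?invr_ge0 ?powR_ge0// andbT.
    have [h|h] := leP `|a x - b x| delta.
      by apply: (@le_trans _ _ 0); [lra|rewrite mulr_ge0 ?invr_ge0 ?powR_ge0].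
    apply: (@le_trans _ _ `|a x - b x|); first by lra.
    rewrite ler_pdivlMl// -(mulr_powRB1 (normr_ge0 _) q0) mulrC ler_wpM2l//.
    by rewrite ge0_ler_powR ?nnegrE ?(ltW d0) ?(ltW h)//; lra.
rewrite ge0_integralZl_EFin//; last 2 first.
- exact/measurable_EFinP.
- by rewrite invr_ge0 ltW.
rewrite -(@lee_pmul2l _ (delta `^ (q - 1))%:E) ?lte_fin//.
rewrite muleA -EFinM mulfV ?gt_eqF// mul1e; apply: (le_trans Iq).
rewrite -EFinM lee_fin mulrC ler_wpM2r ?(ltW eta0)//.
by rewrite ge_min lexx orbT.
Qed.

End weak_estimates.

(** * Comparison with singular solutions in L^q *)

Section extinction.
Context {R : realType} {N : nat}.
Local Notation mu := (leb R N).
Local Notation T := (N.-tuple R).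
Implicit Types (s p q t e A C delta eta : R) (x : T) (f g h w : T -> R)
  (v z : R -> T -> R).

Lemma ae_notin_null (S : set T) : measurable S -> mu S = 0%E ->
  {ae mu, forall x, ~ S x}.
Proof. by move=> mS S0; exists S; split => // x /= /contrapT. Qed.

Lemma lee0_small (X : \bar R) (c : R) : 0 < c ->
  (forall eta, 0 < eta -> (X <= (c * eta)%:E)%E) -> (X <= 0)%E.
Proof.
move=> c0 h; apply/lee_addgt0Pr => e e0; rewrite add0e.
by have := h (e / c); rewrite divr_gt0// mulrCA mulfV ?gt_eqF// mulr1; exact.
Qed.

Lemma le0_natSinv (y c : R) : 0 <= c -> (forall k : nat, y <= c / k.+1%:R) -> y <= 0.
Proof.
move=> c0 h; rewrite -lee_fin; apply: (lee_natSinv c0) => k.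
by rewrite add0e lee_fin.
Qed.

Lemma measure_le_fineM (X : \bar R) (c eta : R) : 0 < c ->
  (c%:E * X <= (c * eta)%:E)%E -> (X <= eta%:E)%E.
Proof. by move=> c0; rewrite EFinM lee_pmul2l ?lte_fin. Qed.

Lemma norm_dist_lt q (a : nat -> T -> R) (b : T -> R) rho : 0 < rho ->
  norm_dist q (a n) b @[n --> \oo] --> 0%E ->
  \forall n \near \oo, (norm_dist q (a n) b <= rho%:E)%E.
Proof.
move=> r0 /fine_cvgP[fin /cvgrPdist_lt /(_ _ r0)].
apply: filterS2 fin => n fin; rewrite sub0r normrN => h.
by rewrite -(fineK fin) lee_fin ltW// (le_lt_trans _ h)// ler_norm.
Qed.

(** The datum is below the singular solution that vanishes at time [t + 1 / j], for
    every positive [j], as [A <= C * t `^ (2 - p)^-1].  At time [t] this solution is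
    [C * j `^ (- (2 - p)^-1)] times a fixed function of the point, hence
    tends to [0] as [j] grows. *)
Lemma Lq_limit_nonpositive s p C A q t (f : nat -> T -> R)
    (v : nat -> R -> T -> R) h w : (0 < N)%N -> 0 < s < 1 -> 1 < p -> p < 2 ->
  is_C_infty N s p C -> 0 < A -> 1 <= q -> (A / C) `^ (2 - p) <= t ->
  measurable_fun setT h -> measurable_fun setT w ->
  (forall n, L2_semigroup_solution s p (f n) (v n)) ->
  norm_dist q (f n) h @[n --> \oo] --> 0%E ->
  norm_dist q (v n t) w @[n --> \oo] --> 0%E ->
  {ae mu, forall x, h x <= A * eucl_norm x `^ (- (s * p / (2 - p)))} ->
  {ae mu, forall x, w x <= 0}.
Proof.
move=> N0 hs p1 p2 hC A0 q1 At mh mw sol fh vw hA.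
have C0 : 0 < C by case: hC.
have q0 : 0 < 2 - p by lra.
have t0 : 0 <= t by exact: le_trans (powR_ge0 _ _) At.
pose m := (2 - p)^-1; have m1 : 1 <= m by rewrite invf_ge1//; lra.
pose T' (j : nat) : R := t + j.+1%:R^-1.
have tT j : t < T' j by rewrite ltrDl invr_gt0.
(* Beyond height 3, either [v n t] exceeds the singular solution by 2 or it is at
   distance 1 from [w], in units of [delta]. *)
pose S (j k : nat) : set T := [set x |
  singular_solution s p C (T' j) t x + 3 * k.+1%:R^-1 < w x].
have mn : measurable_fun setT (@eucl_norm R N) by exact: measurable_eucl_norm.
have msing j : measurable_fun setT (singular_solution s p C (T' j) t : T -> R).
  apply: measurable_funM => //.
  exact: (measurableT_comp (measurable_powR _)).
have mS j k : measurable (S j k).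
  by apply: measurable_ltr_set => //; exact: measurable_funD.
have S0 j k : mu (S j k) = 0%E.
  apply/eqP; rewrite -measure_le0; apply: (@lee0_small _ 2) => // eta eta0.
  pose delta : R := k.+1%:R^-1; have d0 : 0 < delta by rewrite invr_gt0.
  have hd0 : 0 < huber delta by exact: huber_gt0.
  have e1 : 0 < Num.min eta (huber delta * eta) by rewrite lt_min eta0 mulr_gt0.
  have [rho rho0 mod_rho] := @lq_modulus R N q delta _ q1 d0 e1.
  near \oo => n.
  have [f2 v2 _ _ _] := sol n.
  have mf := Lfun_measurable f2; have mv := Lfun_measurable (v2 _ t0).
  have fhn : (norm_dist q (f n) h <= rho%:E)%E by near: n; exact: norm_dist_lt.
  have vwn : (norm_dist q (v n t) w <= rho%:E)%E by near: n; exact: norm_dist_lt.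
  have [_ fI] := mod_rho (f n) h mf mh fhn.
  have [vM _] := mod_rho (v n t) w mv mw vwn.
  pose g x := `|f n x - h x|.
  have mg : measurable_fun setT g.
    by apply: (measurableT_comp (@normr_measurable _ setT)); exact: measurable_funB.
  pose S1 := [set x | singular_solution s p C (T' j) t x + 2 * delta < v n t x].
  pose S2 := [set x | delta <= `|v n t x - w x|].
  have mS1 : measurable S1.
    by apply: measurable_ltr_set => //; exact: measurable_funD.
  have mS2 : measurable S2.
    apply: measurable_ler_set; first exact: measurable_cst.
    by apply: (measurableT_comp (@normr_measurable _ setT)); exact: measurable_funB.
  have S1le : (mu S1 <= eta%:E)%E.
    apply: (measure_le_fineM hd0).
    apply: le_trans (singular_comparison_weak N0 hs p1 p2 hC d0 t0 (tT j) (sol n) mg _) _.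
      apply: filterS hA => x hx.
      apply: (@le_trans _ _ (h x + g x)).
        by rewrite -lerBlDl; exact: ler_norm.
      rewrite lerD2r (le_trans hx)// /singular_solution subr0.
      rewrite ler_wpM2r ?powR_ge0// mulrC -ler_pdivrMr//.
      have AC : A / C = ((A / C) `^ (2 - p)) `^ m.
        by rewrite -powRrM mulfV ?gt_eqF// powRr1// divr_ge0// ltW.
      rewrite AC ge0_ler_powR ?nnegrE ?powR_ge0//; first by lra.
        by apply: (le_trans t0); exact: ltW.
      by apply: (le_trans At); exact: ltW.
    by apply: (le_trans fI); rewrite lee_fin ge_min lexx orbT.
  have S2le : (mu S2 <= eta%:E)%E.
    by apply: (le_trans vM); rewrite lee_fin ge_min lexx.
  apply: (@le_trans _ _ (mu (S1 `|` S2))).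
    apply: le_measure; rewrite ?inE; [exact: mS|exact: measurableU|].
    move=> x; rewrite /S /S1 /S2 /= -/delta.
    move: (singular_solution s p C (T' j) t x) => y ywx.
    have [h1|h1] := leP delta `|v n t x - w x|; [by right|left].
    by move: h1; rewrite ltr_norml => /andP[h1 h2]; lra.
  apply: (le_trans (measureU2 _ mS1 mS2)).
  by rewrite mulr_natl mulr2n EFinD leeD.
have : {ae mu, forall x, forall j k, ~ S j k x}.
  apply/ae_foralln => j; apply/ae_foralln => k.
  by apply: ae_notin_null; [exact: mS|exact: S0].
apply: filterS => x Sx.
pose E := C * eucl_norm x `^ (- (s * p / (2 - p))).
have E0 : 0 <= E by rewrite mulr_ge0 ?powR_ge0// ltW.
apply: (@le0_natSinv _ (E + 3)); first by rewrite addr_ge0.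
move=> k; have := Sx k k; rewrite /S /= => /negP; rewrite -leNgt => /le_trans; apply.
rewrite [leRHS]mulrDl lerD// /singular_solution /T' [t + _]addrC addrK mulrAC -/E.
rewrite ler_wpM2l// ge1r_powR// invr_gt0 ltr0Sn/= invf_le1// ler1n//.
Unshelve. all: by end_near. Qed.

End extinction.

(** * The extinction time *)

Section extinction_time.
Context {R : realType} {N : nat}.
Local Notation mu := (leb R N).
Local Notation T := (N.-tuple R).
Implicit Types (s p q t e A C delta eta : R) (x : T) (f g h : T -> R)
  (v z w : R -> T -> R) (u : R -> T -> \bar R).

Lemma norm_dist_refl q f : 1 <= q -> norm_dist q f f = 0%E.
Proof.
move=> q1; rewrite /norm_dist (_ : EFin \o _ = cst 0%E); last first.
  by apply/funext => x /=; rewrite subrr.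
by rewrite Lnorm0// eqe gt_eqF//; lra.
Qed.

Lemma norm_dist_tri q f g h : 1 <= q -> measurable_fun setT f ->
  measurable_fun setT g -> measurable_fun setT h ->
  (norm_dist q f g <= norm_dist q f h + norm_dist q g h)%E.
Proof.
move=> q1 mf mg mh; rewrite -(norm_distN q g h) /norm_dist.
have -> : f \- g = (f \- h) \+ (\- g \- \- h).
  by apply/funext => x /=; ring.
apply: minkowski_EFin => //; first exact: measurable_funB.
by apply: measurable_funB; exact: measurable_funN.
Qed.

Lemma L2_nonpositive s p C A t f v : (0 < N)%N -> 0 < s < 1 -> 1 < p -> p < 2 ->
  is_C_infty N s p C -> 0 < A -> (A / C) `^ (2 - p) <= t ->
  L2_semigroup_solution s p f v ->
  {ae mu, forall x, f x <= A * eucl_norm x `^ (- (s * p / (2 - p)))} ->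
  {ae mu, forall x, v t x <= 0}.
Proof.
move=> N0 hs p1 p2 hC A0 At sol fA; have [f2 v2 _ _ _] := sol.
have t0 : 0 <= t by exact: le_trans (powR_ge0 _ _) At.
have q1 : 1 <= 2 :> R by lra.
apply: (@Lq_limit_nonpositive R N s p C A 2 t (fun=> f) (fun=> v) f) => //.
- exact: Lfun_measurable f2.
- exact: Lfun_measurable (v2 _ t0).
- by rewrite norm_dist_refl//; exact: cvg_cst.
- by rewrite norm_dist_refl//; exact: cvg_cst.
Qed.

(** The opposite solution has a nonpositive datum, hence lies below the singular
    solution that vanishes at the time [t] itself. *)
Lemma L2_solution_nonneg s p C t f v : (0 < N)%N -> 0 < s < 1 -> 1 < p -> p < 2 ->
  is_C_infty N s p C -> 0 < t -> L2_semigroup_solution s p f v ->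
  {ae mu, forall x, 0 <= f x} -> {ae mu, forall x, 0 <= v t x}.
Proof.
move=> N0 hs p1 p2 hC t0 sol f0; have C0 : 0 < C by case: hC.
have q0 : 0 < 2 - p by lra.
suff : {ae mu, forall x, (\- v t) x <= 0}.
  by apply: filterS => x /=; rewrite oppr_le0.
have A0 : 0 < C * t `^ (2 - p)^-1 by rewrite mulr_gt0// powR_gt0.
apply: (L2_nonpositive N0 hs p1 p2 hC A0 _ (L2_semigroup_solutionN sol)).
  rewrite [C * _]mulrC mulfK ?gt_eqF// -powRrM mulVf ?gt_eqF// powRr1//.
  exact: ltW.
apply: filterS f0 => x fx; apply: (@le_trans _ _ 0); first by rewrite /= oppr_le0.
by rewrite mulr_ge0 ?powR_ge0// ltW.
Qed.

(** The T-contraction with a vanishing right-hand side, at all heights. *)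
Lemma L2_solution_order s p t f g v z : 1 < p -> 0 <= t ->
  L2_semigroup_solution s p f v -> L2_semigroup_solution s p g z ->
  {ae mu, forall x, f x <= g x} -> {ae mu, forall x, v t x <= z t x}.
Proof.
move=> p1 t0 solv solz fg; have [f2 v2 _ _ _] := solv; have [g2 z2 _ _ _] := solz.
have mvz : measurable_fun setT (fun x => v t x - z t x).
  exact: Lfun_measurable (Lfun2B (v2 _ t0) (z2 _ t0)).
pose S (k : nat) : set T := [set x | 2 * k.+1%:R^-1 < v t x - z t x].
have mS k : measurable (S k) by apply: measurable_ltr_set => //; exact: measurable_cst.
have S0 k : mu (S k) = 0%E.
  have d0 : 0 < k.+1%:R^-1 :> R by rewrite invr_gt0.
  apply/eqP; rewrite -measure_le0.
  rewrite -(@lee_pmul2l _ (huber k.+1%:R^-1)%:E) ?lte_fin ?huber_gt0// mule0.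
  apply: (le_trans (L2_T_contraction_weak p1 d0 t0 solv solz)).
  rewrite (ae_eq_integral (cst 0%E)) ?integral0//.
    apply/measurable_EFinP; apply: measurable_maxr => //; apply: measurable_funB => //.
    exact: Lfun_measurable (Lfun2B f2 g2).
  apply: filterS fg => x fgx _ /=; congr EFin; apply/max_idPr.
  by rewrite -addrA -opprD subr_le0 (le_trans fgx)// lerDl ltW.
have : {ae mu, forall x, forall k, ~ S k x}.
  by apply/ae_foralln => k; exact: ae_notin_null (mS k) (S0 k).
apply: filterS => x Sx; rewrite -subr_le0; apply: (@le0_natSinv _ _ 2) => // k.
by have := Sx k; rewrite /S /= => /negP; rewrite -leNgt.
Qed.

(** Right continuity in measure at [tau].  The T-contraction makes the convergence of
    the approximations uniform in time, in measure, and each approximation is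
    continuous in L^2.  Concretely, [w tau] is compared with [w t = 0], for [t]
    slightly larger than [tau], through [v n tau], [v n t] and [v m t]: here [n] is
    fixed before [t] is, while [m] depends on [t], and the contraction compares
    [v n t] with [v m t]. *)
Lemma Lq_vanishing_right_closed s p q (f : nat -> T -> R)
    (v : nat -> R -> T -> R) h w tau : 1 < p -> 1 <= q -> 0 <= tau ->
  measurable_fun setT h -> (forall t, 0 <= t -> measurable_fun setT (w t)) ->
  (forall n, L2_semigroup_solution s p (f n) (v n)) ->
  norm_dist q (f n) h @[n --> \oo] --> 0%E ->
  (forall t, 0 <= t -> norm_dist q (v n t) (w t) @[n --> \oo] --> 0%E) ->
  (forall t, tau < t -> {ae mu, forall x, w t x = 0}) ->
  {ae mu, forall x, w tau x = 0}.
Proof.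
move=> p1 q1 tau0 mh mw sol fh vw w0.
(* In units of [delta], the three distances are less than 1 and the contraction
   costs 2 in either direction. *)
pose S (k : nat) : set T := [set x | 5 * k.+1%:R^-1 <= `|w tau x|].
have mnorm (a : T -> R) : measurable_fun setT a -> measurable_fun setT (fun x => `|a x|).
  by move=> ma; apply: (measurableT_comp (@normr_measurable _ setT)).
have mS k : measurable (S k).
  by apply: measurable_ler_set; [exact: measurable_cst|apply: mnorm; exact: mw].
have S0 k : mu (S k) = 0%E.
  apply/eqP; rewrite -measure_le0; apply: (@lee0_small _ _ 5) => // eta eta0.
  pose delta : R := k.+1%:R^-1; have d0 : 0 < delta by rewrite invr_gt0.
  have hd0 : 0 < huber delta by exact: huber_gt0.
  have e1 : 0 < Num.min eta (huber delta * eta) by rewrite lt_min eta0 mulr_gt0.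
  have [rho rho0 mod_rho] := @lq_modulus R N q delta _ q1 d0 e1.
  have r20 : 0 < rho / 2 by rewrite divr_gt0.
  have q2 : 1 <= 2 :> R by lra.
  have [rho2 rho20 mod_rho2] := @lq_modulus R N 2 delta _ q2 d0 eta0.
  have mv n t : 0 <= t -> measurable_fun setT (v n t).
    by move=> t0; have [_ v2 _ _ _] := sol n; exact: Lfun_measurable (v2 _ t0).
  have mf n : measurable_fun setT (f n).
    by have [f2 _ _ _ _] := sol n; exact: Lfun_measurable f2.
  have [n0 _ fn0] := norm_dist_lt r20 fh.
  have [n1 _ vn1] := norm_dist_lt rho0 (vw tau tau0).
  pose n := maxn n0 n1.
  have [_ cont _] := L2_solution_curve (sol n).
  have [d dp hd] := cont tau tau0 rho2 rho20.
  pose t := tau + d / 2.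
  have taut : tau < t by rewrite ltrDl divr_gt0.
  have t0 : 0 <= t by rewrite (le_trans tau0)// ltW.
  have [n2 _ vn2] := norm_dist_lt rho0 (vw t t0).
  pose m := maxn n0 n2.
  have split_le (a b : T -> R) : (mu [set x | (delta <= `|a x - b x|)%R] <=
      (Num.min eta (huber delta * eta))%:E)%E ->
      (mu [set x | (delta <= `|a x - b x|)%R] <= eta%:E)%E.
    by move=> /le_trans; apply; rewrite lee_fin ge_min lexx.
  have S1le : (mu [set x | (delta <= `|v n tau x - w tau x|)%R] <= eta%:E)%E.
    apply: split_le; apply: (mod_rho _ _ (mv n tau tau0) (mw tau tau0) _).1.
    by apply: vn1; rewrite /= leq_maxr.
  have S2le : (mu [set x | (delta <= `|v n t x - v n tau x|)%R] <= eta%:E)%E.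
    apply: (mod_rho2 _ _ (mv n t t0) (mv n tau tau0) _).1.
    have [_ v2 _ _ _] := sol n.
    rewrite norm_dist2E ?v2// lee_fin ltW// hd//.
    by rewrite /t addrAC subrr add0r gtr0_norm ?divr_gt0//; lra.
  have S3le : (mu [set x | (delta <= `|v m t x - w t x|)%R] <= eta%:E)%E.
    apply: split_le; apply: (mod_rho _ _ (mv m t t0) (mw t t0) _).1.
    by apply: vn2; rewrite /= leq_maxr.
  have contr (i j : nat) : (n0 <= i)%N -> (n0 <= j)%N ->
      (mu [set x | (2 * delta < v i t x - v j t x)%R] <= eta%:E)%E.
    move=> i0 j0; apply: (measure_le_fineM hd0).
    apply: (le_trans (L2_T_contraction_weak p1 d0 t0 (sol i) (sol j))).
    have fij : (norm_dist q (f i) (f j) <= rho%:E)%E.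
      apply: (le_trans (norm_dist_tri q1 (mf i) (mf j) mh)).
      by rewrite (splitr rho) EFinD leeD//; exact: fn0.
    have [_ I] := mod_rho _ _ (mf i) (mf j) fij.
    apply: (@le_trans _ _ (huber delta * eta)%:E); last by [].
    apply: (@le_trans _ _ (Num.min eta (huber delta * eta))%:E); last first.
      by rewrite lee_fin ge_min lexx orbT.
    apply: le_trans I; apply: ge0_le_integral => //.
    - by move=> x _; rewrite lee_fin le_max lexx orbT.
    - apply/measurable_EFinP; apply: measurable_maxr => //; apply: measurable_funB => //.
      exact: measurable_funB.
    - apply/measurable_EFinP; apply: measurable_maxr => //; apply: measurable_funB => //.
      by apply: mnorm; exact: measurable_funB.
    - move=> x _; rewrite lee_fin ge_max !le_max lexx orbT andbT.
      by rewrite lerB ?ler_norm.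
  have S4le := contr n m (leq_maxl _ _) (leq_maxl _ _).
  have S5le := contr m n (leq_maxl _ _) (leq_maxl _ _).
  set S1 := [set x | _] in S1le; set S2 := [set x | _] in S2le.
  set S3 := [set x | _] in S3le; set S4 := [set x | _] in S4le.
  set S5 := [set x | _] in S5le.
  have mS1 : measurable S1.
    apply: measurable_ler_set; first exact: measurable_cst.
    by apply: mnorm; apply: measurable_funB; [exact: mv|exact: mw].
  have mS2 : measurable S2.
    apply: measurable_ler_set; first exact: measurable_cst.
    by apply: mnorm; apply: measurable_funB; exact: mv.
  have mS3 : measurable S3.
    apply: measurable_ler_set; first exact: measurable_cst.
    by apply: mnorm; apply: measurable_funB; [exact: mv|exact: mw].
  have mS4 : measurable S4.
    apply: measurable_ltr_set; first exact: measurable_cst.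
    by apply: measurable_funB; exact: mv.
  have mS5 : measurable S5.
    apply: measurable_ltr_set; first exact: measurable_cst.
    by apply: measurable_funB; exact: mv.
  have m12 : measurable (S1 `|` S2) by exact: measurableU.
  have m123 : measurable (S1 `|` S2 `|` S3) by exact: measurableU.
  have m1234 : measurable (S1 `|` S2 `|` S3 `|` S4) by exact: measurableU.
  have mall : measurable (S1 `|` S2 `|` S3 `|` S4 `|` S5) by exact: measurableU.
  apply: (@le_trans _ _ (mu (S1 `|` S2 `|` S3 `|` S4 `|` S5))).
    apply: ae_le_measure => //; apply: filterS (w0 t taut) => x wt0 Sx.
    apply: contrapT => /not_orP[/not_orP[/not_orP[/not_orP[h1 h2] h3] h4] h5].
    move: Sx; rewrite /S /=; apply/negP; rewrite -ltNge -/delta.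
    move: h1 h2 h3 h4 h5; rewrite /S1 /S2 /S3 /S4 /S5 /= wt0 subr0.
    move=> /negP; rewrite -ltNge ltr_norml => /andP[a1 a2].
    move=> /negP; rewrite -ltNge ltr_norml => /andP[b1 b2].
    move=> /negP; rewrite -ltNge ltr_norml => /andP[c1 c2].
    move=> /negP; rewrite -leNgt => e4.
    move=> /negP; rewrite -leNgt => e5.
    rewrite ltr_norml; apply/andP; split; lra.
  have -> : (5 * eta)%:E = (eta%:E + eta%:E + eta%:E + eta%:E + eta%:E)%E.
    by rewrite -!EFinD; congr EFin; ring.
  apply: (le_trans (measureU2 _ m1234 mS5)); apply: leeD => //.
  apply: (le_trans (measureU2 _ m123 mS4)); apply: leeD => //.
  apply: (le_trans (measureU2 _ m12 mS3)); apply: leeD => //.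
  by apply: (le_trans (measureU2 _ mS1 mS2)); apply: leeD.
have : {ae mu, forall x, forall k, ~ S k x}.
  by apply/ae_foralln => k; exact: ae_notin_null (mS k) (S0 k).
apply: filterS => x Sx; apply/eqP; rewrite -normr_le0.
apply: (@le0_natSinv _ _ 5) => // k.
by have := Sx k; rewrite /S /= => /negP; rewrite -ltNge => /ltW.
Qed.

Lemma L2_vanishing_right_closed s p f v tau : 1 < p -> 0 <= tau ->
  L2_semigroup_solution s p f v ->
  (forall t, tau < t -> {ae mu, forall x, v t x = 0}) ->
  {ae mu, forall x, v tau x = 0}.
Proof.
move=> p1 tau0 sol; have [f2 v2 _ _ _] := sol.
have q1 : 1 <= 2 :> R by lra.
apply: (@Lq_vanishing_right_closed s p 2 (fun=> f) (fun=> v) f) => //.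
- exact: Lfun_measurable f2.
- by move=> t t0; exact: Lfun_measurable (v2 _ t0).
- by rewrite norm_dist_refl//; exact: cvg_cst.
- by move=> t t0; rewrite norm_dist_refl//; exact: cvg_cst.
Qed.

(** The infimum of the times from which [u] vanishes is one of them, because
    vanishing just after a time implies vanishing at that time. *)
Lemma extinction_time_exists u (T0 : R) : 0 <= T0 -> vanishes_from u T0 ->
  (forall tau, 0 <= tau ->
    (forall t, tau < t -> {ae mu, forall x, u t x = 0%E}) ->
    {ae mu, forall x, u tau x = 0%E}) ->
  exists T1, is_extinction_time u T1 /\ T1 <= T0.
Proof.
move=> T00 uT0 closed; pose S := [set r : R | 0 <= r /\ vanishes_from u r].
have S0 : S T0 by [].
have hS : has_inf S by split; [exists T0|exists 0 => r []].
exists (inf S).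
have infT r : S r -> inf S <= r by move=> Sr; apply: ge_inf => //; case: hS.
have inf0 : 0 <= inf S by apply: lb_le_inf; [exists T0|move=> r []].
have later t : inf S < t -> {ae mu, forall x, u t x = 0%E}.
  move=> st; have d0 : 0 < t - inf S by rewrite subr_gt0.
  have [r [r0 ur]] := inf_adherent d0 hS.
  by rewrite addrC subrK => /ltW rt; exact: ur.
split; last exact: infT.
split => //.
- move=> t; rewrite le_eqVlt => /predU1P[<-|]; last exact: later.
  exact: closed.
- by move=> r r0 ur; apply: infT.
Qed.

Lemma le0_barrier s p A f : 0 < A -> {ae mu, forall x, 0 <= f x} ->
  {ae mu, forall x, (\- f) x <= A * eucl_norm x `^ (- (s * p / (2 - p)))}.
Proof.
move=> A0; apply: filterS => x fx; apply: (@le_trans _ _ 0).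
  by rewrite /= oppr_le0.
by rewrite mulr_ge0 ?powR_ge0// ltW.
Qed.

(** Both [w] and [- w] are solutions with data below the singular profile. *)
Lemma Lq_solution_extinct s p C A q t f w : (0 < N)%N -> 0 < s < 1 -> 1 < p ->
  p < 2 -> is_C_infty N s p C -> 0 < A -> 1 <= q -> (A / C) `^ (2 - p) <= t ->
  Lq_semigroup_solution s p q f w -> {ae mu, forall x, 0 <= f x} ->
  {ae mu, forall x, f x <= A * eucl_norm x `^ (- (s * p / (2 - p)))} ->
  {ae mu, forall x, w t x = 0}.
Proof.
move=> N0 hs p1 p2 hC A0 q1 tT [f2 w2 [g [v [_ sol gf vw]]]] f0 fA.
have t0 : 0 <= t by exact: le_trans (powR_ge0 _ _) tT.
have mf := Lfun_measurable f2; have mw := Lfun_measurable (w2 _ t0).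
have up := Lq_limit_nonpositive N0 hs p1 p2 hC A0 q1 tT mf mw sol gf (vw t t0) fA.
have mnf : measurable_fun setT (\- f) by exact: measurable_funN.
have mnw : measurable_fun setT (\- w t) by exact: measurable_funN.
have ngf : norm_dist q (\- g n) (\- f) @[n --> \oo] --> 0%E.
  by under eq_fun do rewrite norm_distN.
have nvw : norm_dist q (\- v n t) (\- w t) @[n --> \oo] --> 0%E.
  by under eq_fun do rewrite norm_distN; exact: vw.
have down := @Lq_limit_nonpositive R N s p C A q t (fun n => \- g n)
  (fun n t => \- v n t) (\- f) (\- w t) N0 hs p1 p2 hC A0 q1 tT mnf mnw
  (fun n => L2_semigroup_solutionN (sol n)) ngf nvw (le0_barrier s p A0 f0).
move: up down; apply: filterS2 => x wx /=; rewrite oppr_le0 => wx'.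
by apply/le_anti; rewrite wx wx'.
Qed.

Lemma L2_solution_extinct s p C A t f v : (0 < N)%N -> 0 < s < 1 -> 1 < p ->
  p < 2 -> is_C_infty N s p C -> 0 < A -> (A / C) `^ (2 - p) <= t ->
  L2_semigroup_solution s p f v -> {ae mu, forall x, 0 <= f x} ->
  {ae mu, forall x, f x <= A * eucl_norm x `^ (- (s * p / (2 - p)))} ->
  {ae mu, forall x, v t x = 0}.
Proof.
move=> N0 hs p1 p2 hC A0 tT sol f0 fA.
have up := L2_nonpositive N0 hs p1 p2 hC A0 tT sol fA.
have down := L2_nonpositive N0 hs p1 p2 hC A0 tT (L2_semigroup_solutionN sol)
  (le0_barrier s p A0 f0).
move: up down; apply: filterS2 => x vx /=; rewrite oppr_le0 => vx'.
by apply/le_anti; rewrite vx vx'.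
Qed.

Lemma ae_lim0 (a : nat -> T -> R) (b : T -> \bar R) :
  {ae mu, forall x, (a n x)%:E @[n --> \oo] --> b x} ->
  (forall n, {ae mu, forall x, a n x = 0}) -> {ae mu, forall x, b x = 0%E}.
Proof.
move=> ab a0; have : {ae mu, forall x, forall n, a n x = 0} by exact/ae_foralln.
move: ab; apply: filterS2 => x abx ax.
have e : (fun n => (a n x)%:E) = cst 0%E by apply/funext => n; rewrite ax.
by rewrite e in abx; rewrite -(cvg_lim _ abx)// lim_cst.
Qed.

Lemma ae_le_monotone_limit (a : nat -> T -> R) (b : T -> R) :
  {ae mu, forall x, forall n, a n x <= a n.+1 x} ->
  {ae mu, forall x, a n x @[n --> \oo] --> b x} ->
  {ae mu, forall x, forall n, a n x <= b x}.
Proof.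
apply: filterS2 => x ax abx n; rewrite -(cvg_lim _ abx)//.
apply: nondecreasing_cvgn_le; last by apply/cvg_ex; exists (b x).
exact/nondecreasing_seqP.
Qed.

(** A minimal solution dominates its approximations, which increase with their
    data; so they all vanish where it does. *)
Lemma minimal_vanishing_right_closed s p C f u tau : (0 < N)%N -> 0 < s < 1 ->
  1 < p -> p < 2 -> is_C_infty N s p C -> 0 <= tau -> minimal_solution s p f u ->
  (forall t, tau < t -> {ae mu, forall x, u t x = 0%E}) ->
  {ae mu, forall x, u tau x = 0%E}.
Proof.
move=> N0 hs p1 p2 hC tau0 [_ [g [v [_ gmon _ sol vu]]]] u0.
have g0 n : {ae mu, forall x, 0 <= g n x}.
  by apply: filterS gmon => x /(_ n)/andP[].
apply: (ae_lim0 (vu tau tau0)) => n.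
apply: (L2_vanishing_right_closed p1 tau0 (sol n)) => t taut.
have t0 : 0 < t by exact: le_lt_trans taut.
have order k : {ae mu, forall x, v k t x <= v k.+1 t x}.
  apply: (L2_solution_order p1 (ltW t0) (sol k) (sol k.+1)).
  by apply: filterS gmon => x /(_ k)/andP[].
have cv0 : {ae mu, forall x, v n t x @[n --> \oo] --> (cst 0 x : R)}.
  move: (vu t (ltW t0)) (u0 t taut); apply: filterS2 => x + ux.
  by rewrite ux => /fine_cvgP[].
have mon : {ae mu, forall x, forall n, v n t x <= v n.+1 t x} by exact/ae_foralln.
have up := ae_le_monotone_limit mon cv0.
have down := L2_solution_nonneg N0 hs p1 p2 hC t0 (sol n) (g0 n).
move: up down; apply: filterS2 => x /(_ n) vx vx'.
by apply/le_anti; rewrite vx vx'.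
Qed.

End extinction_time.

Unset Implicit Arguments.

Theorem proposition8p1 (R : realType) (N : nat) (s p C A : R)
    (u0 : N.-tuple R -> R) (u : R -> N.-tuple R -> \bar R) :
  (2 <= N)%N ->
  0 < s < 1 ->
  1 < p < 2 * N%:R / (N%:R + s) ->
  is_C_infty N s p C ->
  0 < A ->
  measurable_fun [set: N.-tuple R] u0 ->
  {ae leb R N, forall x, 0 <= u0 x} ->
  {ae leb R N, forall x, u0 x <= A * eucl_norm x `^ (- (s * p / (2 - p)))} ->
  is_solution s p u0 u ->
  exists T : R, is_extinction_time u T /\ T <= (A / C) `^ (2 - p).
Proof.
move=> N2 hs /andP[p1 pc] hC A0 _ u00 u0A sol.
have N0 : (0 < N)%N by exact: leq_trans N2.
have p2 : p < 2.
  apply: (lt_le_trans pc); have /andP[s0 _] := hs.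
  have n0 : 0 <= N%:R :> R by exact: ler0n.
  by rewrite ler_pdivrMr; lra.
case: sol => [[q [w [q1 wsol uw]]]|minu].
- have [u0q wq [g [v [_ gsol gu0 vw]]]] := wsol.
  have uw0 t : 0 <= t -> {ae leb R N, forall x, u t x = 0%E} ->
      {ae leb R N, forall x, w t x = 0}.
    move=> t0; move: (uw t t0); apply: filterS2 => x -> [].
    exact.
  have wu0 t : 0 <= t -> {ae leb R N, forall x, w t x = 0} ->
      {ae leb R N, forall x, u t x = 0%E}.
    by move=> t0; move: (uw t t0); apply: filterS2 => x -> ->.
  apply: extinction_time_exists; first exact: powR_ge0.
    move=> t tT; apply: wu0; first exact: le_trans (powR_ge0 _ _) tT.
    exact: (Lq_solution_extinct N0 hs p1 p2 hC A0 q1 tT wsol).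
  move=> tau tau0 later; apply: wu0 => //.
  apply: (Lq_vanishing_right_closed p1 q1 tau0 (Lfun_measurable u0q) _ gsol gu0 vw).
    by move=> t t0; exact: Lfun_measurable (wq _ t0).
  move=> t taut; apply: uw0; last exact: later.
  by apply: (le_trans tau0); exact: ltW.
apply: extinction_time_exists; first exact: powR_ge0.
  have [_ [g [v [_ gmon gu0 gsol vu]]]] := minu.
  move=> t tT; have t0 : 0 <= t by exact: le_trans (powR_ge0 _ _) tT.
  apply: (ae_lim0 (vu t t0)) => n.
  apply: (L2_solution_extinct N0 hs p1 p2 hC A0 tT (gsol n)).
    by apply: filterS gmon => x /(_ n)/andP[].
  have mon : {ae leb R N, forall x, forall n, g n x <= g n.+1 x}.
    by apply: filterS gmon => x gx k; have /andP[] := gx k.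
  move: (ae_le_monotone_limit mon gu0) u0A; apply: filterS2 => x gx.
  exact: le_trans.
by move=> tau tau0; exact: (minimal_vanishing_right_closed N0 hs p1 p2 hC tau0 minu).
Qed.
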